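(* Let $c>\left(\frac{4\pi}3\right)^{1/4}$. There exists a set of nonnegative integers $A$ such that $A^2+A^2=\mathbb{N}_0$ and $A(X)\sim \frac{2c\sqrt{X}}{(\log X)^{1/4}}$ as $X\to\infty$.
   Context: $\mathbb{N}_0$ is the set of nonnegative integers. $A^2=\{ab:a,b\in A\}$, $A^2+A^2=\{x+y: x,y\in A^2\}$. $A(X)=|A\cap[1,X]|$. *)

(* Defs.v *)
From Stdlib Require Import Reals List Arith Bool.
From Coquelicot Require Import Coquelicot.
Open Scope R_scope.

(* A^2 + A^2 = N_0 : every n is a*b + c*d with a,b,c,d in A
   (the reverse inclusion is automatic). *)
Definition sumsq_products_all (A : nat -> bool) : Prop :=
  forall n : nat, exists a b c d : nat,
    A a = true /\ A b = true /\ A c = true /\ A d = true /\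
    n = (a * b + c * d)%nat.

(* A(X) = |A ∩ [1, X]| for real X.  up X is an integer > X, so the
   list 1 .. Z.to_nat (up X) covers every integer n with 1 <= n <= X. *)
Definition counting (A : nat -> bool) (X : R) : nat :=
  length (filter (fun n => andb (A n) (if Rle_dec (INR n) X then true else false))
                 (seq 1 (Z.to_nat (up X)))).

(* Main.v *)
Require Import Defs.
From Stdlib Require Import Reals List Arith ZArith Bool Lia Lra ClassicalEpsilon.
From Coquelicot Require Import Coquelicot.
Open Scope R_scope.

(** Proof idea. Cut the nonnegative integers into consecutive blocks [block j], the [j]-th one
    starting near [K j^2 sqrt (ln j)] with [K = sqrt 2 / (4 c^2)], and pick one element
    [al j] uniformly and independently in each block; whatever the choice, the resulting set
    has counting function asymptotic to [2 c sqrt X / (ln X)^(1/4)].  To it are added [0], [1] and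
    every [n] that is missed, i.e. not of the form [al i * al j + al k * al l], because then
    [n = n * 1 + 0 * 0]; so it suffices that the missed numbers up to [X] are [O(X^(19/40))],
    which follows once [n] is missed with probability at most [n^(-11/20)].

    For the latter, take [n = q^400].  The indices of [a, c] range below [q^98] and are revealed first;
    those of [b, d] are above [q^100].  With [a, c] fixed, [n] is missed
    only if the random set contains no edge [{b, d}] of the graph [a b + c d = n], and a Janson-type
    inequality bounds the probability of this by [exp (- (1 - o(1)) mu)], where [mu] is the expected
    number of edges.  Since [b d <= n^2 / (4 a c)] by AM-GM, [mu] is at least a sum over coprime
    pairs [(a, c)] of explicit weights, and the same inequality, applied now to the choice of
    [a, c], shows that the expectation of [exp (- mu)] is at most [exp (- (1 - o(1)) E mu)].
    As at least half of the pairs [(a, c)] are coprime, this is below [n^(-11/20)] as soon as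
    the fourth power of the constant of the theorem is at least [4 < 4 pi / 3]. *)

(** * Finite sums and averages *)

(** So [n] is missed with probability at most a negative power of [n], whose exponent scales like
    [1 / K^2], that is like [c^4]. The exponent must exceed 1/2, because the missed numbers have to
    be negligible against [sqrt X / (ln X)^(1/4)]; with 11/20 their expected number is about
    [X^(9/20)], and 19/40 lies between 9/20 and 1/2. A representation involves four picks, so it is
    not an edge of a graph. Revealing the two small picks first leaves a genuine graph, and one
    whose degrees are tiny. The powers of [q] separate the scales: each spare factor [q] absorbs
    logarithms, [K], or a divisor function. All probabilities are finite averages. The infinite
    choice is built at the end by conditional expectations, one block at a time. *)

Definition Rsum {T : Type} (l : list T) (f : T -> R) : R :=
  fold_right (fun x s => f x + s) 0 l.

Lemma Rsum_ext {T} (l : list T) f g :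
  (forall x, In x l -> f x = g x) -> Rsum l f = Rsum l g.
Proof.
  induction l as [|a l IH]; intros H; simpl; [reflexivity|].
  rewrite (H a) by (left; reflexivity). rewrite IH; auto.
  intros x Hx; apply H; right; exact Hx.
Qed.

Lemma Rsum_le {T} (l : list T) f g :
  (forall x, In x l -> f x <= g x) -> Rsum l f <= Rsum l g.
Proof.
  induction l as [|a l IH]; intros H; simpl; [lra|].
  apply Rplus_le_compat; [apply H; left; reflexivity|].
  apply IH. intros x Hx; apply H; right; exact Hx.
Qed.

Lemma Rsum_zero {T} (l : list T) : Rsum l (fun _ => 0) = 0.
Proof. induction l as [|a l IH]; simpl; [|rewrite IH]; lra. Qed.

Lemma Rsum_eq0 {T} (l : list T) f : (forall x, In x l -> f x = 0) -> Rsum l f = 0.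
Proof. intros H. rewrite (Rsum_ext l f (fun _ => 0)) by exact H. apply Rsum_zero. Qed.

Lemma Rsum_nonneg {T} (l : list T) f :
  (forall x, In x l -> 0 <= f x) -> 0 <= Rsum l f.
Proof. intros H. rewrite <- (Rsum_zero l). apply Rsum_le, H. Qed.

Lemma Rsum_plus {T} (l : list T) f g :
  Rsum l (fun x => f x + g x) = Rsum l f + Rsum l g.
Proof. induction l as [|a l IH]; simpl; [|rewrite IH]; lra. Qed.

Lemma Rsum_scal {T} (l : list T) k f : Rsum l (fun x => k * f x) = k * Rsum l f.
Proof. induction l as [|a l IH]; simpl; [|rewrite IH]; lra. Qed.

Lemma Rsum_const {T} (l : list T) k : Rsum l (fun _ => k) = INR (length l) * k.
Proof.
  induction l as [|a l IH]; [simpl; lra|].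
  change (length (a :: l)) with (S (length l)). rewrite S_INR. simpl. rewrite IH. lra.
Qed.

Lemma Rsum_swap {T U} (l : list T) (l' : list U) f :
  Rsum l (fun x => Rsum l' (fun y => f x y)) = Rsum l' (fun y => Rsum l (fun x => f x y)).
Proof.
  induction l as [|a l IH]; simpl; [symmetry; apply Rsum_zero|].
  rewrite IH, <- Rsum_plus. reflexivity.
Qed.

Lemma Rsum_app {T} (l l' : list T) f : Rsum (l ++ l') f = Rsum l f + Rsum l' f.
Proof. induction l as [|a l IH]; simpl; [|rewrite IH]; lra. Qed.

Lemma Rsum_map {T U} (l : list T) (h : T -> U) f :
  Rsum (map h l) f = Rsum l (fun x => f (h x)).
Proof. induction l as [|a l IH]; simpl; [|rewrite IH]; reflexivity. Qed.

Lemma Rsum_flat_map {T U} (l : list T) (h : T -> list U) f :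
  Rsum (flat_map h l) f = Rsum l (fun x => Rsum (h x) f).
Proof. induction l as [|a l IH]; simpl; [|rewrite Rsum_app, IH]; reflexivity. Qed.

Lemma Rsum_term {T} (l : list T) f a :
  In a l -> (forall x, In x l -> 0 <= f x) -> f a <= Rsum l f.
Proof.
  induction l as [|b l IH]; simpl; intros Ha Hf; [tauto|].
  destruct Ha as [->|Ha].
  - assert (0 <= Rsum l f) by (apply Rsum_nonneg; auto). lra.
  - assert (0 <= f b) by auto. assert (f a <= Rsum l f) by auto. lra.
Qed.

Lemma Rsum_incl {T} (l l' : list T) f :
  NoDup l -> incl l l' -> (forall x, In x l' -> 0 <= f x) -> Rsum l f <= Rsum l' f.
Proof.
  revert l'. induction l as [|a l IH]; intros l' Hn Hi Hf.
  - simpl. apply Rsum_nonneg, Hf.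
  - inversion Hn as [|? ? Ha Hn']; subst.
    destruct (in_split a l') as (l1 & l2 & ->); [apply Hi; left; reflexivity|].
    assert (Hle : Rsum l f <= Rsum (l1 ++ l2) f).
    { apply IH; [exact Hn'| |].
      - intros x Hx. assert (Hx' : In x (l1 ++ a :: l2)) by (apply Hi; right; exact Hx).
        apply in_app_iff in Hx'. apply in_app_iff.
        destruct Hx' as [|[->|]]; tauto.
      - intros x Hx. apply Hf. apply in_app_iff in Hx. apply in_app_iff. simpl. tauto. }
    rewrite Rsum_app in *. simpl. lra.
Qed.

Lemma Rsum_single {T} (l : list T) f a :
  NoDup l -> 0 <= f a -> (forall x, In x l -> x <> a -> f x = 0) -> Rsum l f <= f a.
Proof.
  induction l as [|b l IH]; simpl; intros Hn Ha H; [exact Ha|].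
  inversion Hn as [|? ? Hb Hn']; subst.
  destruct (excluded_middle_informative (b = a)) as [->|E].
  - rewrite (Rsum_eq0 l); [lra|]. intros x Hx. apply H; [tauto|]. intros ->. contradiction.
  - rewrite (H b) by tauto. assert (Rsum l f <= f a) by (apply IH; auto). lra.
Qed.

Lemma Rsum_seq_split m k k' f :
  Rsum (seq m (k + k')) f = Rsum (seq m k) f + Rsum (seq (m + k) k') f.
Proof. rewrite seq_app, Rsum_app. reflexivity. Qed.

Definition avg (l : list nat) (f : nat -> R) : R := Rsum l f / INR (length l).

Lemma avg_ext l f g : (forall x, In x l -> f x = g x) -> avg l f = avg l g.
Proof. intros H. unfold avg. rewrite (Rsum_ext l f g H). reflexivity. Qed.

Lemma length_pos {T} (l : list T) : l <> nil -> 0 < INR (length l).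
Proof. intros H. destruct l; [congruence|]. apply lt_0_INR. simpl; lia. Qed.

Lemma avg_le l f g : l <> nil -> (forall x, In x l -> f x <= g x) -> avg l f <= avg l g.
Proof.
  intros Hl H. unfold avg, Rdiv. apply Rmult_le_compat_r.
  - left. apply Rinv_0_lt_compat, length_pos, Hl.
  - apply Rsum_le, H.
Qed.

Lemma avg_const l k : l <> nil -> avg l (fun _ => k) = k.
Proof.
  intros Hl. unfold avg. rewrite Rsum_const. pose proof (length_pos l Hl). field. lra.
Qed.

Lemma avg_nonneg l f : l <> nil -> (forall x, In x l -> 0 <= f x) -> 0 <= avg l f.
Proof. intros Hl H. rewrite <- (avg_const l 0 Hl). apply avg_le; assumption. Qed.

Lemma avg_plus l f g : avg l (fun x => f x + g x) = avg l f + avg l g.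
Proof. unfold avg, Rdiv. rewrite Rsum_plus. lra. Qed.

Lemma avg_scal l k f : avg l (fun x => k * f x) = k * avg l f.
Proof. unfold avg, Rdiv. rewrite Rsum_scal. lra. Qed.

Lemma avg_Rsum {T} l (l' : list T) f :
  avg l (fun x => Rsum l' (fun j => f x j)) = Rsum l' (fun j => avg l (fun x => f x j)).
Proof.
  unfold avg, Rdiv. rewrite Rsum_swap, Rmult_comm, <- Rsum_scal.
  apply Rsum_ext. intros; lra.
Qed.

Lemma avg_swap l l' f :
  avg l (fun x => avg l' (fun y => f x y)) = avg l' (fun y => avg l (fun x => f x y)).
Proof.
  unfold avg, Rdiv.
  rewrite (Rsum_ext l _ (fun x => / INR (length l') * Rsum l' (fun y => f x y))) by (intros; lra).
  rewrite (Rsum_ext l' _ (fun y => / INR (length l) * Rsum l (fun x => f x y))) by (intros; lra).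
  rewrite !Rsum_scal, Rsum_swap. lra.
Qed.

Lemma avg_exists_le l f k : l <> nil -> avg l f <= k -> exists x, In x l /\ f x <= k.
Proof.
  intros Hl H. apply NNPP. intros Hno.
  assert (Hgt : forall x, In x l -> k < f x).
  { intros x Hx. apply Rnot_le_lt. intros Hle. apply Hno. exists x; tauto. }
  assert (Hs : INR (length l) * k < Rsum l f).
  { clear -Hl Hgt. induction l as [|a l IH]; [congruence|].
    change (length (a :: l)) with (S (length l)). rewrite S_INR. simpl.
    assert (k < f a) by (apply Hgt; left; reflexivity).
    destruct l as [|b l]; [simpl; lra|].
    assert (INR (length (b :: l)) * k < Rsum (b :: l) f); [|lra].
    apply IH; [congruence|]. intros x Hx; apply Hgt; right; exact Hx. }
  pose proof (length_pos l Hl) as Hp. unfold avg in H.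
  apply (Rmult_le_compat_r (INR (length l))) in H; [|lra].
  unfold Rdiv in H. rewrite Rmult_assoc, Rinv_l in H by lra. lra.
Qed.

Lemma exp_le x y : x <= y -> exp x <= exp y.
Proof. intros [H|E]; [left; apply exp_increasing, H|rewrite E; right; reflexivity]. Qed.

(** * A Janson-type inequality *)

Section Janson.

Variable I : nat -> list nat.
Hypothesis I_nonempty : forall j, I j <> nil.
Variable psi : nat -> nat -> nat -> nat -> R.

Definition back_degree (m j y : nat) : R :=
  Rsum (seq m (j - m)) (fun i => avg (I i) (fun x => psi i j x y)).

Definition fwd_degree (k i x : nat) : R :=
  Rsum (seq (S i) k) (fun j => avg (I j) (fun y => psi i j x y)).

(** The [mu] of a Janson inequality: the expected sum of [psi] over all pairs of picks in the [k]
    blocks from [m] on. *)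
Fixpoint total (k m : nat) : R :=
  match k with
  | O => 0
  | S k' => avg (I m) (fwd_degree k' m) + total k' (S m)
  end.

(** The expectation of the product of all [s j] and of [1 - psi i j] over all pairs of picks. The
    argument [s] accumulates the factors contributed by the blocks already revealed. *)
Fixpoint survival (k m : nat) (s : nat -> nat -> R) : R :=
  match k with
  | O => 1
  | S k' => avg (I m) (fun x =>
      s m x * survival k' (S m) (fun j y => s j y * (1 - psi m j x y)))
  end.

(** [total] groups the pairs by their earlier block, in the order in which [survival] reveals them;
    the potential needs them grouped by the later one. *)
Lemma total_back k m :
  total k m = Rsum (seq m k) (fun j => avg (I j) (back_degree m j)).
Proof.
  revert m. induction k as [|k IH]; intros m; [reflexivity|].
  simpl. rewrite IH. unfold back_degree at 2. rewrite Nat.sub_diag. simpl.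
  rewrite avg_const, Rplus_0_l by apply I_nonempty.
  unfold fwd_degree. rewrite avg_Rsum, <- Rsum_plus. apply Rsum_ext. intros j Hj.
  apply in_seq in Hj. rewrite avg_swap, <- avg_plus. apply avg_ext. intros y _.
  unfold back_degree. replace (j - m)%nat with (S (j - S m)) by lia. reflexivity.
Qed.

(** Because [(1 + u) (1 - u + u^2) = 1 + u^3 >= 1] and [1 + u <= exp u]. *)
Lemma exp_neg_quadratic u : 0 <= u -> exp (- u) <= 1 - u + u * u.
Proof.
  intros Hu. pose proof (exp_ineq1_le u) as H. pose proof (exp_pos u) as Hp.
  rewrite exp_Ropp. apply Rmult_le_reg_l with (exp u); [exact Hp|].
  rewrite Rinv_r by lra.
  assert (0 <= u * u * u) by (repeat apply Rmult_le_pos; assumption).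
  nra.
Qed.

(** The quadratic error [h^2] is at most [D d]. Multiplying by [s] removes [1 - s] times a factor
    that is at least [1 - D]. The result is affine in [1 - s], [h] and [d], ready to be averaged. *)
Lemma alive_step s h d D :
  0 <= s <= 1 -> 0 <= h <= d -> d <= D -> D <= 1 ->
  s * exp (- (1 - D) * h) <= 1 - (1 - D) * (1 - s) - (1 - D) * h + D * d.
Proof.
  intros Hs Hh Hd HD.
  assert (He : exp (- (1 - D) * h) <= 1 - (1 - D) * h + D * d).
  { replace (- (1 - D) * h) with (- ((1 - D) * h)) by ring.
    eapply Rle_trans; [apply exp_neg_quadratic; nra|].
    assert ((1 - D) * h * ((1 - D) * h) <= D * d).
    { apply Rle_trans with (h * h); [|apply Rmult_le_compat; lra].
      apply Rmult_le_compat; nra. }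
    lra. }
  assert (H0 : 0 <= D - (1 - D) * h + D * d) by nra.
  assert (s * exp (- (1 - D) * h) <= s * (1 - (1 - D) * h + D * d))
    by (apply Rmult_le_compat_l; lra).
  nra.
Qed.

Section Bound.

Variables (D : R) (M : nat).
Hypothesis D_range : 0 <= D <= 1.
Hypothesis psi_range : forall i j x y, (i < j < M)%nat -> In x (I i) -> In y (I j) ->
  0 <= psi i j x y <= 1.
Hypothesis back_bound : forall m j y, (j < M)%nat -> In y (I j) -> back_degree m j y <= D.
Hypothesis fwd_bound : forall k m x, (m + k < M)%nat -> In x (I m) -> fwd_degree k m x <= D.

Lemma back_degree_nonneg m j y : (j < M)%nat -> In y (I j) -> 0 <= back_degree m j y.
Proof.
  intros Hj Hy. apply Rsum_nonneg. intros i Hi. apply in_seq in Hi.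
  apply avg_nonneg; [apply I_nonempty|]. intros x Hx. apply psi_range; [lia|..]; assumption.
Qed.

(* [s j y] tells how much of [y] is still alive after the blocks before [m] are revealed.
   The potential bounds from below the expected mass that will be killed; the factor [1 - D]
   absorbs the elements [y] that are hit more than once. *)
Definition potential (k m : nat) (s : nat -> nat -> R) : R :=
  Rsum (seq m k) (fun j => avg (I j) (fun y =>
    1 - s j y * (1 - (1 - D) * back_degree m j y))).

(** Induction on the number of blocks: revealing [x] in block [m] multiplies each later [s j y] by
    [1 - psi m j x y], which raises the potential by [h x]. The quadratic errors [D * fwd_degree]
    add up to [D * total]. *)
Lemma survival_potential k m s :
  (m + k <= M)%nat ->
  (forall j y, (m <= j < m + k)%nat -> In y (I j) -> 0 <= s j y <= 1) ->
  survival k m s <= exp (- (1 - D) * potential k m s + D * total k m).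
Proof.
  revert m s. induction k as [|k IH]; intros m s HM Hs.
  { unfold potential. simpl. rewrite Rmult_0_r, Rmult_0_r, Rplus_0_r, exp_0. lra. }
  simpl survival. simpl total.
  set (s' := fun x j y => s j y * (1 - psi m j x y)).
  set (base := Rsum (seq (S m) k) (fun j => avg (I j) (fun y =>
    1 - s j y * (1 - (1 - D) * back_degree (S m) j y)))).
  set (h := fun x => Rsum (seq (S m) k) (fun j => avg (I j) (fun y =>
    s j y * psi m j x y * (1 - (1 - D) * back_degree (S m) j y)))).
  assert (HU : forall j y, (S m <= j < S m + k)%nat -> In y (I j) ->
    0 <= 1 - (1 - D) * back_degree (S m) j y <= 1).
  { intros j y Hj Hy.
    assert (back_degree (S m) j y <= D) by (apply back_bound; [lia|assumption]).
    assert (0 <= back_degree (S m) j y) by (apply back_degree_nonneg; [lia|assumption]).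
    nra. }
  assert (Hpot : forall x, potential k (S m) (s' x) = base + h x).
  { intros x. unfold potential, base, h. rewrite <- Rsum_plus. apply Rsum_ext. intros j _.
    rewrite <- avg_plus. apply avg_ext. intros y _. unfold s'. ring. }
  assert (Hh : forall x, In x (I m) -> 0 <= h x <= fwd_degree k m x).
  { intros x Hx. split.
    - apply Rsum_nonneg. intros j Hj. apply in_seq in Hj.
      apply avg_nonneg; [apply I_nonempty|]. intros y Hy.
      specialize (HU j y ltac:(lia) Hy). specialize (Hs j y ltac:(lia) Hy).
      pose proof (psi_range m j x y ltac:(lia) Hx Hy).
      repeat apply Rmult_le_pos; lra.
    - apply Rsum_le. intros j Hj. apply in_seq in Hj.
      apply avg_le; [apply I_nonempty|]. intros y Hy.
      specialize (HU j y ltac:(lia) Hy). specialize (Hs j y ltac:(lia) Hy).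
      pose proof (psi_range m j x y ltac:(lia) Hx Hy).
      assert (0 <= s j y * psi m j x y <= psi m j x y) by nra. nra. }
  set (T := total k (S m)).
  (* The bound is affine in [1 - s m x], [h x] and the degree of [x], so averaging over [x] and then
     [1 + t <= exp t] put the averages back into the exponent. *)
  apply Rle_trans with (avg (I m) (fun x =>
    exp (- (1 - D) * base + D * T) *
    (1 - (1 - D) * (1 - s m x) - (1 - D) * h x + D * fwd_degree k m x))).
  { apply avg_le; [apply I_nonempty|]. intros x Hx.
    pose proof (Hs m x ltac:(lia) Hx) as Hsm. pose proof (Hh x Hx) as Hhx.
    pose proof (fwd_bound k m x ltac:(lia) Hx) as Hfx.
    apply Rle_trans with (s m x * exp (- (1 - D) * potential k (S m) (s' x) + D * T)).
    - apply Rmult_le_compat_l; [lra|]. apply IH; [lia|].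
      intros j y Hj Hy. unfold s'. specialize (Hs j y ltac:(lia) Hy).
      pose proof (psi_range m j x y ltac:(lia) Hx Hy). nra.
    - rewrite Hpot.
      replace (- (1 - D) * (base + h x) + D * T)
        with ((- (1 - D) * base + D * T) + (- (1 - D) * h x)) by ring.
      rewrite exp_plus. pose proof (exp_pos (- (1 - D) * base + D * T)).
      pose proof (alive_step (s m x) (h x) (fwd_degree k m x) D Hsm Hhx Hfx ltac:(lra)).
      nra. }
  rewrite avg_scal.
  set (sb := avg (I m) (fun x => 1 - s m x)).
  set (hb := avg (I m) h). set (db := avg (I m) (fwd_degree k m)).
  assert (Havg : avg (I m) (fun x =>
    1 - (1 - D) * (1 - s m x) - (1 - D) * h x + D * fwd_degree k m x)
    = 1 + (- (1 - D) * sb - (1 - D) * hb + D * db)).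
  { unfold sb, hb, db. rewrite <- (avg_const (I m) 1) at 1 by apply I_nonempty.
    rewrite (avg_ext _ _ (fun x => 1 + (- (1 - D) * (1 - s m x) + (- (1 - D) * h x +
      D * fwd_degree k m x)))) by (intros; ring).
    rewrite !avg_plus, !avg_scal, (avg_const _ 1) by apply I_nonempty. ring. }
  rewrite Havg.
  apply Rle_trans with (exp (- (1 - D) * base + D * T) *
     exp (- (1 - D) * sb - (1 - D) * hb + D * db)).
  { apply Rmult_le_compat_l; [left; apply exp_pos|]. apply exp_ineq1_le. }
  rewrite <- exp_plus.
  assert (Hfin : potential (S k) m s <= sb + hb + base).
  { unfold potential. simpl.
    assert (E : avg (I m) (fun y => 1 - s m y * (1 - (1 - D) * back_degree m m y)) = sb).
    { apply avg_ext. intros y _. unfold back_degree. rewrite Nat.sub_diag. simpl. ring. }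
    rewrite E. unfold hb, h. rewrite avg_Rsum. unfold base. rewrite Rplus_assoc, <- Rsum_plus.
    apply Rplus_le_compat_l. apply Rsum_le. intros j Hj. apply in_seq in Hj.
    rewrite avg_swap, <- avg_plus. apply avg_le; [apply I_nonempty|]. intros y Hy.
    rewrite (avg_ext _ _ (fun x => (s j y * (1 - (1 - D) * back_degree (S m) j y)) *
      psi m j x y)) by (intros; ring).
    rewrite avg_scal.
    assert (EU : back_degree m j y = avg (I m) (fun x => psi m j x y) + back_degree (S m) j y).
    { unfold back_degree. replace (j - m)%nat with (S (j - S m)) by lia. reflexivity. }
    rewrite EU. set (p := avg (I m) (fun x => psi m j x y)). set (U := back_degree (S m) j y).
    assert (HUD : U <= D) by (apply back_bound; [lia|assumption]).
    assert (HU0 : 0 <= U) by (apply back_degree_nonneg; [lia|assumption]).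
    assert (Hp : 0 <= p).
    { apply avg_nonneg; [apply I_nonempty|]. intros x Hx. apply psi_range; [lia|..]; assumption. }
    specialize (Hs j y ltac:(lia) Hy).
    assert (0 <= s j y * p) by (apply Rmult_le_pos; lra).
    (* The term of [hb] at [y] carries the factor [1 - (1 - D) * U], while the potential asks for
       [1 - D]; [U <= D] closes the gap. *)
    assert (0 <= D - (1 - D) * U) by nra. nra. }
  assert ((1 - D) * potential (S k) m s <= (1 - D) * (sb + hb + base))
    by (apply Rmult_le_compat_l; lra).
  apply exp_le. fold db T. lra.
Qed.

Lemma total_nonneg k m : (m + k <= M)%nat -> 0 <= total k m.
Proof.
  intros H. rewrite total_back. apply Rsum_nonneg. intros j Hj. apply in_seq in Hj.
  apply avg_nonneg; [apply I_nonempty|]. intros y Hy. apply back_degree_nonneg; [lia|assumption].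
Qed.

(** With nothing killed yet the potential is [(1 - D) * total], and [(1 - D)^2 - D >= 1 - 3 D]. *)
Lemma janson k m :
  (m + k <= M)%nat -> survival k m (fun _ _ => 1) <= exp (- (1 - 3 * D) * total k m).
Proof.
  intros H. eapply Rle_trans; [apply survival_potential; [exact H|intros; lra]|].
  assert (E : potential k m (fun _ _ => 1) = (1 - D) * total k m).
  { rewrite total_back, <- Rsum_scal. apply Rsum_ext. intros j _.
    rewrite <- avg_scal. apply avg_ext. intros; ring. }
  rewrite E. pose proof (total_nonneg k m H).
  apply exp_le. nra.
Qed.

End Bound.
End Janson.

(** * Expectation over independent uniform choices *)

Section Expectation.

Variable I : nat -> list nat.
Hypothesis I_nonempty : forall j, I j <> nil.

Definition update (al : nat -> nat) (m x : nat) : nat -> nat :=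
  fun j => if Nat.eqb j m then x else al j.

Lemma update_eq al m x : update al m x m = x.
Proof. unfold update. rewrite Nat.eqb_refl. reflexivity. Qed.

Lemma update_neq al m x j : j <> m -> update al m x j = al j.
Proof. intros H. unfold update. apply Nat.eqb_neq in H. rewrite H. reflexivity. Qed.

(** Only the coordinates from [m] to [m + k - 1] are averaged; the others are read from [al]. So the
    same function also gives conditional expectations, with [al] as the revealed prefix. *)
Fixpoint expect (k m : nat) (f : (nat -> nat) -> R) (al : nat -> nat) : R :=
  match k with
  | O => f al
  | S k' => avg (I m) (fun x => expect k' (S m) f (update al m x))
  end.

Definition outcome (k m : nat) (al be : nat -> nat) : Prop :=
  (forall j, (j < m \/ m + k <= j)%nat -> be j = al j) /\
  (forall j, (m <= j < m + k)%nat -> In (be j) (I j)).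

Lemma outcome_update k m al be x :
  In x (I m) -> outcome k (S m) (update al m x) be -> outcome (S k) m al be /\ be m = x.
Proof.
  intros Hx [H1 H2]. assert (E : be m = x) by (rewrite H1 by lia; apply update_eq).
  split; [split|exact E].
  - intros j Hj. rewrite H1 by lia. apply update_neq. lia.
  - intros j Hj. destruct (Nat.eq_dec j m) as [->|Hne]; [rewrite E; exact Hx|apply H2; lia].
Qed.

Lemma expect_le k m f g al :
  (forall be, outcome k m al be -> f be <= g be) -> expect k m f al <= expect k m g al.
Proof.
  revert m al. induction k as [|k IH]; intros m al H; simpl.
  - apply H. split; [reflexivity|intros; lia].
  - apply avg_le; [apply I_nonempty|]. intros x Hx. apply IH. intros be Hbe.
    apply H. eapply outcome_update; eassumption.
Qed.

Lemma expect_ext k m f g al :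
  (forall be, outcome k m al be -> f be = g be) -> expect k m f al = expect k m g al.
Proof.
  intros H. apply Rle_antisym; apply expect_le; intros be Hbe; rewrite (H be Hbe); lra.
Qed.

Lemma expect_const k m c al : expect k m (fun _ => c) al = c.
Proof.
  revert m al. induction k as [|k IH]; intros m al; simpl; [reflexivity|].
  rewrite (avg_ext _ _ (fun _ => c)) by (intros; apply IH). apply avg_const, I_nonempty.
Qed.

Lemma expect_scal k m c f al : expect k m (fun be => c * f be) al = c * expect k m f al.
Proof.
  revert m al. induction k as [|k IH]; intros m al; simpl; [reflexivity|].
  rewrite <- avg_scal. apply avg_ext. intros; apply IH.
Qed.

Lemma expect_Rsum {T} k m (l : list T) f al :
  expect k m (fun be => Rsum l (fun t => f t be)) al = Rsum l (fun t => expect k m (f t) al).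
Proof.
  revert m al. induction k as [|k IH]; intros m al; simpl; [reflexivity|].
  rewrite <- avg_Rsum. apply avg_ext. intros; apply IH.
Qed.

Lemma expect_split p q m f al : expect (p + q) m f al = expect p m (expect q (m + p) f) al.
Proof.
  revert m al. induction p as [|p IH]; intros m al; simpl.
  - rewrite Nat.add_0_r. reflexivity.
  - apply avg_ext. intros x _. rewrite IH, <- plus_n_Sm. reflexivity.
Qed.

Definition depends_below (N : nat) (f : (nat -> nat) -> R) : Prop :=
  forall al be, (forall j, (j < N)%nat -> al j = be j) -> f al = f be.

Lemma expect_depends k m f al : depends_below m f -> expect k m f al = f al.
Proof.
  intros Hf. rewrite <- (expect_const k m (f al) al). apply expect_ext.
  intros be [H _]. apply Hf. intros j Hj. apply H. left; exact Hj.
Qed.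

Variable psi : nat -> nat -> nat -> nat -> R.

(** The random variable of which [survival] is the mean, with the picks read from [al]. *)
Fixpoint weight (k m : nat) (s : nat -> nat -> R) (al : nat -> nat) : R :=
  match k with
  | O => 1
  | S k' => s m (al m) * weight k' (S m) (fun j y => s j y * (1 - psi m j (al m) y)) al
  end.

Lemma expect_weight k m s al : expect k m (weight k m s) al = survival I psi k m s.
Proof.
  revert m s al. induction k as [|k IH]; intros m s al; [reflexivity|].
  simpl. apply avg_ext. intros x Hx.
  rewrite <- (IH (S m) (fun j y => s j y * (1 - psi m j x y)) (update al m x)), <- expect_scal.
  apply expect_ext. intros be Hbe. apply outcome_update in Hbe; [|exact Hx].
  destruct Hbe as [_ ->]. reflexivity.
Qed.

(** [sg] is left general so that the induction can move the exponents [v m j] of the revealed block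
    into it. *)
Lemma weight_exp k m s al (sg : nat -> R) (v : nat -> nat -> R) :
  (forall j, (m <= j < m + k)%nat -> s j (al j) = exp (- sg j)) ->
  (forall i j, (m <= i < j)%nat -> (j < m + k)%nat -> 1 - psi i j (al i) (al j) = exp (- v i j)) ->
  weight k m s al = exp (- Rsum (seq m k) (fun j => sg j + Rsum (seq m (j - m)) (fun i => v i j))).
Proof.
  revert m s sg. induction k as [|k IH]; intros m s sg Hs Hv.
  { simpl. rewrite Ropp_0, exp_0. reflexivity. }
  simpl. rewrite Hs by lia. rewrite (IH (S m) _ (fun j => sg j + v m j)).
  - rewrite <- exp_plus. f_equal. rewrite Nat.sub_diag. simpl.
    rewrite (Rsum_ext (seq (S m) k) (fun j => sg j + v m j + Rsum (seq (S m) (j - S m)) (fun i => v i j))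
      (fun j => sg j + Rsum (seq m (j - m)) (fun i => v i j))); [ring|].
    intros j Hj. apply in_seq in Hj. replace (j - m)%nat with (S (j - S m)) by lia. simpl. ring.
  - intros j Hj. rewrite Hs, Hv, <- exp_plus by lia. f_equal. ring.
  - intros i j Hi Hj. apply Hv; lia.
Qed.

Lemma weight_nonneg k m s al :
  (forall j, (m <= j < m + k)%nat -> 0 <= s j (al j)) ->
  (forall i j, (m <= i < j)%nat -> (j < m + k)%nat -> psi i j (al i) (al j) <= 1) ->
  0 <= weight k m s al.
Proof.
  revert m s. induction k as [|k IH]; intros m s Hs H; simpl; [lra|].
  apply Rmult_le_pos; [apply Hs; lia|]. apply IH.
  - intros j Hj. apply Rmult_le_pos; [apply Hs; lia|].
    specialize (H m j ltac:(lia) ltac:(lia)). lra.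
  - intros i j Hi Hj. apply H; lia.
Qed.

(** The form in which the Janson inequality is applied twice: any [f] dominated by a product over
    pairs of [1 - psi], written as exponentials, has a small expectation. The alternative
    [f be <= 0] covers the outcomes on which an indicator vanishes. *)
Lemma expect_exp_pairs D k m f al :
  0 <= D <= 1 ->
  (forall i j x y, (i < j < m + k)%nat -> In x (I i) -> In y (I j) -> 0 <= psi i j x y <= 1) ->
  (forall m' j y, (j < m + k)%nat -> In y (I j) -> back_degree I psi m' j y <= D) ->
  (forall k' m' x, (m' + k' < m + k)%nat -> In x (I m') -> fwd_degree I psi k' m' x <= D) ->
  (forall be, outcome k m al be -> f be <= 0 \/ exists v : nat -> nat -> R,
     f be <= exp (- Rsum (seq m k) (fun j => Rsum (seq m (j - m)) (fun i => v i j))) /\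
     forall i j, (m <= i < j)%nat -> (j < m + k)%nat ->
       1 - psi i j (be i) (be j) = exp (- v i j)) ->
  expect k m f al <= exp (- (1 - 3 * D) * total I psi k m).
Proof.
  intros HD Hpsi Hb Hf H.
  apply Rle_trans with (expect k m (weight k m (fun _ _ => 1)) al).
  - apply expect_le. intros be Hbe. destruct (H be Hbe) as [H0|(v & H1 & H2)].
    + eapply Rle_trans; [exact H0|]. destruct Hbe as [_ Hbe].
      apply weight_nonneg; [intros; lra|]. intros i j Hi Hj.
      apply Hpsi; [lia|apply Hbe; lia..].
    + rewrite (weight_exp k m _ be (fun _ => 0) v).
      * eapply Rle_trans; [exact H1|]. right. do 2 f_equal. apply Rsum_ext. intros; ring.
      * intros. rewrite Ropp_0, exp_0. reflexivity.
      * exact H2.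
  - rewrite expect_weight. apply (janson I I_nonempty psi D (m + k)); auto.
Qed.

End Expectation.

(** * The divisor bound *)

Definition divisors (n : nat) : list nat := filter (fun d => Nat.eqb (n mod d) 0) (seq 1 n).

Lemma in_divisors n d : (0 < n)%nat -> In d (divisors n) <-> Nat.divide d n.
Proof.
  intros Hn. unfold divisors. rewrite filter_In, in_seq, Nat.eqb_eq. split.
  - intros [H1 H2]. apply Nat.Lcm0.mod_divide. exact H2.
  - intros H. assert (d <= n)%nat by (apply Nat.divide_pos_le; assumption).
    assert (d <> 0)%nat by (intros ->; destruct H; lia).
    split; [lia|]. apply Nat.Lcm0.mod_divide. exact H.
Qed.

Lemma NoDup_divisors n : NoDup (divisors n).
Proof. apply NoDup_filter, seq_NoDup. Qed.

Lemma split_power q d :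
  (2 <= q)%nat -> (0 < d)%nat -> exists v d', d = (q ^ v * d')%nat /\ ~ Nat.divide q d' /\ (0 < d')%nat.
Proof.
  intros Hq. induction d as [d IH] using lt_wf_ind. intros Hd.
  destruct (excluded_middle_informative (Nat.divide q d)) as [[e He]|Hn].
  - destruct (IH e) as (v & d' & E & H); [nia|nia|].
    exists (S v), d'. split; [|exact H]. rewrite He, E. simpl. ring.
  - exists 0%nat, d. simpl. split; [lia|auto].
Qed.

Definition rough (q n : nat) : Prop := forall d, (2 <= d < q)%nat -> ~ Nat.divide d n.

(** Roughness stands in for primality: a common divisor of [x] and [q] divides [n], so it is 1 or
    [q] itself, and the latter is excluded. Gauss's lemma then handles the powers. *)
Lemma rough_coprime_pow q n x e :
  (2 <= q)%nat -> rough q n -> Nat.divide q n -> ~ Nat.divide q x -> Nat.gcd x (q ^ e) = 1%nat.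
Proof.
  intros Hq Hr Hqn Hx.
  assert (H1 : Nat.gcd x q = 1%nat).
  { set (g := Nat.gcd x q). assert (Hg : Nat.divide g q) by apply Nat.gcd_divide_r.
    assert (g <> 0)%nat by (intros E; rewrite E in Hg; destruct Hg; lia).
    assert (g <= q)%nat by (apply Nat.divide_pos_le; [lia|exact Hg]).
    destruct (Nat.eq_dec g q) as [E|E].
    - exfalso. apply Hx. rewrite <- E. apply Nat.gcd_divide_l.
    - destruct (Nat.eq_dec g 1); [assumption|]. exfalso. apply (Hr g); [lia|].
      eapply Nat.divide_trans; eassumption. }
  induction e as [|e IH]; [simpl; rewrite Nat.gcd_comm; reflexivity|].
  simpl. set (g := Nat.gcd x (q * q ^ e)).
  assert (Hg1 : Nat.divide g x) by apply Nat.gcd_divide_l.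
  assert (Hg2 : Nat.divide g (q * q ^ e)) by apply Nat.gcd_divide_r.
  assert (Hgq : Nat.gcd g q = 1%nat).
  { apply Nat.divide_1_r. rewrite <- H1. apply Nat.gcd_greatest.
    - eapply Nat.divide_trans; [apply Nat.gcd_divide_l|exact Hg1].
    - apply Nat.gcd_divide_r. }
  apply Nat.gauss in Hg2; [|exact Hgq].
  apply Nat.divide_1_r. rewrite <- IH. apply Nat.gcd_greatest; assumption.
Qed.

(** Every divisor is [q^v d'] with [v <= e] and [d'] dividing [m], so the divisors embed into
    [e + 1] copies of those of [m]. *)
Lemma divisors_split q e m :
  (2 <= q)%nat -> (0 < m)%nat -> (0 < e)%nat -> rough q (q ^ e * m) -> ~ Nat.divide q m ->
  (length (divisors (q ^ e * m)) <= (e + 1) * length (divisors m))%nat.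
Proof.
  intros Hq Hm He Hr Hqm.
  assert (Hqe : (0 < q ^ e)%nat) by (apply Nat.neq_0_lt_0, Nat.pow_nonzero; lia).
  assert (Hqn : Nat.divide q (q ^ e * m)).
  { destruct e as [|e]; [lia|]. exists (q ^ e * m)%nat. simpl. ring. }
  set (L := flat_map (fun v => map (fun d => (q ^ v * d)%nat) (divisors m)) (seq 0 (e + 1))).
  assert (HL : length L = ((e + 1) * length (divisors m))%nat).
  { unfold L. rewrite (flat_map_constant_length (c := length (divisors m))).
    - rewrite length_seq. reflexivity.
    - intros; apply length_map. }
  rewrite <- HL. apply NoDup_incl_length; [apply NoDup_divisors|].
  intros d Hd. apply in_divisors in Hd; [|nia].
  assert (Hd0 : (0 < d)%nat) by (destruct Hd as [z Hz]; destruct d; [nia|lia]).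
  destruct (split_power q d Hq Hd0) as (v & d' & -> & Hd' & Hd'0).
  assert (Hdm : Nat.divide d' m).
  { apply (Nat.gauss d' (q ^ e) m).
    - eapply Nat.divide_trans; [|exact Hd]. exists (q ^ v)%nat; ring.
    - eapply rough_coprime_pow; eassumption. }
  assert (Hv : (v <= e)%nat).
  { destruct (le_lt_dec v e) as [|Hlt]; [assumption|]. exfalso. apply Hqm.
    destruct Hd as [z Hz]. replace v with (e + S (v - e - 1))%nat in Hz by lia.
    rewrite Nat.pow_add_r in Hz. exists (z * q ^ (v - e - 1) * d')%nat.
    apply (Nat.mul_cancel_l _ _ (q ^ e)%nat); [lia|]. rewrite Hz. simpl. ring. }
  unfold L. apply in_flat_map. exists v. split; [apply in_seq; lia|].
  apply in_map_iff. exists d'. split; [reflexivity|]. apply in_divisors; assumption.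
Qed.

(** For [r > 0], dividing [e] by [r] with quotient [f] gives [e + 1 <= r (f + 1) <= r 2^f]; in the
    [r]-th power, [2^(r f) <= 2^e]. *)
Lemma succ_pow_le_two_pow r e : ((e + 1) ^ r <= (r + 1) ^ (r + 1) * 2 ^ e)%nat.
Proof.
  destruct r as [|r]; [simpl; pose proof (Nat.pow_nonzero 2 e); lia|].
  set (f := (e / S r)%nat).
  assert (He : (e = S r * f + e mod S r)%nat) by apply Nat.div_mod_eq.
  assert (Hm : (e mod S r < S r)%nat) by (apply Nat.mod_upper_bound; lia).
  assert (Hf : (f + 1 <= 2 ^ f)%nat) by (clear; induction f; simpl; lia).
  apply Nat.le_trans with ((S r * (f + 1)) ^ S r)%nat; [apply Nat.pow_le_mono_l; nia|].
  rewrite Nat.pow_mul_l. apply Nat.mul_le_mono.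
  - apply Nat.le_trans with ((S r + 1) ^ S r)%nat; [apply Nat.pow_le_mono_l; lia|].
    apply Nat.pow_le_mono_r; lia.
  - apply Nat.le_trans with ((2 ^ f) ^ S r)%nat; [apply Nat.pow_le_mono_l; lia|].
    rewrite <- Nat.pow_mul_r. apply Nat.pow_le_mono_r; nia.
Qed.

(* Only the primes below [2 ^ r] cost a constant: for larger [q],
   [(e + 1) ^ r <= 2 ^ (e r) <= q ^ e]. *)
Lemma divisor_bound_rough r q n :
  (2 <= q)%nat -> (0 < n)%nat -> rough q n ->
  (length (divisors n) ^ r <= ((r + 1) ^ (r + 1)) ^ (2 ^ r - q) * n)%nat.
Proof.
  set (C := ((r + 1) ^ (r + 1))%nat).
  assert (HC : (1 <= C)%nat) by (unfold C; pose proof (Nat.pow_nonzero (r + 1) (r + 1)); lia).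
  (* This measure drops both when [q] is passed as a non-divisor and when the full power of [q] is
     removed from [n]. *)
  remember (n + 1 - q)%nat as k eqn:Hk.
  revert q n Hk. induction k as [k IH] using lt_wf_ind. intros q n Hk Hq Hn Hr.
  assert (HCp : forall a, (1 <= C ^ a)%nat)
    by (intros a; pose proof (Nat.pow_nonzero C a); lia).
  destruct (le_lt_dec q n) as [Hle|Hlt].
  - destruct (excluded_middle_informative (Nat.divide q n)) as [Hd|Hd].
    + destruct (split_power q n Hq Hn) as (e & m & E & Hqm & Hm).
      assert (He : (0 < e)%nat).
      { destruct e; [|lia]. exfalso. apply Hqm. simpl in E. rewrite Nat.add_0_r in E.
        rewrite <- E. exact Hd. }
      assert (Hqe : (q ^ e >= q)%nat).
      { replace e with (S (e - 1)) by lia. simpl.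
        pose proof (Nat.pow_nonzero q (e - 1)). nia. }
      assert (Hmn : (m < n)%nat) by nia.
      assert (Hrm : rough (S q) m).
      { intros d Hd2 Hdm. destruct (Nat.eq_dec d q) as [->|Hne]; [contradiction|].
        apply (Hr d); [lia|]. rewrite E. apply Nat.divide_mul_r, Hdm. }
      specialize (IH (m + 1 - S q)%nat ltac:(lia) (S q) m eq_refl ltac:(lia) Hm Hrm).
      assert (Hsp : (length (divisors n) <= (e + 1) * length (divisors m))%nat).
      { rewrite E. apply divisors_split; auto. rewrite <- E. exact Hr. }
      apply Nat.le_trans with ((e + 1) ^ r * length (divisors m) ^ r)%nat.
      { rewrite <- Nat.pow_mul_l. apply Nat.pow_le_mono_l, Hsp. }
      rewrite E.
      destruct (le_lt_dec (2 ^ r) q) as [Hbig|Hsmall].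
      * assert (H1 : ((e + 1) ^ r <= q ^ e)%nat).
        { apply Nat.le_trans with ((2 ^ e) ^ r)%nat.
          - apply Nat.pow_le_mono_l. clear; induction e; simpl; lia.
          - rewrite <- Nat.pow_mul_r, Nat.mul_comm, Nat.pow_mul_r.
            apply Nat.pow_le_mono_l. exact Hbig. }
        replace (2 ^ r - S q)%nat with 0%nat in IH by lia.
        replace (2 ^ r - q)%nat with 0%nat by lia. simpl in *. nia.
      * assert (H1 : ((e + 1) ^ r <= C * q ^ e)%nat).
        { eapply Nat.le_trans; [apply succ_pow_le_two_pow|]. fold C.
          apply Nat.mul_le_mono_l, Nat.pow_le_mono_l, Hq. }
        replace (2 ^ r - q)%nat with (S (2 ^ r - S q)) by lia.
        rewrite Nat.pow_succ_r'.
        replace (C * C ^ (2 ^ r - S q) * (q ^ e * m))%nat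
          with ((C * q ^ e) * (C ^ (2 ^ r - S q) * m))%nat by ring.
        apply Nat.mul_le_mono; assumption.
    + assert (Hr' : rough (S q) n).
      { intros d Hd2 Hdn. destruct (Nat.eq_dec d q) as [->|Hne]; [contradiction|].
        apply (Hr d); [lia|exact Hdn]. }
      specialize (IH (n + 1 - S q)%nat ltac:(lia) (S q) n eq_refl ltac:(lia) Hn Hr').
      eapply Nat.le_trans; [exact IH|]. apply Nat.mul_le_mono_r.
      apply Nat.pow_le_mono_r; lia.
  - assert (n = 1%nat) as ->.
    { destruct (Nat.eq_dec n 1); [assumption|]. exfalso. apply (Hr n); [lia|]. apply Nat.divide_refl. }
    change (length (divisors 1)) with 1%nat. rewrite Nat.pow_1_l. specialize (HCp (2 ^ r - q)%nat). lia.
Qed.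

(** Used with [r = 401]: up to a constant the number of divisors is at most [n^(1/401)], hence at
    most [q = n^(1/400)] for large [n]. *)
Lemma divisor_bound (r : nat) :
  exists C : nat, forall n, (0 < n)%nat -> (length (divisors n) ^ r <= C * n)%nat.
Proof.
  exists (((r + 1) ^ (r + 1)) ^ (2 ^ r - 2))%nat. intros n Hn.
  apply divisor_bound_rough; [lia|exact Hn|]. intros d Hd; lia.
Qed.

(** * Coprime pairs and solutions of [a b + c d = n] *)

Definition indic (P : Prop) : R := if excluded_middle_informative P then 1 else 0.

Lemma indic_true (P : Prop) : P -> indic P = 1.
Proof. intros H. unfold indic. destruct (excluded_middle_informative P); tauto. Qed.

Lemma indic_false (P : Prop) : ~ P -> indic P = 0.
Proof. intros H. unfold indic. destruct (excluded_middle_informative P); tauto. Qed.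

Lemma indic_range (P : Prop) : 0 <= indic P <= 1.
Proof. unfold indic. destruct (excluded_middle_informative P); lra. Qed.

Lemma indic_le (P Q : Prop) : (P -> Q) -> indic P <= indic Q.
Proof.
  intros H. unfold indic.
  destruct (excluded_middle_informative P), (excluded_middle_informative Q); try lra; tauto.
Qed.

Lemma Rsum_indic {T} (l : list T) (P : T -> Prop) :
  Rsum l (fun x => indic (P x)) =
  INR (length (filter (fun x => if excluded_middle_informative (P x) then true else false) l)).
Proof.
  induction l as [|a l IH]; [reflexivity|].
  simpl Rsum. rewrite IH. unfold indic. simpl filter.
  destruct (excluded_middle_informative (P a)); [|lra].
  change (length (a :: ?l)) with (S (length l)). simpl length. rewrite S_INR. lra.
Qed.

(** Points at distance at least [d] have different quotients [(x - u) / d], which take at most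
    [l / d + 1] values. *)
Lemma Rsum_indic_spaced u l d (P : nat -> Prop) :
  (0 < d)%nat ->
  (forall x y, (u <= x < y)%nat -> (y < u + l)%nat -> P x -> P y -> (d <= y - x)%nat) ->
  Rsum (seq u l) (fun x => indic (P x)) <= INR l / INR d + 1.
Proof.
  intros Hd H. rewrite Rsum_indic.
  set (F := filter _ _).
  assert (HF : forall x, In x F -> (u <= x < u + l)%nat /\ P x).
  { intros x Hx. apply filter_In in Hx. destruct Hx as [H1 H2]. apply in_seq in H1.
    destruct (excluded_middle_informative (P x)); [split; assumption|discriminate]. }
  assert (Hlt : forall x y, In x F -> In y F -> (x < y)%nat -> ((x - u) / d < (y - u) / d)%nat).
  { intros x y Hx Hy Hxy. apply HF in Hx. apply HF in Hy.
    assert (d <= y - x)%nat by (apply H; tauto || lia).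
    apply Nat.lt_le_trans with (((x - u) + 1 * d) / d)%nat.
    - rewrite Nat.div_add by lia. lia.
    - apply Nat.Div0.div_le_mono. lia. }
  assert (Hlen : (length F <= l / d + 1)%nat).
  { rewrite <- (length_map (fun x => ((x - u) / d)%nat) F), <- (length_seq (l / d + 1) 0).
    apply NoDup_incl_length.
    - apply NoDup_map_NoDup_ForallPairs; [|apply NoDup_filter, seq_NoDup].
      intros x y Hx Hy E. destruct (lt_eq_lt_dec x y) as [[Hl|Hl]|Hl]; [|exact Hl|].
      + specialize (Hlt x y Hx Hy Hl). lia.
      + specialize (Hlt y x Hy Hx Hl). lia.
    - intros z Hz. apply in_map_iff in Hz. destruct Hz as (x & <- & Hx). apply HF in Hx.
      apply in_seq. assert ((x - u) / d <= l / d)%nat by (apply Nat.Div0.div_le_mono; lia). lia. }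
  apply le_INR in Hlen. rewrite plus_INR in Hlen. simpl in Hlen.
  assert (INR (l / d) <= INR l / INR d).
  { apply lt_0_INR in Hd. apply Rmult_le_reg_r with (INR d); [exact Hd|].
    unfold Rdiv. rewrite Rmult_assoc, Rinv_l, Rmult_1_r, <- mult_INR by lra. apply le_INR.
    rewrite Nat.mul_comm. apply Nat.Div0.mul_div_le. }
  lra.
Qed.

Lemma ln_le_sub1 x : 0 < x -> ln x <= x - 1.
Proof. intros Hx. pose proof (exp_ineq1_le (ln x)). rewrite exp_ln in H; lra. Qed.

Lemma ln_succ_sub k : 0 < k -> / (k + 1) <= ln (k + 1) - ln k <= / k.
Proof.
  intros Hk. split.
  - assert (H := ln_le_sub1 (k / (k + 1)) ltac:(apply Rdiv_lt_0_compat; lra)).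
    rewrite ln_div in H by lra. replace (k / (k + 1) - 1) with (- / (k + 1)) in H by (field; lra). lra.
  - assert (H := ln_le_sub1 ((k + 1) / k) ltac:(apply Rdiv_lt_0_compat; lra)).
    rewrite ln_div in H by lra. replace ((k + 1) / k - 1) with (/ k) in H by (field; lra). lra.
Qed.

Lemma inv_sum_le_ln m k : (1 <= m)%nat ->
  Rsum (seq m k) (fun j => / (INR j + 1)) <= ln (INR (m + k)) - ln (INR m).
Proof.
  revert m. induction k as [|k IH]; intros m Hm.
  - rewrite Nat.add_0_r. simpl. lra.
  - simpl. specialize (IH (S m) ltac:(lia)).
    replace (m + S k)%nat with (S m + k)%nat by lia.
    rewrite S_INR in IH.
    assert (0 < INR m) by (apply lt_0_INR; lia).
    pose proof (ln_succ_sub (INR m) H). lra.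
Qed.

Lemma inv_sum_ge_ln m k :
  ln (INR (m + k) + 1) - ln (INR m + 1) <= Rsum (seq m k) (fun j => / (INR j + 1)).
Proof.
  revert m. induction k as [|k IH]; intros m.
  - rewrite Nat.add_0_r. simpl. lra.
  - simpl. specialize (IH (S m)).
    replace (m + S k)%nat with (S m + k)%nat by lia.
    rewrite S_INR in IH. pose proof (pos_INR m).
    pose proof (ln_succ_sub (INR m + 1) ltac:(lra)). lra.
Qed.

(** Two and the odd numbers from 3 on contain a common divisor of any two non-coprime numbers, yet
    their inverse squares sum to at most 1/2; all integers from 2 on would give more. *)
Definition trial_divisors (X : nat) : list nat := 2%nat :: map (fun k => (2 * k + 3)%nat) (seq 0 X).

Lemma in_trial_divisors a c X :
  (0 < a <= X)%nat -> Nat.gcd a c <> 1%nat ->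
  exists d, In d (trial_divisors X) /\ Nat.divide d a /\ Nat.divide d c.
Proof.
  intros Ha Hg. set (g := Nat.gcd a c) in *.
  assert (Hga : Nat.divide g a) by apply Nat.gcd_divide_l.
  assert (Hgc : Nat.divide g c) by apply Nat.gcd_divide_r.
  assert (g <= a)%nat by (apply Nat.divide_pos_le; [lia|exact Hga]).
  assert (g <> 0)%nat by (intros E; rewrite E in Hga; destruct Hga; lia).
  destruct (Nat.Even_or_Odd g) as [[h Hh]|[h Hh]].
  - exists 2%nat. split; [left; reflexivity|].
    assert (Nat.divide 2 g) by (exists h; lia).
    split; eapply Nat.divide_trans; eassumption.
  - exists g. split; [|tauto]. right. apply in_map_iff. exists (h - 1)%nat.
    split; [lia|]. apply in_seq. lia.
Qed.

(** The divisor 2 contributes 1/4. The odd ones contribute at most another 1/4 by telescoping, since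
    [(2 k + 3)^2 >= 4 (k + 1) (k + 2)]. *)
Lemma trial_sum_sqr X : Rsum (trial_divisors X) (fun d => / (INR d * INR d)) <= 1 / 2.
Proof.
  unfold trial_divisors. change (Rsum (2%nat :: ?l) ?f) with (f 2%nat + Rsum l f).
  cbv beta. rewrite Rsum_map.
  assert (H : forall m k, Rsum (seq m k) (fun k => / (INR (2 * k + 3) * INR (2 * k + 3)))
    <= / 4 * (/ (INR m + 1) - / (INR (m + k) + 1))).
  { intros m k. revert m. induction k as [|k IH]; intros m.
    - rewrite Nat.add_0_r. simpl. lra.
    - change (Rsum (seq m (S k)) ?f) with (f m + Rsum (seq (S m) k) f).
      specialize (IH (S m)). replace (m + S k)%nat with (S m + k)%nat by lia.
      rewrite S_INR in IH. pose proof (pos_INR m) as Hm. cbv beta.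
      assert (/ (INR (2 * m + 3) * INR (2 * m + 3)) <= / 4 * (/ (INR m + 1) - / (INR m + 1 + 1))).
      { replace (/ 4 * (/ (INR m + 1) - / (INR m + 1 + 1)))
          with (/ (4 * ((INR m + 1) * (INR m + 1 + 1)))) by (field; lra).
        apply Rinv_le_contravar; [nra|]. rewrite plus_INR, mult_INR. simpl. nra. }
      lra. }
  specialize (H 0%nat X).
  assert (0 < / (INR (0 + X) + 1)) by (apply Rinv_0_lt_compat; pose proof (pos_INR (0 + X)); lra).
  change (INR 2) with 2. change (INR 0) with 0 in H. lra.
Qed.

Lemma trial_sum_inv X : Rsum (trial_divisors X) (fun d => / INR d) <= 1 + ln (INR X + 1).
Proof.
  unfold trial_divisors. change (Rsum (2%nat :: ?l) ?f) with (f 2%nat + Rsum l f).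
  cbv beta. rewrite Rsum_map.
  assert (Rsum (seq 0 X) (fun k => / INR (2 * k + 3)) <= Rsum (seq 1 X) (fun j => / (INR j + 1))).
  { rewrite <- (seq_shift X 0), Rsum_map. apply Rsum_le. intros k _.
    pose proof (pos_INR k). apply Rinv_le_contravar.
    - rewrite S_INR. lra.
    - rewrite S_INR, plus_INR, mult_INR. simpl. lra. }
  pose proof (inv_sum_le_ln 1 X ltac:(lia)) as H1.
  replace (1 + X)%nat with (S X) in H1 by lia. rewrite S_INR in H1. change (INR 1) with 1 in H1.
  rewrite ln_1 in H1. change (INR 2) with 2. lra.
Qed.

Lemma Rsum_multiples u l d : (0 < d)%nat ->
  Rsum (seq u l) (fun x => indic (Nat.divide d x)) <= INR l / INR d + 1.
Proof.
  intros Hd. apply Rsum_indic_spaced; [exact Hd|]. intros x y Hxy _ Hx Hy.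
  apply Nat.divide_pos_le; [lia|]. apply Nat.divide_sub_r; assumption.
Qed.

(** A union bound: a non-coprime pair shares a trial divisor [d], and at most
    [(l / d + 1) (l' / d + 1)] pairs share a given [d]. The main term sums to at most 1/2; the other
    terms are the two errors. [X] bounds the first range only, so the second one may be much
    higher. *)
Lemma coprime_fraction u l u' l' X :
  (0 < u)%nat -> (0 < l)%nat -> (0 < l')%nat -> (u + l <= X)%nat ->
  1 / 2 - (/ INR l + / INR l') * (1 + ln (INR X + 1)) - (INR X + 1) * (/ INR l * / INR l')
  <= avg (seq u l) (fun a => avg (seq u' l') (fun c => indic (Nat.gcd a c = 1%nat))).
Proof.
  intros Hu Hl Hl' HX.
  assert (Hlp : 0 < INR l) by (apply lt_0_INR; lia).
  assert (Hlp' : 0 < INR l') by (apply lt_0_INR; lia).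
  set (Ds := trial_divisors X).
  assert (HDs : forall d, In d Ds -> (0 < d)%nat).
  { intros d [<-|Hd]; [lia|]. apply in_map_iff in Hd. destruct Hd as (k & <- & _). lia. }
  set (A := fun d => Rsum (seq u l) (fun a => indic (Nat.divide d a))).
  set (C := fun d => Rsum (seq u' l') (fun a => indic (Nat.divide d a))).
  assert (H1 : INR l * INR l' - Rsum Ds (fun d => A d * C d) <=
    Rsum (seq u l) (fun a => Rsum (seq u' l') (fun c => indic (Nat.gcd a c = 1%nat)))).
  { assert (Hone : INR l * INR l' = Rsum (seq u l) (fun a => Rsum (seq u' l') (fun c => 1))).
    { rewrite (Rsum_ext _ _ (fun _ => INR l')), Rsum_const, length_seq; [reflexivity|].
      intros. rewrite Rsum_const, length_seq. ring. }
    assert (HAC : Rsum Ds (fun d => A d * C d) = Rsum (seq u l) (fun a => Rsum (seq u' l') (fun c =>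
      Rsum Ds (fun d => indic (Nat.divide d a) * indic (Nat.divide d c))))).
    { rewrite (Rsum_ext (seq u l) _ (fun a => Rsum Ds (fun d => Rsum (seq u' l')
        (fun c => indic (Nat.divide d a) * indic (Nat.divide d c))))) by (intros; apply Rsum_swap).
      rewrite Rsum_swap. apply Rsum_ext. intros d _. unfold A.
      rewrite Rmult_comm, <- Rsum_scal. apply Rsum_ext. intros a _.
      rewrite Rsum_scal. apply Rmult_comm. }
    rewrite Hone, HAC. apply Rle_minus_l. rewrite <- Rsum_plus. apply Rsum_le. intros a Ha.
    rewrite <- Rsum_plus. apply Rsum_le. intros c _. apply in_seq in Ha.
    destruct (Nat.eq_dec (Nat.gcd a c) 1) as [E|E].
    - rewrite (indic_true (Nat.gcd a c = 1%nat)) by exact E.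
      assert (0 <= Rsum Ds (fun d => indic (Nat.divide d a) * indic (Nat.divide d c))); [|lra].
      apply Rsum_nonneg. intros d _. apply Rmult_le_pos; apply indic_range.
    - rewrite (indic_false (Nat.gcd a c = 1%nat)) by exact E.
      destruct (in_trial_divisors a c X ltac:(lia) E) as (d & Hd & Hda & Hdc).
      assert (H := Rsum_term Ds (fun d => indic (Nat.divide d a) * indic (Nat.divide d c)) d Hd).
      simpl in H. rewrite !indic_true in H by assumption.
      assert (1 * 1 <= Rsum Ds (fun d => indic (Nat.divide d a) * indic (Nat.divide d c))); [|lra].
      apply H. intros. apply Rmult_le_pos; apply indic_range. }
  assert (H2 : Rsum Ds (fun d => A d * C d) <=
    INR l * INR l' * (1 / 2) + (INR l + INR l') * (1 + ln (INR X + 1)) + (INR X + 1)).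
  { apply Rle_trans with (Rsum Ds (fun d => INR l * INR l' * / (INR d * INR d) +
      ((INR l + INR l') * / INR d + 1))).
    - apply Rsum_le. intros d Hd. specialize (HDs d Hd).
      assert (0 < INR d) by (apply lt_0_INR; lia).
      replace (INR l * INR l' * / (INR d * INR d) + ((INR l + INR l') * / INR d + 1))
        with ((INR l / INR d + 1) * (INR l' / INR d + 1)) by (field; lra).
      apply Rmult_le_compat; try (apply Rsum_multiples; exact HDs).
      + apply Rsum_nonneg; intros; apply indic_range.
      + apply Rsum_nonneg; intros; apply indic_range.
    - rewrite !Rsum_plus, !Rsum_scal, Rsum_const.
      assert (Hlen : length Ds = S X) by (unfold Ds, trial_divisors; simpl; rewrite length_map, length_seq; reflexivity).
      rewrite Hlen, S_INR.
      pose proof (trial_sum_sqr X). pose proof (trial_sum_inv X). fold Ds in H, H0.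
      assert (INR l * INR l' * Rsum Ds (fun d => / (INR d * INR d)) <= INR l * INR l' * (1 / 2))
        by (apply Rmult_le_compat_l; [nra|assumption]).
      assert ((INR l + INR l') * Rsum Ds (fun d => / INR d) <= (INR l + INR l') * (1 + ln (INR X + 1)))
        by (apply Rmult_le_compat_l; [nra|assumption]).
      lra. }
  set (S := Rsum (seq u l) (fun a => Rsum (seq u' l') (fun c => indic (Nat.gcd a c = 1%nat)))) in *.
  assert (E : avg (seq u l) (fun a => avg (seq u' l') (fun c => indic (Nat.gcd a c = 1%nat)))
    = S * (/ INR l * / INR l')).
  { unfold avg. rewrite !length_seq. unfold Rdiv.
    rewrite (Rsum_ext _ _ (fun a => / INR l' * Rsum (seq u' l') (fun c => indic (Nat.gcd a c = 1%nat))))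
      by (intros; ring).
    rewrite Rsum_scal. unfold S. ring. }
  rewrite E.
  apply Rle_trans with ((INR l * INR l' - (INR l * INR l' * (1 / 2) + (INR l + INR l') * (1 + ln (INR X + 1)) + (INR X + 1)))
    * (/ INR l * / INR l')).
  - right. field. lra.
  - apply Rmult_le_compat_r; [|lra].
    left. apply Rmult_lt_0_compat; apply Rinv_0_lt_compat; assumption.
Qed.

Lemma linear_solution n a c u :
  (0 < a)%nat -> (0 < c)%nat -> Nat.gcd a c = 1%nat -> (a * (u + c) <= n)%nat ->
  exists b d, (u <= b < u + c)%nat /\ (a * b + c * d = n)%nat.
Proof.
  intros Ha Hc Hg Hn.
  destruct (Nat.gcd_bezout_pos a c Ha) as (x & y & E). rewrite Hg in E.
  (* By Bezout [n * x] solves [a b = n] modulo [c]. The summand [c * u - u], congruent to [- u],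
     makes [u + w mod c] the solution that lies in [[u, u + c)]. *)
  set (w := (n * x + (c * u - u))%nat).
  assert (Hw : w = (c * (w / c) + w mod c)%nat) by apply Nat.div_mod_eq.
  assert (Hm : (w mod c < c)%nat) by (apply Nat.mod_upper_bound; lia).
  set (b := (u + w mod c)%nat).
  assert (Hb : (u <= b < u + c)%nat) by (unfold b; lia).
  assert (Hab : (a * b <= n)%nat) by nia.
  assert (HZ : (Z.of_nat n - Z.of_nat a * Z.of_nat b =
    Z.of_nat c * (Z.of_nat a * Z.of_nat (w / c) - Z.of_nat n * Z.of_nat y - Z.of_nat a * Z.of_nat u))%Z).
  { assert (Eb : (b + c * (w / c) = n * x + c * u)%nat) by (unfold b, w in *; nia).
    apply (f_equal Z.of_nat) in Eb. apply (f_equal Z.of_nat) in E.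
    rewrite !Nat2Z.inj_add, !Nat2Z.inj_mul in *. change (Z.of_nat 1) with 1%Z in E.
    assert (E2 : (Z.of_nat b = Z.of_nat n * Z.of_nat x + Z.of_nat c * Z.of_nat u - Z.of_nat c * Z.of_nat (w / c))%Z) by lia.
    rewrite E2.
    replace (Z.of_nat a * (Z.of_nat n * Z.of_nat x + Z.of_nat c * Z.of_nat u - Z.of_nat c * Z.of_nat (w / c)))%Z
      with (Z.of_nat n * (Z.of_nat x * Z.of_nat a) + Z.of_nat a * Z.of_nat c * Z.of_nat u - Z.of_nat a * Z.of_nat c * Z.of_nat (w / c))%Z by ring.
    rewrite E. ring. }
  set (z := (Z.of_nat a * Z.of_nat (w / c) - Z.of_nat n * Z.of_nat y - Z.of_nat a * Z.of_nat u)%Z) in *.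
  exists b, (Z.to_nat z). split; [exact Hb|].
  assert (0 <= z)%Z by nia.
  apply Nat2Z.inj. rewrite Nat2Z.inj_add, !Nat2Z.inj_mul, Z2Nat.id by assumption. lia.
Qed.

(** A common divisor [g] of the two members divides [n]. If it serves for two parameters, it divides
    [a] and [c] times their difference, hence the difference itself as [a] and [c] are coprime. So
    each [g > G] spoils at most [T / G + 1] values of [t]. *)
Lemma small_gcd_solutions n a c b d T G :
  (0 < n)%nat -> (0 < G)%nat -> Nat.gcd a c = 1%nat -> (a * b + c * d = n)%nat -> (a * T <= d)%nat ->
  INR T - INR (length (divisors n)) * (INR T / INR G + 1) <=
  Rsum (seq 0 T) (fun t => indic (Nat.gcd (b + c * t) (d - a * t) <= G)%nat).
Proof.
  intros Hn HG Hg E HT.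
  assert (Hone : INR T = Rsum (seq 0 T) (fun _ => 1)) by (rewrite Rsum_const, length_seq; ring).
  rewrite Hone at 1. apply Rle_minus_l.
  set (bad := fun g t => (G < g)%nat /\ Nat.divide g (b + c * t) /\ Nat.divide g (d - a * t)).
  apply Rle_trans with (Rsum (seq 0 T) (fun t => indic (Nat.gcd (b + c * t) (d - a * t) <= G)%nat)
    + Rsum (divisors n) (fun g => Rsum (seq 0 T) (fun t => indic (bad g t)))).
  - rewrite Rsum_swap, <- Rsum_plus. apply Rsum_le. intros t Ht. apply in_seq in Ht.
    assert (Hpos : 0 <= Rsum (divisors n) (fun g => indic (bad g t)))
      by (apply Rsum_nonneg; intros; apply indic_range).
    destruct (le_lt_dec (Nat.gcd (b + c * t) (d - a * t)) G) as [Hle|Hlt].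
    + rewrite indic_true by exact Hle. lra.
    + set (g := Nat.gcd (b + c * t) (d - a * t)) in *.
      assert (Hgb : Nat.divide g (b + c * t)) by apply Nat.gcd_divide_l.
      assert (Hgd : Nat.divide g (d - a * t)) by apply Nat.gcd_divide_r.
      assert (Hgn : In g (divisors n)).
      { apply in_divisors; [exact Hn|].
        assert (Hat : (a * t <= d)%nat) by nia.
        replace n with (a * (b + c * t) + c * (d - a * t))%nat
          by (assert (c * (a * t) <= c * d)%nat by (apply Nat.mul_le_mono_l; exact Hat);
              rewrite Nat.mul_sub_distr_l; nia).
        apply Nat.divide_add_r; apply Nat.divide_mul_r; assumption. }
      assert (H := Rsum_term _ (fun g => indic (bad g t)) g Hgn ltac:(intros; apply indic_range)).
      simpl in H. rewrite (indic_true (bad g t)) in H by (unfold bad; auto).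
      pose proof (indic_range (g <= G)%nat). lra.
  - apply Rplus_le_compat_l. rewrite <- Rsum_const. apply Rsum_le. intros g Hgn.
    assert (HGp : 0 < INR G) by (apply lt_0_INR; lia).
    assert (HT0 := pos_INR T).
    destruct (le_lt_dec g G) as [Hle|Hlt].
    + rewrite Rsum_eq0.
      * assert (0 <= INR T / INR G) by (apply Rdiv_le_0_compat; lra). lra.
      * intros t _. apply indic_false. unfold bad. lia.
    + apply Rle_trans with (INR T / INR g + 1).
      * apply Rsum_indic_spaced; [lia|]. intros x y Hxy Hy (_ & Hbx & Hdx) (_ & Hby & Hdy).
        apply Nat.divide_pos_le; [lia|].
        assert (H1 : Nat.divide g (c * (y - x))).
        { replace (c * (y - x))%nat with ((b + c * y) - (b + c * x))%nat
            by (rewrite Nat.mul_sub_distr_l; lia).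
          apply Nat.divide_sub_r; assumption. }
        assert (H2 : Nat.divide g (a * (y - x))).
        { replace (a * (y - x))%nat with ((d - a * x) - (d - a * y))%nat
            by (assert (a * x <= a * y <= d)%nat by nia; rewrite Nat.mul_sub_distr_l; lia).
          apply Nat.divide_sub_r; assumption. }
        replace (y - x)%nat with (Nat.gcd (a * (y - x)) (c * (y - x))).
        -- apply Nat.gcd_greatest; assumption.
        -- rewrite Nat.gcd_mul_mono_r, Hg. lia.
      * apply Rplus_le_compat_r. apply Rmult_le_compat_l; [lra|].
        apply Rinv_le_contravar; [exact HGp|]. apply le_INR. lia.
Qed.

(** Subtracting the equations, [b / g] divides [c' - c], where [g = gcd b d <= G]. But
    [b / g >= H > |c' - c|], so the difference is zero. *)
Lemma solution_unique n a c a' c' b d G H :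
  (a * b + c * d = n)%nat -> (a' * b + c' * d = n)%nat -> (Nat.gcd b d <= G)%nat ->
  (c < H)%nat -> (c' < H)%nat -> (G * H <= b)%nat -> (0 < b)%nat -> a = a' /\ c = c'.
Proof.
  revert a c a' c'.
  assert (Hw : forall a c a' c', (a * b + c * d = n)%nat -> (a' * b + c' * d = n)%nat ->
    (Nat.gcd b d <= G)%nat -> (c < H)%nat -> (c' < H)%nat -> (G * H <= b)%nat -> (0 < b)%nat ->
    (c <= c')%nat -> c = c').
  { intros a c a' c' E E' Hg Hc Hc' Hb Hb0 Hle.
    destruct (Nat.eq_dec c c') as [|Hne]; [assumption|exfalso].
    set (g := Nat.gcd b d) in *.
    destruct (Nat.gcd_divide_l b d) as [b' Eb]. destruct (Nat.gcd_divide_r b d) as [d' Ed].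
    fold g in Eb, Ed.
    assert (Hg0 : (0 < g)%nat) by nia.
    assert (Hcop : Nat.gcd b' d' = 1%nat).
    { assert (Hgg : Nat.gcd (b' * g) (d' * g) = g) by (rewrite <- Eb, <- Ed; reflexivity).
      rewrite Nat.gcd_mul_mono_r in Hgg. nia. }
    assert (Hdiv : Nat.divide b' (d' * (c' - c))).
    { exists (a - a')%nat. apply (Nat.mul_cancel_r _ _ g); [lia|].
      replace (d' * (c' - c) * g)%nat with (d * (c' - c))%nat by (rewrite Ed; ring).
      replace ((a - a') * b' * g)%nat with ((a - a') * b)%nat by (rewrite Eb; ring).
      rewrite Nat.mul_sub_distr_l, Nat.mul_sub_distr_r. nia. }
    apply Nat.gauss in Hdiv; [|exact Hcop].
    apply Nat.divide_pos_le in Hdiv; [|lia]. nia. }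
  intros a c a' c' E E' Hg Hc Hc' Hb Hb0.
  assert (Ec : c = c').
  { destruct (le_lt_dec c c').
    - apply (Hw a c a' c'); assumption.
    - symmetry. apply (Hw a' c' a c); auto. lia. }
  split; [|exact Ec]. subst c'. nia.
Qed.

(** * The blocks *)

Definition floor_nat (x : R) : nat := Z.to_nat (Int_part x).

Lemma floor_nat_spec x : 0 <= x -> INR (floor_nat x) <= x < INR (floor_nat x) + 1.
Proof.
  intros Hx. destruct (base_Int_part x) as [H1 H2]. unfold floor_nat.
  assert (Hz : (0 <= Int_part x)%Z).
  { assert (-1 < Int_part x)%Z; [|lia]. apply lt_IZR. lra. }
  rewrite INR_IZR_INZ, Z2Nat.id by exact Hz. lra.
Qed.

Lemma eventually_ge (C : R) : eventually (fun j => C <= INR j).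
Proof.
  exists (S (floor_nat (Rabs C))). intros j Hj. apply le_INR in Hj. rewrite S_INR in Hj.
  pose proof (floor_nat_spec (Rabs C) (Rabs_pos C)). pose proof (Rle_abs C). lra.
Qed.

(** The shift by one keeps the logarithm defined and nonnegative at [j = 0]. *)
Definition lg (j : nat) : R := ln (INR j + 1).
Definition sqrt_lg (j : nat) : R := sqrt (lg j).

Lemma lg_nonneg j : 0 <= lg j.
Proof. pose proof (pos_INR j). unfold lg. rewrite <- ln_1. apply ln_le; lra. Qed.

Lemma lg_le i j : (i <= j)%nat -> lg i <= lg j.
Proof. intros H. apply le_INR in H. pose proof (pos_INR i). unfold lg. apply ln_le; lra. Qed.

Lemma eventually_sqrt_lg_ge (C : R) : eventually (fun j => C <= sqrt_lg j).
Proof.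
  destruct (eventually_ge (exp (C * C))) as [N HN]. exists N. intros j Hj.
  specialize (HN j Hj). unfold sqrt_lg.
  destruct (Rle_lt_dec C 0) as [H|H]; [eapply Rle_trans; [exact H|apply sqrt_pos]|].
  rewrite <- (sqrt_square C) by lra. apply sqrt_le_1_alt.
  rewrite <- (ln_exp (C * C)). unfold lg. apply ln_le; [apply exp_pos|lra].
Qed.

Section Blocks.

Variable K : R.
Hypothesis K_pos : 0 < K.

Definition grow (j : nat) : R := K * (INR j * INR j) * sqrt_lg j.

Lemma grow_nonneg j : 0 <= grow j.
Proof.
  pose proof (pos_INR j). unfold grow. repeat apply Rmult_le_pos; try lra. apply sqrt_pos.
Qed.

Lemma sqrt_lg_le i j : (i <= j)%nat -> sqrt_lg i <= sqrt_lg j.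
Proof. intros H. apply sqrt_le_1_alt, lg_le, H. Qed.

Lemma grow_le i j : (i <= j)%nat -> grow i <= grow j.
Proof.
  intros H. unfold grow. pose proof (le_INR _ _ H). pose proof (pos_INR i).
  apply Rmult_le_compat.
  - repeat apply Rmult_le_pos; lra.
  - apply sqrt_pos.
  - apply Rmult_le_compat_l; [lra|]. apply Rmult_le_compat; lra.
  - apply sqrt_lg_le, H.
Qed.

(* The summand [j] only serves to make [xi] strictly increasing. *)
Definition xi (j : nat) : nat := (j + floor_nat (grow j))%nat.

Lemma xi_bounds j : grow j + INR j - 1 < INR (xi j) <= grow j + INR j.
Proof.
  unfold xi. rewrite plus_INR. pose proof (floor_nat_spec (grow j) (grow_nonneg j)). lra.
Qed.

Lemma xi_lt_S j : (xi j < xi (S j))%nat.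
Proof.
  apply INR_lt. unfold xi. rewrite !plus_INR, S_INR.
  assert (H : (floor_nat (grow j) <= floor_nat (grow (S j)))%nat).
  { pose proof (floor_nat_spec _ (grow_nonneg j)). pose proof (floor_nat_spec _ (grow_nonneg (S j))).
    pose proof (grow_le j (S j) ltac:(lia)).
    assert (INR (floor_nat (grow j)) < INR (S (floor_nat (grow (S j))))) by (rewrite S_INR; lra).
    apply INR_lt in H2. lia. }
  apply le_INR in H. lra.
Qed.

Lemma xi_lt i j : (i < j)%nat -> (xi i < xi j)%nat.
Proof.
  intros H. induction H as [|j H IH]; [apply xi_lt_S|]. pose proof (xi_lt_S j). lia.
Qed.

Lemma xi_le i j : (i <= j)%nat -> (xi i <= xi j)%nat.
Proof. intros H. destruct (Nat.eq_dec i j) as [->|]; [lia|]. pose proof (xi_lt i j). lia. Qed.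

Lemma xi_ge j : (j <= xi j)%nat.
Proof. unfold xi. lia. Qed.

Definition len (j : nat) : nat := (xi (S j) - xi j)%nat.
Definition block (j : nat) : list nat := seq (xi j) (len j).

Lemma block_nonempty j : block j <> nil.
Proof.
  unfold block, len. pose proof (xi_lt_S j).
  destruct (xi (S j) - xi j)%nat eqn:E; [lia|]. discriminate.
Qed.

Lemma in_block j x : In x (block j) <-> (xi j <= x < xi (S j))%nat.
Proof. unfold block, len. rewrite in_seq. pose proof (xi_lt_S j). lia. Qed.

Lemma block_disjoint i j x : In x (block i) -> In x (block j) -> i = j.
Proof.
  rewrite !in_block. intros Hi Hj.
  destruct (lt_eq_lt_dec i j) as [[H|H]|H]; [|exact H|].
  - pose proof (xi_le (S i) j H). lia.
  - pose proof (xi_le (S j) i H). lia.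
Qed.

Lemma block_of m y : (xi m <= y)%nat -> exists j, (m <= j)%nat /\ In y (block j).
Proof.
  intros Hm. assert (H : forall d, (y < xi (m + d))%nat -> exists j, (m <= j)%nat /\ In y (block j)).
  { induction d as [|d IH]; intros Hd.
    - rewrite Nat.add_0_r in Hd. lia.
    - destruct (lt_dec y (xi (m + d))) as [Hlt|Hge]; [apply IH, Hlt|].
      exists (m + d)%nat. split; [lia|]. apply in_block. rewrite <- plus_n_Sm in Hd. lia. }
  apply (H (S y)). pose proof (xi_ge (m + S y)). lia.
Qed.

Lemma length_block j : length (block j) = len j.
Proof. apply length_seq. Qed.

Lemma block_union m k : flat_map block (seq m k) = seq (xi m) (xi (m + k) - xi m).
Proof.
  revert m. induction k as [|k IH]; intros m.
  - rewrite Nat.add_0_r, Nat.sub_diag. reflexivity.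
  - change (flat_map block (seq m (S k))) with (block m ++ flat_map block (seq (S m) k)).
    rewrite IH. unfold block, len. pose proof (xi_lt_S m). pose proof (xi_le (S m) (S m + k) ltac:(lia)).
    replace (m + S k)%nat with (S m + k)%nat by lia.
    replace (xi (S m + k) - xi m)%nat with ((xi (S m) - xi m) + (xi (S m + k) - xi (S m)))%nat by lia.
    rewrite seq_app. f_equal. f_equal. lia.
Qed.

(** The asymptotics of the blocks, with relative error [eta], in the form consumed later: [reg_sqr]
    bounds [ln j] by half the logarithm of a value in the block, [reg_double] puts [x] in an earlier
    block than [y] when [2 x <= y], and [reg_len_ge] makes degrees small. *)
Record regular (eta : R) (j : nat) : Prop := {
  reg_pos : 1 <= INR j;
  reg_sl : 1 <= sqrt_lg j;
  reg_sqr : (INR j + 1) * (INR j + 1) <= INR (xi j);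
  reg_lower : K * (INR j * INR j) * sqrt_lg j <= INR (xi j);
  reg_upper : INR (xi (S j)) <= (1 + eta) * K * ((INR j + 1) * (INR j + 1)) * sqrt_lg j;
  reg_len_ge : INR j <= INR (len j);
  reg_len_ge' : K * INR j * sqrt_lg j <= INR (len j);
  reg_len_le : INR (len j) <= (1 + eta) * (2 * K * INR j * sqrt_lg j);
  reg_double : INR (xi (S j)) <= 2 * INR (xi j)
}.

(** The logarithm grows by at most [1 / (j + 1)], a relative growth of at most [eta / (j + 1)] once
    [eta * lg j >= 1]; the square root halves it. *)
Lemma sqrt_lg_succ eta j : 0 < eta -> 1 <= eta * lg j ->
  sqrt_lg (S j) <= sqrt_lg j * (1 + eta / (2 * (INR j + 1))).
Proof.
  intros He Hl. pose proof (pos_INR j) as Hj.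
  assert (H1 : lg (S j) <= lg j + / (INR j + 1)).
  { unfold lg. rewrite S_INR. pose proof (ln_succ_sub (INR j + 1) ltac:(lra)). lra. }
  set (r := / (INR j + 1)) in *.
  assert (Hr : 0 < r) by (apply Rinv_0_lt_compat; lra).
  replace (eta / (2 * (INR j + 1))) with (eta * r / 2) by (unfold r; field; lra).
  unfold sqrt_lg. pose proof (sqrt_pos (lg j)). pose proof (lg_nonneg j).
  assert (0 < eta * r) by (apply Rmult_lt_0_compat; lra).
  rewrite <- (sqrt_square (sqrt (lg j) * (1 + eta * r / 2))) by (apply Rmult_le_pos; lra).
  apply sqrt_le_1_alt.
  replace (sqrt (lg j) * (1 + eta * r / 2) * (sqrt (lg j) * (1 + eta * r / 2)))
    with ((sqrt (lg j) * sqrt (lg j)) * ((1 + eta * r / 2) * (1 + eta * r / 2))) by ring.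
  rewrite sqrt_sqrt by assumption.
  assert (r <= eta * lg j * r) by nra. nra.
Qed.

Lemma eventually_regular eta : 0 < eta <= 1 -> eventually (regular eta).
Proof.
  intros He.
  assert (HA : eventually (fun j => (1 <= INR j /\ 10 / eta <= INR j) /\
     ((1 <= sqrt_lg j /\ 4 <= K * sqrt_lg j) /\ / eta <= sqrt_lg j))).
  { repeat apply filter_and; try apply eventually_ge; try apply eventually_sqrt_lg_ge.
    apply (filter_imp (fun j => 4 / K <= sqrt_lg j)); [|apply eventually_sqrt_lg_ge].
    intros j Hj. apply (Rmult_le_compat_l K) in Hj; [|lra].
    replace (K * (4 / K)) with 4 in Hj by (field; lra). exact Hj. }
  revert HA. apply filter_imp. intros j [[Hj1 Hj2] [[Hs1 Hs2] Hs3]].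
  assert (Hje : 10 <= eta * INR j).
  { apply (Rmult_le_compat_l eta) in Hj2; [|lra].
    replace (eta * (10 / eta)) with 10 in Hj2 by (field; lra). exact Hj2. }
  assert (Hse : 1 <= eta * sqrt_lg j).
  { apply (Rmult_le_compat_l eta) in Hs3; [|lra]. rewrite Rinv_r in Hs3 by lra. exact Hs3. }
  assert (Hlg : sqrt_lg j <= lg j).
  { unfold sqrt_lg in *. pose proof (lg_nonneg j). rewrite <- (sqrt_sqrt (lg j)) at 2 by assumption. nra. }
  assert (Hsucc := sqrt_lg_succ eta j ltac:(lra) ltac:(nra)).
  destruct (xi_bounds j) as [Hx1 Hx2]. destruct (xi_bounds (S j)) as [Hy1 Hy2].
  pose proof (sqrt_lg_le j (S j) ltac:(lia)) as Hmono.
  assert (Hg1 : grow (S j) <= K * ((INR j + 1) * (INR j + 1)) * sqrt_lg j + K * sqrt_lg j * (eta * (INR j + 1) / 2)).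
  { unfold grow. rewrite S_INR.
    apply Rle_trans with (K * ((INR j + 1) * (INR j + 1)) * (sqrt_lg j * (1 + eta / (2 * (INR j + 1))))).
    - apply Rmult_le_compat_l; [|exact Hsucc]. nra.
    - right. field. lra. }
  assert (Hg2 : K * ((INR j + 1) * (INR j + 1)) * sqrt_lg j <= grow (S j)).
  { unfold grow. rewrite S_INR. apply Rmult_le_compat_l; [nra|exact Hmono]. }
  assert (Hg : grow j = K * sqrt_lg j * (INR j * INR j)) by (unfold grow; ring).
  assert (Hlen : INR (len j) = INR (xi (S j)) - INR (xi j)).
  { unfold len. rewrite minus_INR; [reflexivity|]. pose proof (xi_lt_S j). lia. }
  rewrite S_INR in *. set (P := K * sqrt_lg j) in *. set (x := INR j) in *.
  replace (K * ((x + 1) * (x + 1)) * sqrt_lg j) with (P * ((x + 1) * (x + 1))) in * by (unfold P; ring).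
  assert (Hlen_le : INR (len j) <= (1 + eta) * (2 * P * x)).
  { rewrite Hlen.
    assert (H : P * (2 * x + 1 + eta * (x + 1) / 2) + 2 <= (1 + eta) * (2 * P * x)).
    { assert (P * (2 * x + 1 + eta * (x + 1) / 2 + 1 / 2) <= P * ((1 + eta) * (2 * x))).
      { apply Rmult_le_compat_l; nra. }
      nra. }
    nra. }
  constructor; fold x.
  - exact Hj1.
  - exact Hs1.
  - assert ((x + 1) * (x + 1) <= 4 * (x * x)) by nra.
    assert (4 * (x * x) <= P * (x * x)) by (apply Rmult_le_compat_r; nra). lra.
  - replace (K * (x * x) * sqrt_lg j) with (P * (x * x)) by (unfold P; ring). lra.
  - replace ((1 + eta) * K * ((x + 1) * (x + 1)) * sqrt_lg j) with ((1 + eta) * P * ((x + 1) * (x + 1)))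
      by (unfold P; ring).
    assert (P * (eta * (x + 1) / 2) + (x + 1) <= eta * P * ((x + 1) * (x + 1))); [|lra].
    assert (0 <= P * eta * ((x + 1) * x)) by (repeat apply Rmult_le_pos; lra).
    assert (4 * (x + 1) <= P * (x + 1)) by nra.
    assert (P * (x + 1) * 1 <= P * (x + 1) * (eta * (x + 1) / 2)) by (apply Rmult_le_compat_l; nra).
    nra.
  - nra.
  - replace (K * x * sqrt_lg j) with (P * x) by (unfold P; ring). nra.
  - replace (2 * K * x * sqrt_lg j) with (2 * P * x) by (unfold P; ring). exact Hlen_le.
  - assert (INR (len j) <= INR (xi j)); [|lra].
    assert (Hx10 : 10 <= x) by nra.
    assert (P * x * 10 <= P * x * x) by (apply Rmult_le_compat_l; nra).
    assert ((1 + eta) * (2 * P * x) <= 4 * (P * x)) by nra. nra.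
Qed.

End Blocks.

(** * The probability that [n] is missed *)

Lemma Rsum_indic_image T (l : list nat) (P : nat -> Prop) (h : nat -> nat) :
  (forall s t, (s < t < T)%nat -> h s <> h t) ->
  (forall t, (t < T)%nat -> P t -> In (h t) l) ->
  Rsum (seq 0 T) (fun t => indic (P t)) <=
  Rsum l (fun y => indic (exists t, (t < T)%nat /\ P t /\ y = h t)).
Proof.
  intros Hinj Hin. rewrite !Rsum_indic. apply le_INR.
  set (F := filter _ (seq 0 T)).
  assert (HF : forall t, In t F -> (t < T)%nat /\ P t).
  { intros t Ht. apply filter_In in Ht. destruct Ht as [H1 H2]. apply in_seq in H1.
    destruct (excluded_middle_informative (P t)); [split; [lia|assumption]|discriminate]. }
  rewrite <- (length_map h F). apply NoDup_incl_length.
  - apply NoDup_map_NoDup_ForallPairs; [|apply NoDup_filter, seq_NoDup].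
    intros s t Hs Ht E. apply HF in Hs. apply HF in Ht.
    destruct (lt_eq_lt_dec s t) as [[Hl|Hl]|Hl]; [|exact Hl|]; exfalso.
    + apply (Hinj s t); [lia|exact E].
    + apply (Hinj t s); [lia|symmetry; exact E].
  - intros y Hy. apply in_map_iff in Hy. destruct Hy as (t & <- & Ht). apply HF in Ht.
    apply filter_In. split; [apply Hin; tauto|].
    destruct (excluded_middle_informative _) as [|Hno]; [reflexivity|].
    exfalso. apply Hno. exists t. tauto.
Qed.

Lemma Rsum_indic_unique {T} (l : list T) (P : T -> Prop) :
  NoDup l -> (forall x y, In x l -> In y l -> P x -> P y -> x = y) ->
  Rsum l (fun x => indic (P x)) <= indic (exists x, In x l /\ P x).
Proof.
  intros Hn H. destruct (excluded_middle_informative (exists x, In x l /\ P x)) as [Hex|Hno].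
  - rewrite (indic_true _ Hex). destruct Hex as (a & Ha & HPa). rewrite <- (indic_true (P a)) by exact HPa.
    apply (Rsum_single l (fun x => indic (P x))); [exact Hn|apply indic_range|].
    intros x Hx Hne. apply indic_false. intros HPx. apply Hne. apply H; assumption.
  - rewrite (indic_false _ Hno). right. apply Rsum_eq0. intros x Hx. apply indic_false.
    intros HP. apply Hno. exists x. tauto.
Qed.

Lemma sqr_succ_le x : 1 <= x -> (x + 1) * (x + 1) <= 4 * (x * x).
Proof. nra. Qed.

(** Bounding the indices by [n] makes the event depend on the first [n] picks only, so that its
    probability is a finite average. *)
Definition represented (n : nat) (al : nat -> nat) : Prop :=
  exists i j k l, (i < n /\ j < n /\ k < n /\ l < n)%nat /\ n = (al i * al j + al k * al l)%nat.

(** * One target [n], with [q = n^(1/400)] *)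

Section FixedTarget.

Variables (K : R) (n : nat) (q L : R).
Hypothesis K_pos : 0 < K.
Hypothesis K_small : 32 * (K * K) <= 1.
Hypothesis L_def : L = ln (INR n).
Hypothesis q_def : q = exp (L / 400).
Hypothesis n_pos : (0 < n)%nat.
Hypothesis q_large : 1000000 * (1 + L) <= q.
Hypothesis q_large_K : 4 * K * (1 + L) <= q.
Hypothesis reg : forall j, q <= INR j -> regular K (1 / 100) j.
Hypothesis few_divisors : forall m, (0 < m <= n)%nat -> INR (length (divisors m)) <= q.

Lemma L_nonneg : 0 <= L.
Proof. rewrite L_def, <- ln_1. apply ln_le; [lra|]. apply (le_INR 1). lia. Qed.

Lemma q_ge : 1000000 <= q.
Proof. pose proof L_nonneg. lra. Qed.

Lemma L_ge : 800 <= L.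
Proof.
  destruct (Rle_lt_dec 800 L) as [|H]; [assumption|exfalso].
  pose proof q_ge. rewrite q_def in H0.
  assert (exp (L / 400) <= exp (1 + 1)) by (apply exp_le; lra).
  rewrite exp_plus in H1. pose proof exp_le_3. pose proof (exp_pos 1). nra.
Qed.

(* Powers of [q] are kept folded: [nra] would expand [qpow 400] as a monomial. *)
Definition qpow (k : nat) : R := q ^ k.

Lemma qpow_add a b : qpow (a + b) = qpow a * qpow b.
Proof. apply pow_add. Qed.

Lemma qpow_split k a b : k = (a + b)%nat -> qpow k = qpow a * qpow b.
Proof. intros ->. apply qpow_add. Qed.

Lemma qpow_1 : qpow 1 = q.
Proof. apply pow_1. Qed.

Lemma qpow_2 : qpow 2 = q * q.
Proof. unfold qpow. ring. Qed.

Lemma n_eq_qpow : INR n = qpow 400.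
Proof.
  unfold qpow. rewrite <- Rpower_pow by (pose proof q_ge; lra). unfold Rpower.
  rewrite q_def, ln_exp. replace (INR 400 * (L / 400)) with L by (simpl; field).
  rewrite L_def. symmetry. apply exp_ln, lt_0_INR, n_pos.
Qed.

Lemma ln_qpow k : ln (qpow k) = INR k * (L / 400).
Proof.
  unfold qpow. rewrite q_def, ln_pow by apply exp_pos. rewrite ln_exp. reflexivity.
Qed.

Lemma sqrt_L : sqrt L <= 1 + L.
Proof.
  pose proof L_ge. rewrite <- (sqrt_square (1 + L)) by lra. apply sqrt_le_1_alt. nra.
Qed.

Lemma K_sqrt_L : 4 * K * sqrt L <= q.
Proof.
  pose proof sqrt_L. apply Rle_trans with (4 * K * (1 + L)); [|exact q_large_K].
  apply Rmult_le_compat_l; lra.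
Qed.

Lemma qpow_le i j : (i <= j)%nat -> qpow i <= qpow j.
Proof. intros H. apply Rle_pow; [pose proof q_ge; lra|exact H]. Qed.

Lemma qpow_pos i : 0 < qpow i.
Proof. apply pow_lt. pose proof q_ge; lra. Qed.

(** The ratio [q] between the indices makes [a] negligible against [c]; the lower bound [q] makes
    the blocks regular and the pair weights small; the upper bound keeps [a c] at most about
    [n / q^6] and leaves a gap of [q^2] below [cut]. *)
Definition paired (i k : nat) : Prop :=
  q <= INR i /\ INR i * q <= INR k /\ INR k + 1 <= qpow 98.

(** The indices are split near [q^100]. [gcd_cap], near [q^2], is exceeded by few solutions, since
    [n] has at most [q] divisors; [coef_cap], near [q^197], exceeds every [c]. Their product is at
    most [q^200], so the condition that it stay below [y], on which [solution_unique] rests, is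
    cheap. *)
Definition cut : nat := S (floor_nat (qpow 100)).
Definition gcd_cap : nat := S (floor_nat (qpow 2)).
Definition coef_cap : nat := S (floor_nat (qpow 197)).

Lemma S_floor_nat_bounds x : 0 <= x -> x < INR (S (floor_nat x)) <= x + 1.
Proof. intros Hx. pose proof (floor_nat_spec x Hx). rewrite S_INR. lra. Qed.

Lemma cut_bounds : qpow 100 < INR cut <= qpow 100 + 1.
Proof. apply S_floor_nat_bounds. left; apply qpow_pos. Qed.

Lemma cut_lt_n : (cut < n)%nat.
Proof.
  apply INR_lt. rewrite n_eq_qpow. pose proof cut_bounds. pose proof q_ge.
  pose proof (qpow_le 1 100 ltac:(lia)). pose proof (qpow_le 101 400 ltac:(lia)).
  rewrite (qpow_split 101 1 100 eq_refl), qpow_1 in H2. rewrite qpow_1 in H1.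
  pose proof (qpow_pos 100). assert (2 * qpow 100 <= q * qpow 100) by (apply Rmult_le_compat_r; lra). lra.
Qed.

Lemma paired_lt i k : paired i k -> (i < k < cut)%nat.
Proof.
  intros (H1 & H2 & H3). pose proof q_ge. split; apply INR_lt.
  { assert (INR i * 1 < INR i * q) by (apply Rmult_lt_compat_l; lra). lra. }
  pose proof cut_bounds. pose proof (qpow_le 98 100 ltac:(lia)). lra.
Qed.

(** Since [ln (q^98) = 98 L / 400 < L / 4]: the factor 1/2 gained here enters the constant 42. *)
Lemma sqrt_lg_small j : INR j + 1 <= qpow 98 -> sqrt_lg j <= sqrt L / 2.
Proof.
  intros H. pose proof L_ge. unfold sqrt_lg.
  replace (sqrt L / 2) with (sqrt (L / 4)).
  - apply sqrt_le_1_alt. unfold lg. apply Rle_trans with (ln (qpow 98)).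
    + apply ln_le; [pose proof (pos_INR j); lra|exact H].
    + rewrite ln_qpow. simpl. lra.
  - rewrite sqrt_div_alt by lra. f_equal.
    replace 4 with (2 * 2) by ring. apply sqrt_square. lra.
Qed.

Lemma block_value j a : q <= INR j -> INR j + 1 <= qpow 98 -> In a (block K j) ->
  INR a <= 101 / 200 * K * sqrt L * ((INR j + 1) * (INR j + 1)) /\
  INR a <= 101 / 100 * K * ((INR j + 1) * (INR j + 1)) * sqrt_lg j.
Proof.
  intros Hj1 Hj2 Ha. destruct (reg j Hj1) as [Rpos Rsl Rsq Rlow Rup Rlen Rlen' Rlen_le Rdbl]. apply in_block in Ha; [|exact K_pos].
  assert (Hle : INR a <= INR (xi K (S j))) by (apply le_INR; lia).
  pose proof (sqrt_lg_small j Hj2). pose proof (pos_INR j).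
  assert (0 <= K * ((INR j + 1) * (INR j + 1))) by (apply Rmult_le_pos; nra).
  assert (K * ((INR j + 1) * (INR j + 1)) * sqrt_lg j <= K * ((INR j + 1) * (INR j + 1)) * (sqrt L / 2))
    by (apply Rmult_le_compat_l; assumption).
  split; nra.
Qed.

(** * Edges between late blocks, for fixed early picks *)

Section Prefix.

Variable al : nat -> nat.
Hypothesis al_valid : forall j, (j < cut)%nat -> In (al j) (block K j).

Lemma al_pos i : q <= INR i -> (i < cut)%nat -> (0 < al i)%nat.
Proof.
  intros Hq Hi. specialize (al_valid i Hi). apply in_block in al_valid; [|exact K_pos].
  pose proof (xi_ge K i). pose proof q_ge.
  assert (0 < i)%nat by (apply INR_lt; simpl; lra). lia.
Qed.

(** Values grow like squares of indices, so the ratio [q] between indices becomes about [q^2]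
    between values, and one [q] pays for the constant 5. In [q^197], one [q] absorbs [K sqrt L] and
    the rest bounds [(k + 1)^2]. *)
Lemma paired_facts i k : paired i k ->
  1 <= INR (al i) /\ INR (al i) * q <= INR (al k) /\ INR (al k) <= qpow 197 /\
  INR (al i) <= 101 / 200 * K * sqrt L * ((INR i + 1) * (INR i + 1)) /\
  INR (al k) <= 101 / 200 * K * sqrt L * ((INR k + 1) * (INR k + 1)).
Proof.
  intros HP. pose proof (paired_lt i k HP) as Hlt. destruct HP as (H1 & H2 & H3).
  pose proof q_ge as Hq.
  assert (Hik : INR i < INR k) by (apply lt_INR; lia).
  destruct (block_value i (al i) H1 ltac:(lra) (al_valid i ltac:(lia))) as [Ha1 Ha2].
  destruct (block_value k (al k) ltac:(lra) H3 (al_valid k ltac:(lia))) as [Hc1 Hc2].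
  repeat split; try assumption.
  - apply (le_INR 1). pose proof (al_pos i H1 ltac:(lia)). lia.
  - destruct (reg k ltac:(lra)) as [Rpos Rsl Rsq Rlow Rup Rlen Rlen' Rlen_le Rdbl]. pose proof (al_valid k ltac:(lia)) as Hk.
    apply in_block in Hk; [|exact K_pos].
    assert (Hkc : INR (xi K k) <= INR (al k)) by (apply le_INR; lia).
    assert (Hsl : sqrt_lg i <= sqrt_lg k) by (apply sqrt_lg_le; lia).
    assert (0 <= sqrt_lg i) by apply sqrt_pos.
    set (Z := K * (INR i * INR i) * sqrt_lg i).
    assert (HZ : 0 <= Z) by (unfold Z; repeat apply Rmult_le_pos; lra).
    assert (Ha : INR (al i) <= 5 * Z).
    { eapply Rle_trans; [exact Ha2|]. unfold Z.
      assert ((INR i + 1) * (INR i + 1) <= 4 * (INR i * INR i)) by (apply sqr_succ_le; lra).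
      assert (K * ((INR i + 1) * (INR i + 1)) * sqrt_lg i <= K * (4 * (INR i * INR i)) * sqrt_lg i).
      { apply Rmult_le_compat_r; [assumption|]. apply Rmult_le_compat_l; lra. }
      unfold Z in HZ. lra. }
    assert (Hc : q * q * Z <= INR (al k)).
    { eapply Rle_trans; [|exact Hkc]. eapply Rle_trans; [|exact Rlow].
      replace (q * q * Z) with (K * ((INR i * q) * (INR i * q)) * sqrt_lg i) by (unfold Z; ring).
      assert (0 <= INR i * q) by (apply Rmult_le_pos; lra).
      apply Rmult_le_compat; [|assumption| |exact Hsl].
      + repeat apply Rmult_le_pos; lra.
      + apply Rmult_le_compat_l; [lra|]. apply Rmult_le_compat; lra. }
    assert (INR (al i) * q <= 5 * Z * q) by (apply Rmult_le_compat_r; lra).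
    assert (5 * (Z * q) <= q * (Z * q)) by (apply Rmult_le_compat_r; [apply Rmult_le_pos|]; lra).
    lra.
  - eapply Rle_trans; [exact Hc1|].
    pose proof K_sqrt_L. pose proof (sqrt_pos L).
    rewrite (qpow_split 197 1 196 eq_refl), (qpow_split 196 98 98 eq_refl), qpow_1.
    pose proof (pos_INR k).
    apply Rmult_le_compat; [|apply Rmult_le_pos; lra| |apply Rmult_le_compat; lra].
    + assert (0 <= K * sqrt L) by (apply Rmult_le_pos; lra). lra.
    + assert (0 <= K * sqrt L) by (apply Rmult_le_pos; lra). lra.
Qed.

(** With [c <= q^197] this gives [c * xi K cut <= q^398 = n / q^2]: requiring [x] to lie beyond the
    cut discards a negligible part of the solutions. *)
Lemma xi_cut_le : INR (xi K cut) <= qpow 201.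
Proof.
  pose proof cut_bounds as Hm. pose proof q_ge as Hq.
  pose proof (qpow_le 1 100 ltac:(lia)) as Hq1. rewrite qpow_1 in Hq1.
  destruct (reg cut ltac:(lra)) as [Rpos Rsl Rsq Rlow Rup Rlen Rlen' Rlen_le Rdbl].
  assert (Hx : INR (xi K cut) <= INR (xi K (S cut)))
    by (apply le_INR, xi_le; [exact K_pos|lia]).
  assert (Hsl : sqrt_lg cut <= sqrt L).
  { unfold sqrt_lg. apply sqrt_le_1_alt. rewrite L_def. unfold lg. apply ln_le; [lra|].
    rewrite <- S_INR. apply le_INR. pose proof cut_lt_n. lia. }
  assert (HA : (INR cut + 1) * (INR cut + 1) <= 2 * (qpow 100 * qpow 100)).
  { apply Rle_trans with ((4 / 3 * qpow 100) * (4 / 3 * qpow 100)).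
    - apply Rmult_le_compat; lra.
    - pose proof (Rle_0_sqr (qpow 100)) as Hs. unfold Rsqr in Hs. lra. }
  pose proof K_sqrt_L. pose proof (sqrt_pos L).
  assert (HK : 0 <= K * sqrt L) by (apply Rmult_le_pos; lra).
  rewrite (qpow_split 201 1 200 eq_refl), (qpow_split 200 100 100 eq_refl), qpow_1.
  pose proof (qpow_pos 100) as Hqp.
  assert ((1 + 1 / 100) * K * ((INR cut + 1) * (INR cut + 1)) * sqrt_lg cut
    <= (1 + 1 / 100) * K * (2 * (qpow 100 * qpow 100)) * sqrt L).
  { apply Rmult_le_compat; [|apply sqrt_pos| |exact Hsl].
    - repeat apply Rmult_le_pos; lra.
    - apply Rmult_le_compat_l; lra. }
  assert (0 <= qpow 100 * qpow 100) by (apply Rmult_le_pos; lra).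
  assert (4 * K * sqrt L * (qpow 100 * qpow 100) <= q * (qpow 100 * qpow 100))
    by (apply Rmult_le_compat_r; lra).
  lra.
Qed.

Lemma caps_bounds :
  (0 < gcd_cap)%nat /\ qpow 2 <= INR gcd_cap /\ qpow 197 < INR coef_cap /\
  INR (gcd_cap * coef_cap) <= qpow 200.
Proof.
  pose proof q_ge as Hq.
  destruct (S_floor_nat_bounds (qpow 2)) as [HG1 HG2]; [left; apply qpow_pos|].
  destruct (S_floor_nat_bounds (qpow 197)) as [HH1 HH2]; [left; apply qpow_pos|].
  fold gcd_cap in HG1, HG2. fold coef_cap in HH1, HH2.
  split; [unfold gcd_cap; lia|]. split; [lra|]. split; [lra|].
  rewrite mult_INR.
  pose proof (qpow_le 1 2 ltac:(lia)) as H1. pose proof (qpow_le 1 197 ltac:(lia)) as H2.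
  rewrite qpow_1 in H1, H2.
  rewrite (qpow_split 200 1 199 eq_refl), (qpow_split 199 2 197 eq_refl), qpow_1.
  assert (INR gcd_cap * INR coef_cap <= (2 * qpow 2) * (2 * qpow 197))
    by (apply Rmult_le_compat; lra || apply pos_INR).
  assert (0 <= qpow 2 * qpow 197) by (apply Rmult_le_pos; lra).
  assert (4 * (qpow 2 * qpow 197) <= q * (qpow 2 * qpow 197)) by (apply Rmult_le_compat_r; lra). lra.
Qed.

(** [R0] is [n / (a c)], the number of solutions to expect. The losses are [1 / q^2] for [x] beyond
    the cut, [2 / q] for starting [y] above [2 n / c], rounding, and the solutions with a large gcd;
    [7 / q] covers them all. *)
Lemma count_arith (R0 T G tau : R) :
  qpow 6 <= R0 -> R0 * (1 - 1 / (q * q) - 2 / q) - 3 <= T -> 0 <= T <= R0 -> qpow 2 <= G ->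
  0 <= tau <= q ->
  R0 * (1 - 7 / q) <= T - tau * (T / G + 1).
Proof.
  intros HR HT HT2 HG Htau. pose proof q_ge as Hq.
  set (r := R0 / q).
  assert (Hr : R0 = r * q) by (unfold r; field; lra).
  rewrite qpow_2 in HG.
  assert (Hr5 : q * q <= r).
  { apply Rmult_le_reg_r with q; [lra|]. rewrite <- Hr.
    pose proof (qpow_le 3 6 ltac:(lia)) as H36.
    rewrite (qpow_split 3 2 1 eq_refl), qpow_1, qpow_2 in H36. lra. }
  assert (Hr2 : q + 3 <= r) by nra.
  assert (E1 : R0 * (1 - 1 / (q * q) - 2 / q) = R0 - r / q - 2 * r) by (unfold r; field; lra).
  assert (E2 : R0 * (1 - 7 / q) = R0 - 7 * r) by (unfold r; field; lra).
  assert (Hrq : r / q <= r).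
  { apply Rmult_le_reg_r with q; [lra|]. unfold Rdiv. rewrite Rmult_assoc, Rinv_l by lra. nra. }
  assert (HTG : tau * (T / G + 1) <= r + q).
  { assert (HGp : 0 < G) by nra.
    assert (T / G <= r / q).
    { apply Rmult_le_reg_r with (G * q); [nra|].
      replace (T / G * (G * q)) with (T * q) by (field; lra).
      replace (r / q * (G * q)) with (r * G) by (field; lra).
      apply Rle_trans with (r * q * q); nra. }
    assert (0 <= T / G) by (apply Rdiv_le_0_compat; lra).
    apply Rle_trans with (q * (r / q + 1)); [apply Rmult_le_compat; lra|].
    right. field. lra. }
  lra.
Qed.

(** The solutions form the progression [y = b + c t], [x = d - a t]. It is started at a large [y]
    and stopped before [x] drops below the late blocks. *)
Lemma solution_count_ge i k : paired i k -> Nat.gcd (al i) (al k) = 1%nat ->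
  exists T b d : nat,
    (forall t, (t < T)%nat ->
      (al i * (b + al k * t) + al k * (d - al i * t) = n)%nat /\
      (gcd_cap * coef_cap <= b + al k * t)%nat /\ (xi K cut <= d - al i * t)%nat /\
      (2 * (d - al i * t) <= b + al k * t)%nat) /\
    INR n / (INR (al i) * INR (al k)) * (1 - 7 / q) <=
    Rsum (seq 0 T) (fun t => indic (Nat.gcd (b + al k * t) (d - al i * t) <= gcd_cap)%nat).
Proof.
  intros HP Hg. destruct (paired_facts i k HP) as (Ha1 & Haq & Hcq & _ & _).
  pose proof q_ge as Hq. pose proof xi_cut_le as HY. destruct caps_bounds as (HG0 & HG & HH & HGH).
  set (a := al i) in *. set (c := al k) in *.
  assert (Hc1 : 1 <= INR c) by nra.
  assert (Ha0 : (0 < a)%nat) by (apply INR_lt; simpl; lra).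
  assert (Hc0 : (0 < c)%nat) by (apply INR_lt; simpl; lra).
  set (N := INR n). assert (HN : N = qpow 400) by apply n_eq_qpow.
  (* Just above [2 n / c]: since [c x <= n], every [y >= u] then satisfies [2 x <= y]. The price
     [a u] is only about [2 n / q], because [a q <= c]. *)
  set (u := S (floor_nat (2 * N / INR c))).
  assert (HNp : 0 < N) by (rewrite HN; apply qpow_pos).
  destruct (S_floor_nat_bounds (2 * N / INR c)) as [Hu1 Hu2]; [left; apply Rdiv_lt_0_compat; lra|].
  fold u in Hu1, Hu2.
  assert (Hu1' : 2 * N < INR c * INR u).
  { apply (Rmult_lt_compat_l (INR c)) in Hu1; [|lra].
    replace (INR c * (2 * N / INR c)) with (2 * N) in Hu1 by (field; lra). exact Hu1. }
  assert (Hcu : INR c * INR u <= 2 * N + INR c).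
  { apply (Rmult_le_compat_l (INR c)) in Hu2; [|lra].
    replace (INR c * (2 * N / INR c + 1)) with (2 * N + INR c) in Hu2 by (field; lra). exact Hu2. }
  set (Y := INR (xi K cut)) in *.
  set (ac := INR a * INR c).
  assert (Hac : 1 <= ac) by (unfold ac; nra).
  set (R0 := N / ac).
  assert (ER : N = R0 * ac) by (unfold R0; field; lra).
  assert (HacN : ac * qpow 6 <= N).
  { rewrite HN. rewrite (qpow_split 400 394 6 eq_refl), (qpow_split 394 197 197 eq_refl).
    apply Rmult_le_compat_r; [left; apply qpow_pos|]. unfold ac. apply Rmult_le_compat; nra. }
  assert (HR6 : qpow 6 <= R0).
  { apply Rmult_le_reg_r with ac; [lra|]. rewrite <- ER. lra. }
  assert (HcY : INR c * Y <= N / (q * q)).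
  { apply Rle_trans with (qpow 197 * qpow 201).
    - apply Rmult_le_compat; try lra. apply pos_INR.
    - right. rewrite HN. rewrite (qpow_split 400 398 2 eq_refl), (qpow_split 398 197 201 eq_refl), qpow_2.
      field. lra. }
  assert (HaU : INR a * INR u <= 2 * N / q + INR a).
  { apply Rmult_le_reg_r with q; [lra|].
    replace ((2 * N / q + INR a) * q) with (2 * N + INR a * q) by (field; lra).
    apply Rle_trans with (INR c * INR u - (INR c - INR a * q) * INR u); [right; ring|].
    assert (1 <= INR u) by (unfold u; rewrite S_INR; pose proof (pos_INR (floor_nat (2 * N / INR c))); lra).
    nra. }
  (* From [c d = n - a b >= n - a (u + c)], the condition [d - a T >= xi K cut] holds as soon as [T]
     is at most this quotient. *)
  set (arg := (N - INR c * Y - INR a * (INR u + INR c)) / ac).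
  assert (Harg : R0 * (1 - 1 / (q * q) - 2 / q) - 2 <= arg).
  { unfold arg. apply Rmult_le_reg_r with ac; [lra|].
    replace ((N - INR c * Y - INR a * (INR u + INR c)) / ac * ac)
      with (N - INR c * Y - INR a * INR u - ac) by (unfold ac; field; unfold ac in Hac; nra).
    replace ((R0 * (1 - 1 / (q * q) - 2 / q) - 2) * ac)
      with (N - N / (q * q) - 2 * N / q - 2 * ac) by (rewrite ER; field; lra).
    assert (INR a <= ac) by (unfold ac; nra). lra. }
  assert (HR0 : 0 <= R0) by (pose proof (qpow_pos 6); lra).
  assert (Harg0 : 0 <= arg).
  { eapply Rle_trans; [|exact Harg].
    assert (/ q <= / 1000000) by (apply Rinv_le_contravar; lra).
    assert (0 < / q) by (apply Rinv_0_lt_compat; lra).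
    replace (1 / (q * q)) with (/ q * / q) by (field; lra).
    unfold Rdiv.     pose proof (qpow_le 1 6 ltac:(lia)) as H16. rewrite qpow_1 in H16.
    assert (/ 2 <= 1 - / q * / q - 2 * / q) by nra. nra. }
  set (T := floor_nat arg).
  destruct (floor_nat_spec arg Harg0) as [HT1 HT2]. fold T in HT1, HT2.
  assert (Hnat : (a * c * T + c * xi K cut + a * (u + c) <= n)%nat).
  { apply INR_le. rewrite !plus_INR, !mult_INR, plus_INR. fold Y. fold N. fold ac.
    assert (ac * INR T <= ac * arg) by (apply Rmult_le_compat_l; lra).
    assert (ac * arg = N - INR c * Y - INR a * (INR u + INR c)) by (unfold arg; field; lra).
    lra. }
  assert (Hunat : (2 * n < c * u)%nat).
  { apply INR_lt. rewrite !mult_INR. simpl (INR 2). fold N. lra. }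
  destruct (linear_solution n a c u Ha0 Hc0 Hg ltac:(lia)) as (b & d & Hb & E).
  assert (Hd : (a * T + xi K cut <= d)%nat).
  { assert (c * (a * T + xi K cut) <= c * d)%nat; [|nia].
    assert (a * b <= a * (u + c))%nat by nia. nia. }
  exists T, b, d. split.
  - intros t Ht.
    assert (Hat : (a * t <= a * T)%nat) by nia.
    assert (Eq : (a * (b + c * t) + c * (d - a * t) = n)%nat).
    { assert (c * (a * t) <= c * d)%nat by (apply Nat.mul_le_mono_l; lia).
      rewrite Nat.mul_sub_distr_l. nia. }
    split; [exact Eq|]. split; [|split; [lia|]].
    + apply Nat.le_trans with u; [|nia]. apply INR_le. eapply Rle_trans; [exact HGH|].
      apply Rmult_le_reg_l with (INR c); [lra|]. left. eapply Rle_lt_trans; [|exact Hu1'].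
      rewrite HN. apply Rle_trans with (qpow 197 * qpow 200).
      * apply Rmult_le_compat_r; [left; apply qpow_pos|exact Hcq].
      * rewrite <- qpow_add. pose proof (qpow_le (197 + 200) 400 ltac:(lia)).
        pose proof (qpow_pos 400). lra.
    + assert (c * (2 * (d - a * t)) < c * u)%nat by nia.
      assert (2 * (d - a * t) < u)%nat by nia. nia.
  - eapply Rle_trans; [|apply (small_gcd_solutions n a c b d T gcd_cap n_pos HG0 Hg E ltac:(lia))].
    fold ac. fold N. fold R0. apply count_arith.
    + exact HR6.
    + lra.
    + split; [apply pos_INR|]. eapply Rle_trans; [exact HT1|]. unfold arg.
      apply Rmult_le_reg_r with ac; [lra|].
      replace ((N - INR c * Y - INR a * (INR u + INR c)) / ac * ac)
        with (N - INR c * Y - INR a * (INR u + INR c)) by (field; lra).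
      rewrite <- ER. pose proof (pos_INR u). pose proof (pos_INR (xi K cut)). fold Y in H0. nra.
    + exact HG.
    + split; [apply pos_INR|apply few_divisors; lia].
Qed.

(** A length is about [2 K j s] with [s = sqrt_lg j], so its square is [4 K s] times [K j^2 s <= y];
    the factor [1.01^2] turns 4 into 4.0804. And [s <= sqrt (L / 2)] because [(j + 1)^2 <= n]. *)
Lemma len_sqr_le j y : (cut <= j)%nat -> In y (block K j) -> (y <= n)%nat ->
  INR (len K j) * INR (len K j) <= 40804 / 10000 * K * INR y * sqrt (L / 2) /\ (j < n)%nat.
Proof.
  intros Hj Hy Hn. pose proof cut_bounds as Hm. pose proof (qpow_le 1 100 ltac:(lia)) as Hq1.
  rewrite qpow_1 in Hq1. pose proof q_ge as Hq. apply le_INR in Hj.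
  destruct (reg j ltac:(lra)) as [Rpos Rsl Rsq Rlow Rup Rlen Rlen' Rlen_le Rdbl]. apply in_block in Hy; [|exact K_pos].
  assert (Hxy : INR (xi K j) <= INR y) by (apply le_INR; lia).
  apply le_INR in Hn.
  assert (Hsl : sqrt_lg j <= sqrt (L / 2)).
  { unfold sqrt_lg. apply sqrt_le_1_alt. unfold lg.
    assert (ln ((INR j + 1) * (INR j + 1)) <= L).
    { rewrite L_def. apply ln_le; [apply Rmult_lt_0_compat|]; lra. }
    rewrite ln_mult in H by lra. lra. }
  split.
  - apply Rle_trans with ((1 + 1 / 100) * (2 * K * INR j * sqrt_lg j) * ((1 + 1 / 100) * (2 * K * INR j * sqrt_lg j))).
    { apply Rmult_le_compat; try assumption; apply pos_INR. }
    replace ((1 + 1 / 100) * (2 * K * INR j * sqrt_lg j) * ((1 + 1 / 100) * (2 * K * INR j * sqrt_lg j)))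
      with (40804 / 10000 * K * ((K * (INR j * INR j) * sqrt_lg j) * sqrt_lg j)) by field.
    rewrite (Rmult_assoc (40804 / 10000 * K)). apply Rmult_le_compat_l; [lra|].
    apply Rmult_le_compat; try lra. repeat apply Rmult_le_pos; lra.
  - apply INR_lt. assert (INR j * 1 <= INR j * INR j) by (apply Rmult_le_compat_l; lra). lra.
Qed.

(** The squares are compared: 2.0813 bounds [4.0804^2 / 8], and 0.255025 is [(101 / 200)^2]. With
    [K^2 <= 1/32] and no losses the constant would be [32 sqrt 2], about 45.2; 42 leaves room for
    the factors 1.01 and 0.99. *)
Lemma weight_arith (X Y N a c P : R) :
  0 <= X -> 0 <= Y -> 0 < N -> 1 <= a -> 1 <= c -> 0 <= P ->
  X * X * (Y * Y) * (a * c) <= (20813/10000) * (K * K) * L * (N * N) ->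
  a * c <= (255025/1000000) * (K * K) * L * (P * P) ->
  X * Y * (42 * (a * c)) <= N * (1 - 7 / q) * (L * P).
Proof.
  intros HX HY HN Ha Hc HP H1 H2. pose proof q_ge as Hq. pose proof L_ge as HL.
  assert (Hac : 1 <= a * c) by (apply Rle_trans with (1 * 1); [lra|apply Rmult_le_compat; lra]).
  assert (HLP : 0 <= L * P) by (apply Rmult_le_pos; lra).
  assert (HXY : 0 <= X * Y) by (apply Rmult_le_pos; lra).
  assert (Hr : (99/100) <= 1 - 7 / q).
  { assert (/ q <= / 1000000) by (apply Rinv_le_contravar; lra). unfold Rdiv. lra. }
  apply Rle_trans with (N * (99/100) * (L * P)).
  2:{ apply Rmult_le_compat_r; [exact HLP|]. apply Rmult_le_compat_l; lra. }
  apply Rsqr_incr_0_var; [|repeat apply Rmult_le_pos; lra].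
  unfold Rsqr.
  apply Rle_trans with (1764 * (a * c) * (X * X * (Y * Y) * (a * c))); [right; ring|].
  apply Rle_trans with (1764 * ((255025/1000000) * (K * K) * L * (P * P)) * ((20813/10000) * (K * K) * L * (N * N))).
  { apply Rmult_le_compat; [lra| |lra|exact H1].
    replace (X * X * (Y * Y) * (a * c)) with ((X * Y) * (X * Y) * (a * c)) by ring.
    apply Rmult_le_pos; [apply Rmult_le_pos|]; lra. }
  replace (1764 * ((255025/1000000) * (K * K) * L * (P * P)) * ((20813/10000) * (K * K) * L * (N * N)))
    with (1764 * (255025/1000000) * (20813/10000) * ((K * K) * (K * K)) * ((N * (L * P)) * (N * (L * P)))) by ring.
  replace (N * (99/100) * (L * P) * (N * (99/100) * (L * P)))
    with ((9801/10000) * ((N * (L * P)) * (N * (L * P)))) by field.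
  apply Rmult_le_compat_r.
  { assert (0 <= N * (L * P)) by (apply Rmult_le_pos; lra). apply Rmult_le_pos; lra. }
  assert (0 <= K * K) by (apply Rmult_le_pos; lra).
  assert ((K * K) * (K * K) <= / 32 * / 32) by (apply Rmult_le_compat; lra).
  lra.
Qed.

Lemma edge_weight_ge i k i' j' x y :
  paired i k -> (cut <= i')%nat -> (cut <= j')%nat -> In x (block K i') -> In y (block K j') ->
  (al i * y + al k * x = n)%nat ->
  INR (len K i') * INR (len K j') * (42 * (INR (al i) * INR (al k))) <=
  INR n * (1 - 7 / q) * (L * ((INR i + 1) * (INR k + 1))).
Proof.
  intros HP Hi' Hj' Hx Hy E. destruct (paired_facts i k HP) as (Ha1 & Haq & Hcq & Ha & Hc).
  pose proof q_ge as Hq. pose proof L_ge as HL.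
  assert (Hc1 : 1 <= INR (al k)).
  { assert (1 * q <= INR (al i) * q) by (apply Rmult_le_compat_r; lra). lra. }
  set (a := al i) in *. set (c := al k) in *.
  assert (Ha0 : (0 < a)%nat) by (apply INR_lt; simpl; lra).
  assert (Hc0 : (0 < c)%nat) by (apply INR_lt; simpl; lra).
  destruct (len_sqr_le i' x Hi' Hx ltac:(nia)) as [Hlx _].
  destruct (len_sqr_le j' y Hj' Hy ltac:(nia)) as [Hly _].
  assert (ER : INR a * INR y + INR c * INR x = INR n) by (rewrite <- E, plus_INR, !mult_INR; ring).
  set (X := INR x) in *. set (Y := INR y) in *. set (N := INR n) in *.
  assert (HX : 0 <= X) by apply pos_INR. assert (HY : 0 <= Y) by apply pos_INR.
  assert (Hss : sqrt (L / 2) * sqrt (L / 2) = L / 2) by (apply sqrt_sqrt; lra).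
  pose proof (pos_INR i) as Hi0. pose proof (pos_INR k) as Hk0.
  apply weight_arith; try assumption; try apply pos_INR.
  - unfold N. apply lt_0_INR, n_pos.
  - apply Rmult_le_pos; lra.
  - apply Rle_trans with ((40804 / 10000 * K * X * sqrt (L / 2)) * (40804 / 10000 * K * Y * sqrt (L / 2)) * (INR a * INR c)).
    { apply Rmult_le_compat_r; [apply Rmult_le_pos; lra|].
      apply Rmult_le_compat; try assumption; apply Rmult_le_pos; apply pos_INR. }
    replace ((40804 / 10000 * K * X * sqrt (L / 2)) * (40804 / 10000 * K * Y * sqrt (L / 2)) * (INR a * INR c))
      with ((40804/10000) * (40804/10000) * (K * K) * (sqrt (L / 2) * sqrt (L / 2)) * ((INR a * Y) * (INR c * X))) by ring.
    rewrite Hss.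
    (* The two factors sum to [n]. Bounding their product by [n^2 / 4] gives all solutions on the
       line the same weight, whatever their position. *)
    assert (HAM : (INR a * Y) * (INR c * X) <= N * N / 4).
    { rewrite <- ER. pose proof (Rle_0_sqr (INR a * Y - INR c * X)) as Hs. unfold Rsqr in Hs. lra. }
    apply Rle_trans with ((40804/10000) * (40804/10000) * (K * K) * (L / 2) * (N * N / 4)).
    + apply Rmult_le_compat_l; [|exact HAM]. repeat apply Rmult_le_pos; lra.
    + assert (0 <= (K * K) * L * (N * N)).
      { pose proof (pos_INR n) as Hn0. fold N in Hn0. repeat apply Rmult_le_pos; lra. }
      lra.
  - assert (HsL : sqrt L * sqrt L = L) by (apply sqrt_sqrt; lra).
    pose proof (sqrt_pos L) as HsL0.
    apply Rle_trans with ((101 / 200 * K * sqrt L * ((INR i + 1) * (INR i + 1))) *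
      (101 / 200 * K * sqrt L * ((INR k + 1) * (INR k + 1)))).
    { apply Rmult_le_compat; lra. }
    right. transitivity (101 / 200 * (101 / 200) * (K * K) * (sqrt L * sqrt L) *
      ((INR i + 1) * (INR k + 1) * ((INR i + 1) * (INR k + 1)))); [ring|].
    rewrite HsL. field.
Qed.

(* The bound on [gcd y x] makes the pair [(i, k)] a function of [(x, y)], so that the edges
   are counted without multiplicity. *)
Definition edge (i k i' j' x y : nat) : Prop :=
  (cut <= i' /\ j' < n)%nat /\ paired i k /\ Nat.gcd (al i) (al k) = 1%nat /\
  (al i * y + al k * x = n)%nat /\ (Nat.gcd y x <= gcd_cap)%nat /\
  (gcd_cap * coef_cap <= y)%nat /\ (0 < x)%nat.

(** Each solution with a small gcd is hit with probability the inverse of the product of two block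
    lengths, at least [1 / W] by [edge_weight_ge]. The solutions are counted by their member [y]. *)
Lemma edge_density_ge i k kk : paired i k -> Nat.gcd (al i) (al k) = 1%nat -> (n <= cut + kk)%nat ->
  42 / (L * ((INR i + 1) * (INR k + 1))) <=
  Rsum (seq cut kk) (fun j' => avg (block K j') (fun y =>
    Rsum (seq cut (j' - cut)) (fun i' => avg (block K i') (fun x => indic (edge i k i' j' x y))))).
Proof.
  intros HP Hg Hkk. destruct (solution_count_ge i k HP Hg) as (T & b & d & Hsol & Hcount).
  destruct (paired_facts i k HP) as (Ha1 & Haq & _).
  pose proof q_ge as Hq. pose proof L_ge as HL.
  assert (Hc1 : 1 <= INR (al k)).
  { assert (1 * q <= INR (al i) * q) by (apply Rmult_le_compat_r; lra). lra. }
  set (ac := INR (al i) * INR (al k)) in *.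
  assert (Hac : 1 <= ac) by (apply Rle_trans with (1 * 1); [lra|apply Rmult_le_compat; lra]).
  set (P := (INR i + 1) * (INR k + 1)) in *.
  assert (HPp : 0 < P) by (pose proof (pos_INR i); pose proof (pos_INR k); apply Rmult_lt_0_compat; lra).
  assert (HNp : 0 < INR n) by apply lt_0_INR, n_pos.
  assert (Hr : 0 < 1 - 7 / q).
  { assert (/ q <= / 1000000) by (apply Rinv_le_contravar; lra). unfold Rdiv. lra. }
  set (W := INR n * (1 - 7 / q) * (L * P) / (42 * ac)).
  assert (HW : 0 < W).
  { unfold W. apply Rdiv_lt_0_compat; [|lra].
    apply Rmult_lt_0_compat; [apply Rmult_lt_0_compat; lra|].
    apply Rmult_lt_0_compat; [lra|exact HPp]. }
  set (good := fun t => (Nat.gcd (b + al k * t) (d - al i * t) <= gcd_cap)%nat).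
  set (hit := fun y => exists t, (t < T)%nat /\ good t /\ y = (b + al k * t)%nat).
  assert (Hxi1 : (1 <= xi K cut)%nat) by (pose proof (xi_ge K cut); unfold cut in *; lia).
  assert (Ha0 : (0 < al i)%nat) by (apply INR_lt; simpl; lra).
  assert (Hc0 : (0 < al k)%nat) by (apply INR_lt; simpl; lra).
  apply Rle_trans with (/ W * Rsum (seq (xi K cut) (xi K (cut + kk) - xi K cut)) (fun y => indic (hit y))).
  - apply Rle_trans with (/ W * (INR n / ac * (1 - 7 / q))).
    + right. unfold W. field. repeat split; lra.
    + apply Rmult_le_compat_l; [left; apply Rinv_0_lt_compat, HW|].
      eapply Rle_trans; [exact Hcount|].
      apply (Rsum_indic_image T _ good (fun t => (b + al k * t)%nat)).
      * intros s t Hst E. nia.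
      * intros t Ht _. destruct (Hsol t Ht) as (E & _ & Hx & H2x).
        apply in_seq. pose proof (xi_ge K (cut + kk)). pose proof (xi_le K K_pos cut (cut + kk) ltac:(lia)).
        assert (b + al k * t <= n)%nat by nia.
        assert (al k * (d - al i * t) <> 0)%nat by nia.
        assert (b + al k * t < n)%nat by nia. lia.
  - rewrite <- (block_union K K_pos), Rsum_flat_map, <- Rsum_scal. apply Rsum_le. intros j' Hj'.
    apply in_seq in Hj'. unfold avg at 1.
    assert (Hlen : 0 < INR (length (block K j'))) by (apply length_pos, block_nonempty, K_pos).
    rewrite <- Rsum_scal.
    unfold Rdiv. rewrite Rmult_comm, <- Rsum_scal. apply Rsum_le. intros y Hy.
    set (inner := Rsum (seq cut (j' - cut)) (fun i' => avg (block K i') (fun x => indic (edge i k i' j' x y)))).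
    assert (Hterm : forall i', 0 <= avg (block K i') (fun x => indic (edge i k i' j' x y))).
    { intros i'. apply avg_nonneg; [apply block_nonempty, K_pos|]. intros; apply indic_range. }
    destruct (excluded_middle_informative (hit y)) as [Hh|Hh].
    2:{ rewrite indic_false by exact Hh. rewrite Rmult_0_r. apply Rmult_le_pos.
        - left; apply Rinv_0_lt_compat, Hlen.
        - apply Rsum_nonneg. intros; apply Hterm. }
    rewrite indic_true by exact Hh. rewrite Rmult_1_r.
    destruct Hh as (t & Ht & Hgood & Ey). destruct (Hsol t Ht) as (E & Hcap & Hx & H2x).
    rewrite <- Ey in E, Hcap, H2x. set (x := (d - al i * t)%nat) in *.
    destruct (block_of K K_pos cut x Hx) as (i' & Hi' & Hxi').
    assert (Hyn : (y <= n)%nat) by nia.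
    destruct (len_sqr_le j' y ltac:(lia) Hy Hyn) as [_ Hjn].
    (* Otherwise [x >= xi j'] while [y < xi (S j') <= 2 xi j'], against [2 x <= y]. *)
    assert (Hij : (i' < j')%nat).
    { destruct (le_lt_dec j' i') as [Hle|]; [exfalso|assumption].
      pose proof cut_bounds as Hm. pose proof (qpow_le 1 100 ltac:(lia)) as Hq1. rewrite qpow_1 in Hq1.
      assert (Hmj : INR cut <= INR j') by (apply le_INR; lia).
      destruct (reg j' ltac:(lra)) as [Rpos Rsl Rsq Rlow Rup Rlen Rlen' Rlen_le Rdbl]. clear - Rdbl Hle Hxi' Hy H2x K_pos.
      apply in_block in Hxi'; [|exact K_pos]. apply in_block in Hy; [|exact K_pos].
      pose proof (xi_le K K_pos j' i' Hle).
      assert (xi K (S j') <= 2 * xi K j')%nat; [|lia].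
      apply INR_le. rewrite mult_INR. exact Rdbl. }
    assert (Hinner : / INR (length (block K i')) <= inner).
    { apply Rle_trans with (avg (block K i') (fun x => indic (edge i k i' j' x y))).
      - unfold avg, Rdiv. rewrite <- (Rmult_1_l (/ _)) at 1. apply Rmult_le_compat_r.
        + left. apply Rinv_0_lt_compat, length_pos, block_nonempty, K_pos.
        + rewrite <- (indic_true (edge i k i' j' x y)).
          * apply (Rsum_term _ (fun x => indic (edge i k i' j' x y))); [exact Hxi'|].
            intros; apply indic_range.
          * unfold edge. split; [split; assumption|]. split; [exact HP|]. split; [exact Hg|].
            split; [exact E|]. split; [rewrite Ey; exact Hgood|]. split; [exact Hcap|]. lia.
      - apply (Rsum_term _ (fun i' => avg (block K i') (fun x => indic (edge i k i' j' x y)))).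
        + apply in_seq. lia.
        + intros; apply Hterm. }
    apply Rle_trans with (/ INR (length (block K j')) * / INR (length (block K i'))).
    2:{ apply Rmult_le_compat_l; [left; apply Rinv_0_lt_compat, Hlen|exact Hinner]. }
    assert (Hlen' : 0 < INR (length (block K i'))) by (apply length_pos, block_nonempty, K_pos).
    rewrite <- Rinv_mult. apply Rinv_le_contravar; [apply Rmult_lt_0_compat; assumption|].
    rewrite !length_block in *. unfold W.
    apply Rmult_le_reg_r with (42 * ac); [lra|].
    replace (INR n * (1 - 7 / q) * (L * P) / (42 * ac) * (42 * ac))
      with (INR n * (1 - 7 / q) * (L * P)) by (field; lra).
    rewrite (Rmult_comm (INR (len K j'))).
    apply (edge_weight_ge i k i' j' x y HP Hi' ltac:(lia) Hxi' Hy E).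
Qed.

(** * The graph of all edges and its degrees *)

Definition edge_sum (i' j' x y : nat) : R :=
  Rsum (seq 0 cut) (fun k => Rsum (seq 0 k) (fun i => indic (edge i k i' j' x y))).

Lemma al_inj_below_cut i j : (i < cut)%nat -> (j < cut)%nat -> al i = al j -> i = j.
Proof.
  intros Hi Hj E. apply (block_disjoint K K_pos i j (al i)); [apply al_valid, Hi|].
  rewrite E. apply al_valid, Hj.
Qed.

Lemma al_coef_cap i k : paired i k -> (al k < coef_cap)%nat.
Proof.
  intros HP. destruct (paired_facts i k HP) as (_ & _ & H & _).
  destruct caps_bounds as (_ & _ & H' & _). apply INR_lt. lra.
Qed.

Lemma edge_unique i k i2 k2 i' j' x y : edge i k i' j' x y -> edge i2 k2 i' j' x y ->
  i = i2 /\ k = k2.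
Proof.
  intros (_ & HP & _ & E & Hg & Hc & Hx) (_ & HP2 & _ & E2 & _ & _ & _).
  pose proof (al_coef_cap i k HP) as H1. pose proof (al_coef_cap i2 k2 HP2) as H2.
  pose proof (paired_lt i k HP). pose proof (paired_lt i2 k2 HP2).
  destruct caps_bounds as (HG & _).
  destruct (solution_unique n (al i) (al k) (al i2) (al k2) y x gcd_cap coef_cap) as [Ea Ec];
    try assumption; [nia|].
  split; apply al_inj_below_cut; lia || assumption.
Qed.

(** By [edge_unique] at most one pair [(i, k)] produces a given edge, so the sum over pairs is an
    indicator, as the range condition on [psi] demands. *)
Lemma edge_sum_range i' j' x y : 0 <= edge_sum i' j' x y <= 1.
Proof.
  split.
  - apply Rsum_nonneg. intros; apply Rsum_nonneg. intros; apply indic_range.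
  - unfold edge_sum.
    apply Rle_trans with (Rsum (seq 0 cut) (fun k => indic (exists i, In i (seq 0 k) /\ edge i k i' j' x y))).
    + apply Rsum_le. intros k _. apply Rsum_indic_unique; [apply seq_NoDup|].
      intros i i2 _ _ H1 H2. apply (edge_unique _ _ _ _ _ _ _ _ H1 H2).
    + eapply Rle_trans; [apply Rsum_indic_unique; [apply seq_NoDup|]|apply indic_range].
      intros k k2 _ _ (i & _ & H1) (i2 & _ & H2). apply (edge_unique _ _ _ _ _ _ _ _ H1 H2).
Qed.

(** A relaxation of [edge] that either end can satisfy in the role of [z], so that a single count
    bounds backward and forward degrees. *)
Definition loose (z p r w : nat) : Prop :=
  INR p + 1 <= qpow 98 /\ (0 < al r)%nat /\ (al p * z + al r * w = n)%nat /\ (0 < w)%nat.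

Lemma Rsum_indic_below m Q : 0 <= Q -> Rsum (seq 0 m) (fun p => indic (INR p + 1 <= Q)) <= Q.
Proof.
  intros HQ. induction m as [|m IH]; [exact HQ|].
  destruct (Rle_lt_dec (INR m + 1) Q) as [H|H].
  - apply Rle_trans with (Rsum (seq 0 (S m)) (fun _ => 1)).
    + apply Rsum_le. intros; apply indic_range.
    + rewrite Rsum_const, length_seq, S_INR. lra.
  - rewrite seq_S, Rsum_app. simpl. rewrite (indic_false (INR m + 1 <= Q)) by lra. lra.
Qed.

(** There are at most [q^98] indices [p]; then [al r] is one of at most [q] divisors of
    [n - al p * z], distinct for distinct [r], and it determines [w]. *)
Lemma loose_sum z l : NoDup l ->
  Rsum l (fun w => Rsum (seq 0 cut) (fun p => Rsum (seq 0 cut) (fun r => indic (loose z p r w))))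
  <= qpow 98 * q.
Proof.
  intros Hl. pose proof q_ge as Hq. rewrite Rsum_swap.
  apply Rle_trans with (Rsum (seq 0 cut) (fun p => q * indic (INR p + 1 <= qpow 98))).
  2:{ rewrite Rsum_scal, Rmult_comm. apply Rmult_le_compat_r; [lra|].
      apply Rsum_indic_below. left; apply qpow_pos. }
  apply Rsum_le. intros p _. rewrite Rsum_swap.
  destruct (Rle_lt_dec (INR p + 1) (qpow 98)) as [Hp|Hp].
  2:{ rewrite Rsum_eq0; [pose proof (indic_range (INR p + 1 <= qpow 98)); apply Rmult_le_pos; lra|].
      intros r _. apply Rsum_eq0. intros w _. apply indic_false. intros (H & _). lra. }
  rewrite indic_true by exact Hp. rewrite Rmult_1_r.
  set (N := (n - al p * z)%nat).
  set (Q := fun r => (0 < N)%nat /\ (0 < al r)%nat /\ Nat.divide (al r) N).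
  apply Rle_trans with (Rsum (seq 0 cut) (fun r => indic (Q r))).
  { apply Rsum_le. intros r _.
    eapply Rle_trans; [apply (Rsum_indic_unique l (fun w => loose z p r w)); [exact Hl|]|].
    - intros w w' _ _ (_ & H1 & H2 & _) (_ & _ & H3 & _). nia.
    - apply indic_le. intros (w & _ & _ & H1 & H2 & H3). unfold Q, N.
      split; [nia|]. split; [exact H1|]. exists w. nia. }
  destruct (Nat.eq_dec N 0) as [E|E].
  - rewrite Rsum_eq0; [lra|]. intros r _. apply indic_false. unfold Q. lia.
  - eapply Rle_trans; [apply (Rsum_indic_image cut (divisors N) Q al)|].
    + intros s t Hst Est. apply al_inj_below_cut in Est; lia.
    + intros t _ (H1 & H2 & H3). apply in_divisors; [lia|exact H3].
    + apply Rle_trans with (Rsum (divisors N) (fun _ => 1)).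
      * apply Rsum_le. intros; apply indic_range.
      * rewrite Rsum_const, Rmult_1_r. apply few_divisors. unfold N in *. lia.
Qed.

Lemma edge_loose i k i' j' x y : edge i k i' j' x y -> loose y i k x /\ loose x k i y.
Proof.
  intros ((Hm & _) & HP & _ & E & _ & Hc & Hx). pose proof (paired_lt i k HP) as Hlt.
  pose proof q_ge as Hq. destruct HP as (H1 & H2 & H3).
  assert (INR i < INR k) by (apply lt_INR; lia).
  pose proof (al_pos i H1 ltac:(lia)). pose proof (al_pos k ltac:(lra) ltac:(lia)).
  destruct caps_bounds as (HG & _).
  assert (0 < coef_cap)%nat by (unfold coef_cap; lia).
  unfold loose. repeat split; try lra; try lia; nia.
Qed.

Lemma len_ge_qpow j : (cut <= j)%nat -> qpow 100 <= INR (length (block K j)).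
Proof.
  intros Hj. apply le_INR in Hj. pose proof cut_bounds as Hm.
  pose proof (qpow_le 1 100 ltac:(lia)) as Hq1. rewrite qpow_1 in Hq1.
  destruct (reg j ltac:(lra)) as [Rpos Rsl Rsq Rlow Rup Rlen Rlen' Rlen_le Rdbl]. rewrite length_block. lra.
Qed.

Lemma loose_ratio : qpow 98 * q / qpow 100 = / q.
Proof.
  pose proof (qpow_pos 98). pose proof q_ge.
  rewrite (qpow_split 100 98 2 eq_refl), qpow_2. field. lra.
Qed.

(* The blocks beyond [cut] have length at least [q ^ 100], while [loose_sum] bounds by
   [q ^ 99] the number of neighbours of a vertex. *)
Lemma sparse_avg m k (F : nat -> nat -> R) (G : nat -> R) :
  (forall j w, In w (block K j) -> (cut <= j)%nat -> 0 <= F j w <= G w) ->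
  (forall j w, In w (block K j) -> (m <= j < cut)%nat -> F j w = 0) ->
  (forall w, 0 <= G w) ->
  (forall l, NoDup l -> Rsum l G <= qpow 98 * q) ->
  Rsum (seq m k) (fun j => avg (block K j) (F j)) <= / q.
Proof.
  intros HF HF0 HG Hsum. rewrite <- loose_ratio.
  apply Rle_trans with (/ qpow 100 * Rsum (seq (xi K m) (xi K (m + k) - xi K m)) G).
  2:{ unfold Rdiv. rewrite Rmult_comm. apply Rmult_le_compat_r.
      - left; apply Rinv_0_lt_compat, qpow_pos.
      - apply Hsum, seq_NoDup. }
  rewrite <- (block_union K K_pos), Rsum_flat_map, <- Rsum_scal. apply Rsum_le. intros j Hjm.
  apply in_seq in Hjm.
  destruct (le_lt_dec cut j) as [Hj|Hj].
  - unfold avg, Rdiv. rewrite Rmult_comm. apply Rmult_le_compat.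
    + left. apply Rinv_0_lt_compat, length_pos, block_nonempty, K_pos.
    + apply Rsum_nonneg. intros w Hw. apply HF; assumption.
    + apply Rinv_le_contravar; [apply qpow_pos|apply len_ge_qpow, Hj].
    + apply Rsum_le. intros w Hw. apply HF; assumption.
  - unfold avg. rewrite Rsum_eq0 by (intros; apply HF0; [assumption|lia]).
    unfold Rdiv. rewrite Rmult_0_l. apply Rmult_le_pos.
    + left; apply Rinv_0_lt_compat, qpow_pos.
    + apply Rsum_nonneg. intros; apply HG.
Qed.

Lemma Rsum_triangle_le m (F : nat -> nat -> R) (G : nat -> nat -> R) :
  (forall i k, F i k <= G i k) -> (forall i k, 0 <= G i k) ->
  Rsum (seq 0 m) (fun k => Rsum (seq 0 k) (fun i => F i k)) <=
  Rsum (seq 0 m) (fun k => Rsum (seq 0 m) (fun i => G i k)).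
Proof.
  intros H HG. apply Rsum_le. intros k Hk. apply in_seq in Hk.
  apply Rle_trans with (Rsum (seq 0 k) (fun i => G i k)); [apply Rsum_le; intros; apply H|].
  apply Rsum_incl; [apply seq_NoDup| |intros; apply HG].
  intros i Hi. apply in_seq in Hi. apply in_seq. lia.
Qed.

Lemma edge_sum_early i' j' x y : (i' < cut)%nat -> edge_sum i' j' x y = 0.
Proof.
  intros H. apply Rsum_eq0. intros k _. apply Rsum_eq0. intros i _. apply indic_false.
  intros ((H' & _) & _). lia.
Qed.

Lemma edge_sum_back m' j y : back_degree (block K) edge_sum m' j y <= / q.
Proof.
  apply (sparse_avg m' (j - m') (fun i' x => edge_sum i' j x y)
    (fun x => Rsum (seq 0 cut) (fun p => Rsum (seq 0 cut) (fun r => indic (loose y p r x))))).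
  - intros i' x _ _. split; [apply edge_sum_range|].
    rewrite Rsum_swap. apply (Rsum_triangle_le cut (fun i k => indic (edge i k i' j x y))
      (fun i k => indic (loose y i k x))); [|intros; apply indic_range].
    intros i k. apply indic_le. intros H. apply (edge_loose _ _ _ _ _ _ H).
  - intros i' x _ H. apply edge_sum_early; lia.
  - intros x. apply Rsum_nonneg. intros; apply Rsum_nonneg. intros; apply indic_range.
  - intros l Hl. apply loose_sum, Hl.
Qed.

Lemma edge_sum_fwd k' m' x : fwd_degree (block K) edge_sum k' m' x <= / q.
Proof.
  destruct (le_lt_dec cut m') as [Hm|Hm].
  - apply (sparse_avg (S m') k' (fun j y => edge_sum m' j x y)
      (fun y => Rsum (seq 0 cut) (fun p => Rsum (seq 0 cut) (fun r => indic (loose x p r y))))).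
    + intros j y _ _. split; [apply edge_sum_range|].
      apply (Rsum_triangle_le cut (fun i k => indic (edge i k m' j x y))
        (fun i k => indic (loose x k i y))); [|intros; apply indic_range].
      intros i k. apply indic_le. intros H. apply (edge_loose _ _ _ _ _ _ H).
    + intros; lia.
    + intros y. apply Rsum_nonneg. intros; apply Rsum_nonneg. intros; apply indic_range.
    + intros l Hl. apply loose_sum, Hl.
  - unfold fwd_degree. rewrite Rsum_eq0.
    + pose proof q_ge. left. apply Rinv_0_lt_compat. lra.
    + intros j _. unfold avg. rewrite Rsum_eq0; [unfold Rdiv; ring|].
      intros y _. apply edge_sum_early, Hm.
Qed.

Lemma Rsum_avg_exchange {T} (l1 : list nat) (B : nat -> list nat) (l2 : list T) G :
  Rsum l1 (fun j => avg (B j) (fun y => Rsum l2 (fun t => G t j y))) =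
  Rsum l2 (fun t => Rsum l1 (fun j => avg (B j) (fun y => G t j y))).
Proof. rewrite <- Rsum_swap. apply Rsum_ext. intros j _. apply avg_Rsum. Qed.

Lemma total_edge_sum kk : (n <= cut + kk)%nat ->
  Rsum (seq 0 cut) (fun k => Rsum (seq 0 k) (fun i =>
    42 / (L * ((INR i + 1) * (INR k + 1))) * indic (paired i k /\ Nat.gcd (al i) (al k) = 1%nat)))
  <= total (block K) edge_sum kk cut.
Proof.
  intros Hkk. rewrite (total_back (block K) (block_nonempty K K_pos)).
  unfold back_degree, edge_sum.
  rewrite (Rsum_ext (seq cut kk) _ (fun j => avg (block K j) (fun y => Rsum (seq 0 cut) (fun k =>
    Rsum (seq 0 k) (fun i => Rsum (seq cut (j - cut)) (fun i' => avg (block K i') (fun x =>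
      indic (edge i k i' j x y)))))))).
  2:{ intros j _. apply avg_ext. intros y _. rewrite Rsum_avg_exchange. apply Rsum_ext.
      intros k _. apply Rsum_avg_exchange. }
  rewrite Rsum_avg_exchange. apply Rsum_le. intros k _.
  rewrite Rsum_avg_exchange. apply Rsum_le. intros i _.
  destruct (excluded_middle_informative (paired i k /\ Nat.gcd (al i) (al k) = 1%nat)) as [H|H].
  - rewrite indic_true by exact H. rewrite Rmult_1_r. apply edge_density_ge; tauto.
  - rewrite indic_false by exact H. rewrite Rmult_0_r. apply Rsum_nonneg. intros j _.
    apply avg_nonneg; [apply block_nonempty, K_pos|]. intros y _.
    apply Rsum_nonneg. intros i' _.
    apply avg_nonneg; [apply block_nonempty, K_pos|]. intros; apply indic_range.
Qed.

(** The Janson inequality with degrees at most [1 / q]; passing from 42 to 41 pays for the factor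
    [1 - 3 / q]. *)
Lemma missed_given_prefix kk : (n <= cut + kk)%nat ->
  expect (block K) kk cut (fun be => indic (~ represented n be)) al <=
  exp (- Rsum (seq 0 cut) (fun k => Rsum (seq 0 k) (fun i =>
    41 / (L * ((INR i + 1) * (INR k + 1))) * indic (paired i k /\ Nat.gcd (al i) (al k) = 1%nat)))).
Proof.
  intros Hkk. pose proof q_ge as Hq. pose proof L_ge as HL.
  assert (Hqi : 0 < / q <= / 1000000).
  { split; [apply Rinv_0_lt_compat; lra|apply Rinv_le_contravar; lra]. }
  eapply Rle_trans; [apply (expect_exp_pairs (block K) (block_nonempty K K_pos) edge_sum (/ q))|].
  - lra.
  - intros; apply edge_sum_range.
  - intros; apply edge_sum_back.
  - intros; apply edge_sum_fwd.
  - intros be [Hbe1 Hbe2].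
    destruct (excluded_middle_informative (represented n be)) as [Hr|Hr].
    + left. rewrite indic_false by tauto. lra.
    (* On an outcome that misses [n] no edge has both ends picked, so every factor [1 - edge_sum]
       equals 1. *)
    + right. exists (fun _ _ => 0). split.
      * rewrite Rsum_eq0 by (intros; apply Rsum_zero). rewrite Ropp_0, exp_0. apply indic_range.
      * intros i' j' Hi' Hj'. rewrite Ropp_0, exp_0.
        assert (E : edge_sum i' j' (be i') (be j') = 0); [|rewrite E; ring].
        apply Rsum_eq0. intros k Hk. apply Rsum_eq0. intros i Hi. apply indic_false.
        intros ((Hm & Hjn) & HP & _ & E & _). apply Hr.
        apply in_seq in Hk. apply in_seq in Hi. pose proof cut_lt_n.
        exists i, j', k, i'. rewrite (Hbe1 i) by lia. rewrite (Hbe1 k) by lia.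
        split; [lia|symmetry; exact E].
  - apply exp_le. pose proof (total_edge_sum kk Hkk) as Ht.
    set (S42 := Rsum _ _) in Ht.
    assert (HS : 0 <= S42).
    { apply Rsum_nonneg. intros k _. apply Rsum_nonneg. intros i _.
      apply Rmult_le_pos; [|apply indic_range]. pose proof (pos_INR i). pose proof (pos_INR k).
      apply Rdiv_le_0_compat; [lra|]. apply Rmult_lt_0_compat; [lra|apply Rmult_lt_0_compat; lra]. }
    assert (E41 : Rsum (seq 0 cut) (fun k => Rsum (seq 0 k) (fun i =>
      41 / (L * ((INR i + 1) * (INR k + 1))) * indic (paired i k /\ Nat.gcd (al i) (al k) = 1%nat)))
      = 41 / 42 * S42).
    { unfold S42. rewrite <- Rsum_scal. apply Rsum_ext. intros k _. rewrite <- Rsum_scal.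
      apply Rsum_ext. intros i _. pose proof (pos_INR i). pose proof (pos_INR k). field. lra. }
    rewrite E41.
    assert (41 / 42 * S42 <= (1 - 3 * / q) * total (block K) edge_sum kk cut).
    { apply Rmult_le_compat; lra. }
    lra.
Qed.

End Prefix.

(** * Averaging over the early picks *)

Definition pair_weight (i k : nat) : R :=
  41 / (L * ((INR i + 1) * (INR k + 1))) * indic (paired i k).

(** Chosen so that the product of [1 - coprime_loss] over pairs is exactly the exponential in
    [missed_given_prefix], which makes that bound a [weight] for a second application of the
    inequality. *)
Definition coprime_loss (i k x y : nat) : R :=
  1 - exp (- (pair_weight i k * indic (Nat.gcd x y = 1%nat))).

Lemma pair_weight_nonneg i k : 0 <= pair_weight i k.
Proof.
  pose proof (pos_INR i). pose proof (pos_INR k). pose proof L_ge.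
  apply Rmult_le_pos; [|apply indic_range].
  apply Rdiv_le_0_compat; [lra|]. apply Rmult_lt_0_compat; [lra|apply Rmult_lt_0_compat; lra].
Qed.

Lemma coprime_loss_range i k x y : 0 <= coprime_loss i k x y <= pair_weight i k /\ coprime_loss i k x y <= 1.
Proof.
  unfold coprime_loss. pose proof (pair_weight_nonneg i k) as Hw.
  pose proof (indic_range (Nat.gcd x y = 1%nat)) as Hi.
  set (v := pair_weight i k * indic (Nat.gcd x y = 1%nat)).
  assert (Hv : 0 <= v) by (apply Rmult_le_pos; lra).
  assert (Hv2 : v <= pair_weight i k * 1) by (apply Rmult_le_compat_l; lra).
  pose proof (exp_ineq1_le (- v)) as H1. pose proof (exp_pos (- v)) as H2.
  assert (H3 : exp (- v) <= exp 0) by (apply exp_le; lra). rewrite exp_0 in H3. lra.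
Qed.

(** Both indices of a pair are at least [q]: one is traded for the factor [1 / q], the other kept,
    so that the sums over either index become harmonic. *)
Lemma pair_weight_le i k :
  pair_weight i k <= 41 / (L * q) * / (INR i + 1) /\ pair_weight i k <= 41 / (L * q) * / (INR k + 1).
Proof.
  pose proof (pos_INR i). pose proof (pos_INR k). pose proof L_ge. pose proof q_ge.
  assert (H3 : 0 < 41 / (L * q)) by (apply Rdiv_lt_0_compat; [lra|apply Rmult_lt_0_compat; lra]).
  assert (Hi : 0 < / (INR i + 1)) by (apply Rinv_0_lt_compat; lra).
  assert (Hk : 0 < / (INR k + 1)) by (apply Rinv_0_lt_compat; lra).
  assert (HL : 0 < 41 / L) by (apply Rdiv_lt_0_compat; lra).
  unfold pair_weight.
  destruct (excluded_middle_informative (paired i k)) as [HP|HP].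
  - rewrite indic_true by exact HP. pose proof (paired_lt i k HP) as Hlt. destruct HP as (H4 & _).
    assert (INR i < INR k) by (apply lt_INR; lia).
    replace (41 / (L * ((INR i + 1) * (INR k + 1))) * 1) with (41 / L * (/ (INR i + 1) * / (INR k + 1)))
      by (field; lra).
    replace (41 / (L * q)) with (41 / L * / q) by (field; lra).
    assert (/ (INR i + 1) <= / q) by (apply Rinv_le_contravar; lra).
    assert (/ (INR k + 1) <= / q) by (apply Rinv_le_contravar; lra).
    rewrite !(Rmult_assoc (41 / L)). split; apply Rmult_le_compat_l; try lra.
    + rewrite Rmult_comm. apply Rmult_le_compat_r; lra.
    + apply Rmult_le_compat_r; lra.
  - rewrite indic_false by exact HP. rewrite Rmult_0_r.
    split; apply Rmult_le_pos; lra.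
Qed.

(** The harmonic sum costs [1 + L], which cancels the [1 / L] of the weights. Hence the degree bound
    [42 / q]. *)
Lemma harmonic_le l : NoDup l -> incl l (seq 0 cut) ->
  Rsum l (fun i => 41 / (L * q) * / (INR i + 1)) <= 42 / q.
Proof.
  intros Hn Hi. pose proof L_ge as HL. pose proof q_ge as Hq.
  assert (H3 : 0 < 41 / (L * q)) by (apply Rdiv_lt_0_compat; [lra|apply Rmult_lt_0_compat; lra]).
  assert (H : Rsum l (fun i => / (INR i + 1)) <= 1 + L).
  { eapply Rle_trans; [apply (Rsum_incl l (seq 0 cut)); [exact Hn|exact Hi|]|].
    - intros x _. left. apply Rinv_0_lt_compat. pose proof (pos_INR x). lra.
    - unfold cut. simpl. rewrite Rplus_0_l, Rinv_1. apply Rplus_le_compat_l.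
      eapply Rle_trans; [apply inv_sum_le_ln; lia|].
      change (1 + floor_nat (qpow 100))%nat with cut. change (INR 1) with 1. rewrite ln_1, Rminus_0_r, L_def.
      apply ln_le; [apply lt_0_INR; unfold cut; lia|]. apply le_INR. pose proof cut_lt_n. lia. }
  rewrite Rsum_scal. apply Rle_trans with (41 / (L * q) * (1 + L)); [apply Rmult_le_compat_l; lra|].
  apply Rmult_le_reg_r with (L * q); [apply Rmult_lt_0_compat; lra|].
  replace (41 / (L * q) * (1 + L) * (L * q)) with (41 * (1 + L)) by (field; lra).
  replace (42 / q * (L * q)) with (42 * L) by (field; lra). lra.
Qed.

Lemma coprime_loss_back m' j y : (j < cut)%nat -> back_degree (block K) coprime_loss m' j y <= 42 / q.
Proof.
  intros Hj. eapply Rle_trans; [|apply (harmonic_le (seq m' (j - m')))].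
  - apply Rsum_le. intros i _. rewrite <- (avg_const (block K i) (41 / (L * q) * / (INR i + 1))) by apply block_nonempty, K_pos.
    apply avg_le; [apply block_nonempty, K_pos|]. intros x _.
    pose proof (coprime_loss_range i j x y). pose proof (pair_weight_le i j). lra.
  - apply seq_NoDup.
  - intros i Hi. apply in_seq in Hi. apply in_seq. lia.
Qed.

Lemma coprime_loss_fwd k' m' x : (m' + k' < cut)%nat -> fwd_degree (block K) coprime_loss k' m' x <= 42 / q.
Proof.
  intros Hj. eapply Rle_trans; [|apply (harmonic_le (seq (S m') k'))].
  - apply Rsum_le. intros j _. rewrite <- (avg_const (block K j) (41 / (L * q) * / (INR j + 1))) by apply block_nonempty, K_pos.
    apply avg_le; [apply block_nonempty, K_pos|]. intros y _.
    pose proof (coprime_loss_range m' j x y). pose proof (pair_weight_le m' j). lra.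
  - apply seq_NoDup.
  - intros i Hi. apply in_seq in Hi. apply in_seq. lia.
Qed.

(** The critical error is [X / (l l')]: here [X] is at most [5 i l], while [l' >= k >= i q], so it
    is of order [1 / q]. This is why only the smaller block limits the trial divisors. *)
Lemma coprime_avg i k : paired i k ->
  4999 / 10000 <= avg (block K k) (fun y => avg (block K i) (fun x => indic (Nat.gcd x y = 1%nat))).
Proof.
  intros HP. pose proof (paired_lt i k HP) as Hlt. destruct HP as (H1 & H2 & H3).
  pose proof q_ge as Hq. pose proof L_ge as HL. rewrite avg_swap.
  assert (Hik : INR i < INR k) by (apply lt_INR; lia).
  assert (Hi0 : (0 < i)%nat) by (apply INR_lt; simpl; lra).
  destruct (reg i H1) as [_ Hsl _ _ Hup _ Hlen _ _]. destruct (reg i H1) as [_ _ _ _ _ Hleni _ _ _].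
  destruct (reg k ltac:(lra)) as [_ _ _ _ _ Hlenk _ _ _].
  pose proof (xi_lt_S K K_pos i) as HxS. pose proof (xi_lt_S K K_pos k) as HxSk.
  eapply Rle_trans; [|apply (coprime_fraction (xi K i) (len K i) (xi K k) (len K k) (xi K (S i)))].
  2:{ pose proof (xi_ge K i). lia. }
  2:{ unfold len. lia. }
  2:{ unfold len. lia. }
  2:{ unfold len. lia. }
  set (X := INR (xi K (S i))) in *. set (l := INR (len K i)) in *. set (l' := INR (len K k)) in *.
  assert (Hll : / l <= / q) by (apply Rinv_le_contravar; lra).
  assert (Hll' : / l' <= / q) by (apply Rinv_le_contravar; lra).
  assert (Hl0 : 0 < / l) by (apply Rinv_0_lt_compat; lra).
  assert (Hl0' : 0 < / l') by (apply Rinv_0_lt_compat; lra).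
  assert (HX0 : 0 <= X) by apply pos_INR.
  assert (HX4 : X <= 5 * (INR i * l)).
  { pose proof (sqr_succ_le (INR i) ltac:(lra)) as Hs.
    apply Rle_trans with (5 * (INR i * (K * INR i * sqrt_lg i))).
    - eapply Rle_trans; [exact Hup|].
      assert (0 <= K * sqrt_lg i) by (apply Rmult_le_pos; lra).
      assert (K * sqrt_lg i * ((INR i + 1) * (INR i + 1)) <= K * sqrt_lg i * (4 * (INR i * INR i)))
        by (apply Rmult_le_compat_l; assumption).
      assert (0 <= K * sqrt_lg i * (INR i * INR i)) by (repeat apply Rmult_le_pos; lra). lra.
    - apply Rmult_le_compat_l; [lra|]. apply Rmult_le_compat_l; lra. }
  assert (HlnX : ln (X + 1) <= L).
  { rewrite L_def. apply ln_le; [lra|]. rewrite n_eq_qpow.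
    pose proof (sqrt_lg_small i ltac:(lra)) as Hss. pose proof K_sqrt_L. pose proof (sqrt_pos L).
    assert (HKs : 0 <= K * sqrt L) by (apply Rmult_le_pos; lra).
    assert (HQ : 0 <= qpow 98 * qpow 98) by (pose proof (qpow_pos 98); apply Rmult_le_pos; lra).
    assert (X <= q * (qpow 98 * qpow 98)).
    { eapply Rle_trans; [exact Hup|].
      apply Rle_trans with ((1 + 1 / 100) * K * (qpow 98 * qpow 98) * (sqrt L / 2)).
      - apply Rmult_le_compat; [repeat apply Rmult_le_pos; lra|lra| |exact Hss].
        apply Rmult_le_compat_l; [lra|]. apply Rmult_le_compat; lra.
      - assert (4 * K * sqrt L * (qpow 98 * qpow 98) <= q * (qpow 98 * qpow 98))
          by (apply Rmult_le_compat_r; lra).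
        assert (0 <= K * sqrt L * (qpow 98 * qpow 98)) by (apply Rmult_le_pos; lra). lra. }
    rewrite <- (qpow_split 196 98 98 eq_refl), <- qpow_1, <- (qpow_split 197 1 196 eq_refl) in H4.
    pose proof (qpow_le 1 197 ltac:(lia)) as H197. rewrite qpow_1 in H197.
    pose proof (qpow_le 198 400 ltac:(lia)) as H198.
    rewrite (qpow_split 198 1 197 eq_refl), qpow_1 in H198.
    assert (2 * qpow 197 <= q * qpow 197) by (apply Rmult_le_compat_r; lra). lra. }
  assert (Hqi : / q <= / 1000000) by (apply Rinv_le_contravar; lra).
  assert (E1 : (/ l + / l') * (1 + ln (X + 1)) <= 2 / 1000000).
  { apply Rle_trans with ((2 * / q) * (1 + L)).
    - apply Rmult_le_compat; try lra.
      assert (0 <= ln (X + 1)) by (rewrite <- ln_1; apply ln_le; lra). lra.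
    - apply Rmult_le_reg_r with q; [lra|]. replace (2 * / q * (1 + L) * q) with (2 * (1 + L)) by (field; lra).
      lra. }
  assert (E2 : (X + 1) * (/ l * / l') <= 6 / 1000000).
  { apply Rle_trans with (6 * (INR i * l) * (/ l * / l')).
    - apply Rmult_le_compat_r; [apply Rmult_le_pos; lra|].
      assert (1 * 1 <= INR i * l) by (apply Rmult_le_compat; lra). lra.
    - replace (6 * (INR i * l) * (/ l * / l')) with (6 * (INR i * / l')) by (field; lra).
      assert (INR i * / l' <= / q); [|lra].
      apply Rmult_le_reg_r with (l' * q); [apply Rmult_lt_0_compat; lra|].
      replace (INR i * / l' * (l' * q)) with (INR i * q) by (field; lra).
      replace (/ q * (l' * q)) with l' by (field; lra). lra. }
  lra.
Qed.

(** A pair weight [V] is at most 1/10000, so [1 - exp (- V) >= 0.9999 V]; and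
    [41 * 0.9999 * 0.4999 > 20.4]. *)
Lemma coprime_loss_avg i k :
  (204 / 10) / L * (indic (paired i k) * (/ (INR i + 1) * / (INR k + 1))) <=
  avg (block K k) (fun y => avg (block K i) (fun x => coprime_loss i k x y)).
Proof.
  pose proof q_ge as Hq. pose proof L_ge as HL.
  destruct (excluded_middle_informative (paired i k)) as [HP|HP].
  2:{ rewrite indic_false by exact HP. rewrite Rmult_0_l, Rmult_0_r.
      apply avg_nonneg; [apply block_nonempty, K_pos|]. intros y _.
      apply avg_nonneg; [apply block_nonempty, K_pos|]. intros; apply coprime_loss_range. }
  set (V := pair_weight i k).
  assert (HV : V = 41 / L * (/ (INR i + 1) * / (INR k + 1))).
  { unfold V, pair_weight. rewrite indic_true by exact HP.
    pose proof (pos_INR i). pose proof (pos_INR k). field. lra. }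
  assert (HV0 : 0 <= V) by apply pair_weight_nonneg.
  assert (HVs : V <= / 10000).
  { destruct (pair_weight_le i k) as [Hle _]. fold V in Hle.
    pose proof (pos_INR i) as Hi.
    eapply Rle_trans; [exact Hle|]. apply Rle_trans with (41 / (L * q) * 1).
    - apply Rmult_le_compat_l.
      + left. apply Rdiv_lt_0_compat; [lra|apply Rmult_lt_0_compat; lra].
      + rewrite <- Rinv_1. apply Rinv_le_contravar; lra.
    - rewrite Rmult_1_r. apply Rmult_le_reg_r with (L * q); [apply Rmult_lt_0_compat; lra|].
      replace (41 / (L * q) * (L * q)) with 41 by (field; lra).
      assert (800 * 1000000 <= L * q) by (apply Rmult_le_compat; lra). lra. }
  assert (He : 9999 / 10000 * V <= 1 - exp (- V)).
  { pose proof (exp_neg_quadratic V HV0). assert (V * V <= / 10000 * V) by (apply Rmult_le_compat_r; lra). lra. }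
  rewrite (avg_ext _ _ (fun y => (1 - exp (- V)) * avg (block K i) (fun x => indic (Nat.gcd x y = 1%nat)))).
  2:{ intros y _. rewrite <- avg_scal. apply avg_ext. intros x _. unfold coprime_loss. fold V.
      destruct (excluded_middle_informative (Nat.gcd x y = 1%nat)) as [E|E].
      - rewrite indic_true by exact E. rewrite !Rmult_1_r. reflexivity.
      - rewrite indic_false by exact E. rewrite !Rmult_0_r, Ropp_0, exp_0. ring. }
  rewrite avg_scal, indic_true by exact HP. rewrite Rmult_1_l.
  apply Rle_trans with (9999 / 10000 * V * (4999 / 10000)).
  - rewrite HV. set (Z := / (INR i + 1) * / (INR k + 1)) in *.
    replace (204 / 10 / L * Z) with (204 / 10 / 41 * (41 / L * Z)) by (field; lra).
    rewrite <- HV. lra.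
  - apply Rmult_le_compat; try lra. apply coprime_avg, HP.
Qed.

(** The discrete form of integrating [(M - ln t) / t]. With [x], [y] consecutive logarithms,
    [1 / (i + 1) >= y - x], and [2 (y - x) (M - x)] exceeds [(M - x)^2 - (M - y)^2] by
    [(y - x)^2]. *)
Lemma weighted_log_sum M m k :
  (forall i, (m <= i < m + k)%nat -> ln (INR i + 1) <= M) ->
  ((M - ln (INR m + 1)) * (M - ln (INR m + 1)) -
   (M - ln (INR (m + k) + 1)) * (M - ln (INR (m + k) + 1))) / 2 <=
  Rsum (seq m k) (fun i => / (INR i + 1) * (M - ln (INR i + 1))).
Proof.
  revert m. induction k as [|k IH]; intros m H.
  - rewrite Nat.add_0_r. simpl. lra.
  - simpl Rsum. specialize (IH (S m) ltac:(intros; apply H; lia)).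
    replace (m + S k)%nat with (S m + k)%nat by lia. rewrite S_INR in IH.
    specialize (H m ltac:(lia)). pose proof (pos_INR m) as Hm.
    destruct (ln_succ_sub (INR m + 1) ltac:(lra)) as [H1 H2].
    assert (H3 : 0 < / (INR m + 1 + 1)) by (apply Rinv_0_lt_compat; lra).
    set (x := ln (INR m + 1)) in *. set (y := ln (INR m + 1 + 1)) in *.
    assert ((y - x) * (M - x) <= / (INR m + 1) * (M - x)) by (apply Rmult_le_compat_r; lra).
    pose proof (Rle_0_sqr (y - x)) as Hs. unfold Rsqr in Hs. lra.
Qed.

(** With [w = L / 400], the sum over [k] from [i q] to [q^98] is about [97 w - ln i], and summing
    over [i] from [q] to [q^97] gives [(96 w)^2 / 2 = 4608 w^2]. Rounding the endpoints costs at
    most [96 w <= 48 w^2]. *)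
Lemma paired_sum :
  4560 * (L / 400 * (L / 400)) <=
  Rsum (seq 0 cut) (fun k => Rsum (seq 0 k) (fun i =>
    indic (paired i k) * (/ (INR i + 1) * / (INR k + 1)))).
Proof.
  pose proof q_ge as Hq. pose proof L_ge as HL.
  set (F := fun i k => indic (paired i k) * (/ (INR i + 1) * / (INR k + 1))).
  assert (HF : forall i k, 0 <= F i k).
  { intros i k. pose proof (pos_INR i). pose proof (pos_INR k).
    apply Rmult_le_pos; [apply indic_range|].
    apply Rmult_le_pos; left; apply Rinv_0_lt_compat; lra. }
  rewrite (Rsum_ext (seq 0 cut) _ (fun k => Rsum (seq 0 cut) (fun i => F i k))).
  2:{ intros k Hk. apply in_seq in Hk. replace cut with (k + (cut - k))%nat by lia.
      rewrite Rsum_seq_split, (Rsum_eq0 (seq (0 + k) (cut - k))), Rplus_0_r; [reflexivity|].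
      intros i Hi. apply in_seq in Hi. unfold F. rewrite indic_false; [ring|].
      intros HP. pose proof (paired_lt i k HP). lia. }
  rewrite Rsum_swap.
  destruct (S_floor_nat_bounds q) as [Hi0 Hi0']; [lra|]. set (i0 := S (floor_nat q)) in *.
  destruct (floor_nat_spec (qpow 97)) as [Hi1 Hi1']; [left; apply qpow_pos|]. set (i1 := floor_nat (qpow 97)) in *.
  destruct (floor_nat_spec (qpow 98)) as [Hk1 Hk1']; [left; apply qpow_pos|]. set (k1 := floor_nat (qpow 98)) in *.
  assert (E98 : qpow 98 = q * qpow 97) by (rewrite (qpow_split 98 1 97 eq_refl), qpow_1; reflexivity).
  assert (H97 : q * q <= qpow 97) by (rewrite <- qpow_2; apply qpow_le; lia).
  assert (Hqq : 1000000 * q <= q * q) by (apply Rmult_le_compat_r; lra).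
  assert (H01 : (i0 <= i1)%nat).
  { assert (INR i0 < INR (S i1)) by (rewrite S_INR; lra). apply INR_lt in H. lia. }
  assert (Hi1m : (i1 <= cut)%nat).
  { apply INR_le. pose proof cut_bounds. pose proof (qpow_le 97 100 ltac:(lia)). lra. }
  assert (Hk1m : (k1 <= cut)%nat).
  { apply INR_le. pose proof cut_bounds. pose proof (qpow_le 98 100 ltac:(lia)). lra. }
  set (M := 97 * (L / 400)).
  assert (Hlni : forall i, (i0 <= i < i0 + (i1 - i0))%nat -> INR i + 1 <= qpow 97).
  { intros i Hi. assert (INR (S i) <= INR i1) by (apply le_INR; lia). rewrite S_INR in H. lra. }
  assert (HlnM : forall i, (i0 <= i < i0 + (i1 - i0))%nat -> ln (INR i + 1) <= M).
  { intros i Hi. specialize (Hlni i Hi). unfold M.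
    replace (97 * (L / 400)) with (ln (qpow 97)) by (rewrite ln_qpow; simpl; ring).
    apply ln_le; [pose proof (pos_INR i); lra|exact Hlni]. }
  apply Rle_trans with (Rsum (seq i0 (i1 - i0)) (fun i => / (INR i + 1) * (M - ln (INR i + 1)))).
  - eapply Rle_trans; [|apply weighted_log_sum; exact HlnM].
    replace (i0 + (i1 - i0))%nat with i1 by lia.
    assert (Hln2 : ln 2 <= 1) by (pose proof (ln_le_sub1 2 ltac:(lra)); lra).
    assert (Hlnq : ln q = L / 400) by (rewrite q_def, ln_exp; reflexivity).
    assert (HA : ln (INR i0 + 1) <= L / 400 + 1).
    { apply Rle_trans with (ln (2 * q)); [apply ln_le; lra|]. rewrite ln_mult by lra. lra. }
    assert (HB1 : M <= ln (INR i1 + 1)).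
    { unfold M. replace (97 * (L / 400)) with (ln (qpow 97)) by (rewrite ln_qpow; simpl; ring).
      apply ln_le; [apply qpow_pos|lra]. }
    assert (HB2 : ln (INR i1 + 1) <= M + 1).
    { apply Rle_trans with (ln (2 * qpow 97)).
      - apply ln_le; [pose proof (pos_INR i1); lra|lra].
      - rewrite ln_mult by (lra || apply qpow_pos). rewrite ln_qpow. unfold M. simpl. lra. }
    set (A := M - ln (INR i0 + 1)) in *. set (B := ln (INR i1 + 1)) in *.
    assert (HAl : 96 * (L / 400) - 1 <= A) by (unfold A, M; lra).
    assert (HA2 : (96 * (L / 400) - 1) * (96 * (L / 400) - 1) <= A * A) by (apply Rmult_le_compat; lra).
    assert (HB : (M - B) * (M - B) <= 1).
    { replace ((M - B) * (M - B)) with ((B - M) * (B - M)) by ring.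
      apply Rle_trans with (1 * 1); [apply Rmult_le_compat; lra|lra]. }
    set (w := L / 400) in *. assert (Hw : 2 <= w) by (unfold w; lra).
    assert (2 * w <= w * w) by (apply Rmult_le_compat_r; lra). lra.
  - apply Rle_trans with (Rsum (seq i0 (i1 - i0)) (fun i => Rsum (seq 0 cut) (fun k => F i k))).
    2:{ apply Rsum_incl; [apply seq_NoDup| |].
        - intros i Hi. apply in_seq in Hi. apply in_seq. lia.
        - intros i _. apply Rsum_nonneg. intros; apply HF. }
    apply Rsum_le. intros i Hi. apply in_seq in Hi. specialize (Hlni i ltac:(lia)).
    assert (Hi0i : INR i0 <= INR i) by (apply le_INR; lia).
    assert (Hiq : 0 <= INR i * q) by (apply Rmult_le_pos; lra).
    destruct (S_floor_nat_bounds (INR i * q) Hiq) as [Hk0 Hk0']. set (k0 := S (floor_nat (INR i * q))) in *.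
    assert (Hqi : (INR i + 1) * q <= qpow 98).
    { rewrite E98, Rmult_comm. apply Rmult_le_compat_l; lra. }
    assert (H0k : (k0 <= k1)%nat).
    { assert (INR k0 < INR (S k1)) by (rewrite S_INR; lra). apply INR_lt in H. lia. }
    apply Rle_trans with (Rsum (seq k0 (k1 - k0)) (fun k => F i k)).
    2:{ apply Rsum_incl; [apply seq_NoDup| |intros; apply HF].
        intros k Hk. apply in_seq in Hk. apply in_seq. lia. }
    rewrite (Rsum_ext (seq k0 (k1 - k0)) _ (fun k => / (INR i + 1) * / (INR k + 1))).
    2:{ intros k Hk. apply in_seq in Hk. unfold F. rewrite indic_true; [ring|].
        assert (INR k0 <= INR k) by (apply le_INR; lia).
        assert (INR (S k) <= INR k1) by (apply le_INR; lia). rewrite S_INR in H0.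
        unfold paired. lra. }
    rewrite Rsum_scal. apply Rmult_le_compat_l; [left; apply Rinv_0_lt_compat; lra|].
    eapply Rle_trans; [|apply inv_sum_ge_ln].
    replace (k0 + (k1 - k0))%nat with k1 by lia.
    assert (H1 : 98 * (L / 400) <= ln (INR k1 + 1)).
    { replace (98 * (L / 400)) with (ln (qpow 98)) by (rewrite ln_qpow; simpl; ring).
      apply ln_le; [apply qpow_pos|lra]. }
    assert (H2 : ln (INR k0 + 1) <= ln (INR i + 1) + L / 400).
    { apply Rle_trans with (ln ((INR i + 1) * q)); [apply ln_le; lra|].
      rewrite ln_mult by lra. rewrite q_def, ln_exp. lra. }
    unfold M. lra.
Qed.

(** The expectation is split at [cut]: the inner one is bounded by [missed_given_prefix], and that
    bound, a product over pairs of early picks, is averaged by the same inequality. *)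
Lemma missed_bound kk al : (n <= cut + kk)%nat ->
  expect (block K) (cut + kk) 0 (fun be => indic (~ represented n be)) al <= exp (- (11 / 20) * L).
Proof.
  intros Hkk. pose proof q_ge as Hq. pose proof L_ge as HL. rewrite expect_split.
  assert (Hqi : 0 < / q <= / 1000000).
  { split; [apply Rinv_0_lt_compat; lra|apply Rinv_le_contravar; lra]. }
  eapply Rle_trans; [apply (expect_exp_pairs (block K) (block_nonempty K K_pos) coprime_loss (42 / q))|].
  - unfold Rdiv. lra.
  - intros i j x y _ _ _. pose proof (coprime_loss_range i j x y). lra.
  - intros m' j y Hj _. apply coprime_loss_back. lia.
  - intros k' m' x Hk _. apply coprime_loss_fwd. lia.
  - intros be [_ Hbe]. right.
    exists (fun i k => pair_weight i k * indic (Nat.gcd (be i) (be k) = 1%nat)). split.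
    + eapply Rle_trans; [apply (missed_given_prefix be); [intros; apply Hbe; lia|exact Hkk]|].
      right. do 2 f_equal. apply Rsum_ext. intros k _. rewrite Nat.sub_0_r. apply Rsum_ext. intros i _.
      unfold pair_weight. rewrite Rmult_assoc. f_equal.
      unfold indic. do 3 destruct (excluded_middle_informative _); try ring; tauto.
    + intros i j _ _. unfold coprime_loss. ring.
  - apply exp_le. rewrite (total_back (block K) (block_nonempty K K_pos)).
    set (S := Rsum (seq 0 cut) _).
    assert (HS : 204 / 10 / L * (4560 * (L / 400 * (L / 400))) <= S).
    { eapply Rle_trans; [apply Rmult_le_compat_l; [|exact paired_sum]|].
      - apply Rdiv_le_0_compat; lra.
      - rewrite <- Rsum_scal. unfold S. apply Rsum_le. intros k _.
        unfold back_degree. rewrite Nat.sub_0_r, avg_Rsum, <- Rsum_scal.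
        apply Rsum_le. intros i _. apply coprime_loss_avg. }
    (* Here [20.4 * 4560 / 400^2 = 0.5814], which exceeds 11/20 even after a factor 0.99 for the
       last error. *)
    replace (204 / 10 / L * (4560 * (L / 400 * (L / 400)))) with (5814 / 10000 * L) in HS by (field; lra).
    assert (5814 / 10000 * L * (99 / 100) <= S * (1 - 3 * (42 / q))).
    { apply Rmult_le_compat; unfold Rdiv; lra. }
    lra.
Qed.

End FixedTarget.

(** * Choosing the random set *)

Lemma exp_ge_sqr y : 0 <= y -> (y / 2) * (y / 2) <= exp y.
Proof.
  intros Hy. replace y with (y / 2 + y / 2) at 3 by field. rewrite exp_plus.
  pose proof (exp_ineq1_le (y / 2)). apply Rmult_le_compat; lra.
Qed.

Lemma eventually_ln_ge M : eventually (fun n => M <= ln (INR n)).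
Proof.
  apply (filter_imp (fun n => exp M <= INR n)); [|apply eventually_ge].
  intros n Hn. rewrite <- (ln_exp M). apply ln_le; [apply exp_pos|exact Hn].
Qed.

Lemma eventually_root_dominates C :
  eventually (fun n => C * (1 + ln (INR n)) <= exp (ln (INR n) / 400)).
Proof.
  apply (filter_imp (fun n => 1 <= ln (INR n) /\ 2 * 800 * 800 * C <= ln (INR n))).
  2:{ apply filter_and; apply eventually_ln_ge. }
  intros n [H1 H2]. set (L := ln (INR n)) in *.
  eapply Rle_trans; [|apply exp_ge_sqr; lra].
  destruct (Rle_lt_dec C 0) as [HC|HC].
  - apply Rle_trans with 0; [nra|]. apply Rmult_le_pos; lra.
  - apply Rle_trans with (C * (2 * L)); [apply Rmult_le_compat_l; lra|].
    replace (L / 400 / 2 * (L / 400 / 2)) with (/ (800 * 800) * L * L) by field.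
    rewrite <- Rmult_assoc. apply Rmult_le_compat_r; lra.
Qed.

Lemma missed_eventually K : 0 < K -> 32 * (K * K) <= 1 ->
  eventually (fun n => forall N al, (n <= N)%nat ->
    expect (block K) N 0 (fun be => indic (~ represented n be)) al <= exp (- (11 / 20) * ln (INR n))).
Proof.
  intros HK HK32.
  destruct (eventually_regular K HK (1 / 100) ltac:(lra)) as [j0 Hj0].
  destruct (divisor_bound 401) as [C HC].
  (* A single constant dominating all others, so that [q >= B (1 + L)] yields every largeness
     condition on [q]. *)
  set (B := 1000000 + 4 * K + INR C + INR j0).
  apply (filter_imp (fun n => 1 <= INR n /\ B * (1 + ln (INR n)) <= exp (ln (INR n) / 400))).
  2:{ apply filter_and; [apply eventually_ge|apply eventually_root_dominates]. }
  intros n [Hn1 Hq] N al HN. set (L := ln (INR n)) in *. set (q := exp (L / 400)) in *.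
  assert (HL : 0 <= L) by (unfold L; rewrite <- ln_1; apply ln_le; lra).
  pose proof (pos_INR C) as HC0. pose proof (pos_INR j0) as Hj00.
  assert (Hsub : forall b, 0 <= b <= B -> b * (1 + L) <= q).
  { intros b Hb. eapply Rle_trans; [|exact Hq]. apply Rmult_le_compat_r; lra. }
  assert (Hn0 : (0 < n)%nat) by (apply INR_lt; simpl; lra).
  assert (Hq1 : 1000000 * (1 + L) <= q) by (apply Hsub; unfold B; lra).
  assert (Hq2 : 4 * K * (1 + L) <= q) by (apply Hsub; unfold B; lra).
  assert (Hreg : forall j, q <= INR j -> regular K (1 / 100) j).
  { intros j Hj. apply Hj0. apply INR_le.
    assert (INR j0 * (1 + L) <= q) by (apply Hsub; unfold B; lra).
    assert (INR j0 * 1 <= INR j0 * (1 + L)) by (apply Rmult_le_compat_l; lra). lra. }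
  assert (Hdiv : forall m, (0 < m <= n)%nat -> INR (length (divisors m)) <= q).
  { intros m Hm. destruct (Rle_lt_dec (INR (length (divisors m))) q) as [|Hlt]; [assumption|exfalso].
    specialize (HC m ltac:(lia)). apply le_INR in HC. rewrite pow_INR, mult_INR in HC.
    assert (H1 : q ^ 401 <= INR (length (divisors m)) ^ 401) by (apply pow_incr; lra).
    assert (H2 : INR C * INR m <= (q - 1) * q ^ 400).
    { apply Rmult_le_compat; try apply pos_INR.
      - assert ((INR C + 1) * (1 + L) <= q) by (apply Hsub; unfold B; lra).
        assert ((INR C + 1) * 1 <= (INR C + 1) * (1 + L)) by (apply Rmult_le_compat_l; lra). lra.
      - apply Rle_trans with (INR n); [apply le_INR; lia|].
        right. apply (n_eq_qpow n q L); auto. }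
    rewrite <- (tech_pow_Rmult q 400) in H1. assert (0 < q ^ 400) by (apply pow_lt; lra). lra. }
  pose proof (cut_lt_n n q L eq_refl eq_refl Hn0 Hq1) as Hm1.
  replace N with (cut q + (N - cut q))%nat by lia.
  apply (missed_bound K n q L); auto. lia.
Qed.

Section Selection.

Variable I : nat -> list nat.
Hypothesis I_nonempty : forall j, I j <> nil.
Variable Phi : nat -> (nat -> nat) -> R.
Variable C : R.
Hypothesis Phi_local : forall N, depends_below N (Phi N).
Hypothesis Phi_mono : forall N al, Phi N al <= Phi (S N) al.

(** The conditional expectation given the picks below [m] is controlled for all horizons [N] at
    once; a single horizon would not lead to an infinite choice. *)
Definition safe (m : nat) (al : nat -> nat) : Prop :=
  forall N, expect I (N - m) m (Phi N) al <= C.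

(** [Phi N] ignores the blocks from [N] on, so averaging it over one more block changes nothing, and
    [Phi_mono] applies inside. *)
Lemma tail_mono m al N N' : (N <= N')%nat ->
  expect I (N - m) m (Phi N) al <= expect I (N' - m) m (Phi N') al.
Proof.
  intros H. induction H as [|N' H IH]; [lra|]. eapply Rle_trans; [exact IH|].
  destruct (le_lt_dec m N') as [Hm|Hm].
  - replace (S N' - m)%nat with ((N' - m) + 1)%nat by lia. rewrite (expect_split I).
    replace (m + (N' - m))%nat with N' by lia.
    apply expect_le; [exact I_nonempty|]. intros be _.
    rewrite <- (expect_depends I I_nonempty 1 N' (Phi N') be) by apply Phi_local.
    apply expect_le; [exact I_nonempty|]. intros; apply Phi_mono.
  - replace (N' - m)%nat with 0%nat by lia. replace (S N' - m)%nat with 0%nat by lia. apply Phi_mono.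
Qed.

(** If every [x] failed at some horizon, then, the block being finite and the expectations monotone,
    all would fail at the largest of these horizons, against the average there. *)
Lemma safe_step m al : safe m al -> exists x, In x (I m) /\ safe (S m) (update al m x).
Proof.
  intros Hs. apply NNPP. intros Hno.
  assert (H : forall l, incl l (I m) -> exists N, (m < N)%nat /\ forall x, In x l ->
    C < expect I (N - S m) (S m) (Phi N) (update al m x)).
  { induction l as [|a l IH]; intros Hl.
    - exists (S m). split; [lia|]. intros x [].
    - destruct IH as (N & HN & HlN); [intros x Hx; apply Hl; right; exact Hx|].
      assert (Ha : exists N', C < expect I (N' - S m) (S m) (Phi N') (update al m a)).
      { apply NNPP. intros Hn. apply Hno. exists a. split; [apply Hl; left; reflexivity|].
        intros N'. apply Rnot_lt_le. intros Hlt. apply Hn. exists N'. exact Hlt. }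
      destruct Ha as [N' HN']. exists (Nat.max N N'). split; [lia|].
      intros x [<-|Hx].
      + eapply Rlt_le_trans; [exact HN'|]. apply tail_mono. lia.
      + eapply Rlt_le_trans; [apply HlN, Hx|]. apply tail_mono. lia. }
  destruct (H (I m) (incl_refl _)) as (N & HN & Hgt).
  specialize (Hs N). replace (N - m)%nat with (S (N - S m)) in Hs by lia. simpl in Hs.
  destruct (avg_exists_le (I m) _ C (I_nonempty m) Hs) as (x & Hx & Hle).
  specialize (Hgt x Hx). lra.
Qed.

Definition next_choice (m : nat) (al : nat -> nat) : nat :=
  epsilon (inhabits 0%nat) (fun x => In x (I m) /\ safe (S m) (update al m x)).

Fixpoint approx (m : nat) : nat -> nat :=
  match m with
  | O => fun _ => O
  | S m' => update (approx m') m' (next_choice m' (approx m'))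
  end.

Lemma selection : (forall N al, expect I N 0 (Phi N) al <= C) ->
  exists al, (forall j, In (al j) (I j)) /\ forall N, Phi N al <= C.
Proof.
  intros H0.
  assert (Hsafe : forall m, safe m (approx m)).
  { induction m as [|m IH].
    - intros N. rewrite Nat.sub_0_r. apply H0.
    - simpl. apply (epsilon_spec (inhabits 0%nat) _ (safe_step m (approx m) IH)). }
  assert (Hnext : forall m, In (next_choice m (approx m)) (I m)).
  { intros m. apply (epsilon_spec (inhabits 0%nat) _ (safe_step m (approx m) (Hsafe m))). }
  set (al := fun j => approx (S j) j).
  assert (Hal : forall m j, (j < m)%nat -> approx m j = al j).
  { induction m as [|m IH]; intros j Hj; [lia|].
    destruct (Nat.eq_dec j m) as [->|Hne]; [reflexivity|].
    simpl. rewrite update_neq by exact Hne. apply IH. lia. }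
  exists al. split.
  - intros j. unfold al. simpl. rewrite update_eq. apply Hnext.
  - intros N. rewrite <- (Phi_local N (approx N) al) by (intros; apply Hal; assumption).
    specialize (Hsafe N N). rewrite Nat.sub_diag in Hsafe. exact Hsafe.
Qed.

End Selection.

(** Each term is at most the drop of [40 x^(-1/40)] from [n - 1] to [n], so the sum telescopes. *)
Lemma inv_power_sum n0 k : (2 <= n0)%nat ->
  Rsum (seq n0 k) (fun n => exp (- (41 / 40) * ln (INR n))) <= 40.
Proof.
  intros Hn0. set (e := fun x => exp (- (1 / 40) * ln x)).
  assert (H : Rsum (seq n0 k) (fun n => exp (- (41 / 40) * ln (INR n))) <=
    40 * (e (INR n0 - 1) - e (INR (n0 + k) - 1))).
  { revert n0 Hn0. induction k as [|k IH]; intros n0 Hn0.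
    - rewrite Nat.add_0_r. simpl. lra.
    - simpl Rsum. specialize (IH (S n0) ltac:(lia)).
      replace (n0 + S k)%nat with (S n0 + k)%nat by lia. rewrite S_INR in IH.
      replace (INR n0 + 1 - 1) with (INR n0) in IH by ring.
      apply le_INR in Hn0. change (INR 2) with 2 in Hn0.
      assert (Hstep : exp (- (41 / 40) * ln (INR n0)) <= 40 * (e (INR n0 - 1) - e (INR n0))).
      { unfold e. set (x := INR n0) in *.
        destruct (ln_succ_sub (x - 1) ltac:(lra)) as [Hln _].
        replace (x - 1 + 1) with x in Hln by ring.
        replace (- (41 / 40) * ln x) with (- (1 / 40) * ln x + - ln x) by field.
        replace (- (1 / 40) * ln (x - 1)) with (- (1 / 40) * ln x + 1 / 40 * (ln x - ln (x - 1))) by field.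
        rewrite !exp_plus, exp_Ropp, exp_ln by lra.
        pose proof (exp_ineq1_le (1 / 40 * (ln x - ln (x - 1)))).
        pose proof (exp_pos (- (1 / 40) * ln x)) as Hp.
        set (E := exp (- (1 / 40) * ln x)) in *.
        assert (E * / x <= E * (40 * (exp (1 / 40 * (ln x - ln (x - 1))) - 1)))
          by (apply Rmult_le_compat_l; lra).
        lra. }
      lra. }
  assert (H1 : e (INR n0 - 1) <= 1).
  { unfold e. apply Rle_trans with (exp 0); [apply exp_le|rewrite exp_0; lra]. apply le_INR in Hn0. change (INR 2) with 2 in Hn0.
    assert (0 <= ln (INR n0 - 1)) by (rewrite <- ln_1; apply ln_le; lra). lra. }
  pose proof (exp_pos (- (1 / 40) * ln (INR (n0 + k) - 1))). fold (e (INR (n0 + k) - 1)) in H0. lra.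
Qed.

(** The weights [n^(-19/40)] merge the bounds for all [X] into one series, convergent because
    [11/20 + 19/40 = 41/40 > 1]. A single choice then serves every [X]. *)
Lemma few_missed K : 0 < K -> 32 * (K * K) <= 1 ->
  exists (al : nat -> nat) (n0 : nat), (1 <= n0)%nat /\ (forall j, In (al j) (block K j)) /\
    forall N, Rsum (seq n0 N) (fun n => exp (- (19 / 40) * ln (INR n)) * indic (~ represented n al)) <= 40.
Proof.
  intros HK HK32. destruct (missed_eventually K HK HK32) as [n1 Hn1].
  (* The shift by 2 keeps [n0 - 1 >= 1], as [inv_power_sum] requires. *)
  set (n0 := (n1 + 2)%nat).
  set (w := fun n => exp (- (19 / 40) * ln (INR n))).
  set (Phi := fun N al => Rsum (seq n0 (N - n0)) (fun n => w n * indic (~ represented n al))).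
  assert (Hw : forall n, 0 <= w n) by (intros; left; apply exp_pos).
  destruct (selection (block K) (block_nonempty K HK) Phi 40) as (al & Hal & HPhi).
  - intros N al be Hab. apply Rsum_ext. intros n Hn. apply in_seq in Hn. f_equal.
    assert (Hr : forall al be, (forall j, (j < N)%nat -> al j = be j) ->
      represented n al -> represented n be).
    { intros a b Hj (i & j & k & l & Hi & E). exists i, j, k, l. split; [exact Hi|].
      rewrite <- !Hj by lia. exact E. }
    apply Rle_antisym; apply indic_le; intros H H'; apply H; eapply Hr; try exact H'; [|assumption].
    intros; symmetry; apply Hab; assumption.
  - intros N al. apply Rsum_incl; [apply seq_NoDup| |].
    + intros n Hn. apply in_seq in Hn. apply in_seq. lia.
    + intros n _. apply Rmult_le_pos; [apply Hw|apply indic_range].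
  - intros N al. unfold Phi. rewrite (expect_Rsum (block K)).
    eapply Rle_trans; [|apply (inv_power_sum n0 (N - n0)); unfold n0; lia].
    apply Rsum_le. intros n Hn. apply in_seq in Hn.
    rewrite (expect_scal (block K) N 0 (w n) (fun be => indic (~ represented n be))).
    apply Rle_trans with (w n * exp (- (11 / 20) * ln (INR n))).
    + apply Rmult_le_compat_l; [apply Hw|]. apply Hn1; unfold n0 in *; lia.
    + right. unfold w. rewrite <- exp_plus. f_equal. field.
  - exists al, n0. split; [unfold n0; lia|]. split; [exact Hal|]. intros N. specialize (HPhi (n0 + N)%nat).
    unfold Phi in HPhi. replace (n0 + N - n0)%nat with N in HPhi by lia. exact HPhi.
Qed.

(** * The counting function *)

Section BasisSet.

Variables (K : R) (al : nat -> nat) (n0 : nat).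
Hypothesis K_pos : 0 < K.
Hypothesis n0_pos : (1 <= n0)%nat.
Hypothesis al_block : forall j, In (al j) (block K j).
Hypothesis al_missed : forall N,
  Rsum (seq n0 N) (fun n => exp (- (19 / 40) * ln (INR n)) * indic (~ represented n al)) <= 40.

(** All numbers up to [n0] are put in, since no bound on the missed ones is available there; as
    [n0 >= 1] this includes 0 and 1. *)
Definition basis (m : nat) : bool :=
  if excluded_middle_informative
    ((m <= n0)%nat \/ (exists j, al j = m) \/ ~ represented m al) then true else false.

Lemma basis_true m :
  basis m = true <-> (m <= n0)%nat \/ (exists j, al j = m) \/ ~ represented m al.
Proof. unfold basis. destruct (excluded_middle_informative _); split; congruence || tauto. Qed.

Lemma basis_sumsq : sumsq_products_all basis.
Proof.
  intros n. destruct (excluded_middle_informative (represented n al)) as [H|H].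
  - destruct H as (i & j & k & l & _ & E). exists (al i), (al j), (al k), (al l).
    repeat split; try exact E; apply basis_true; right; left; eexists; reflexivity.
  - exists n, 1%nat, 0%nat, 0%nat. repeat split; try lia; apply basis_true; auto; left; lia.
Qed.

Definition listed (X : R) : list nat :=
  filter (fun n => andb (basis n) (if Rle_dec (INR n) X then true else false))
    (seq 1 (Z.to_nat (up X))).

Lemma in_listed X m : In m (listed X) <-> (1 <= m)%nat /\ INR m <= X /\ basis m = true.
Proof.
  unfold listed. rewrite filter_In, in_seq, andb_true_iff. split.
  - intros [H1 [H2 H3]]. destruct (Rle_dec (INR m) X); [|discriminate]. split; [lia|tauto].
  - intros (H1 & H2 & H3). split; [split; [exact H1|]|].
    + destruct (archimed X) as [Ha _].
      assert (Hz : (Z.of_nat m < up X)%Z) by (apply lt_IZR; rewrite <- INR_IZR_INZ; lra). lia.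
    + split; [exact H3|]. destruct (Rle_dec (INR m) X); [reflexivity|contradiction].
Qed.

Lemma al_range j : (xi K j <= al j < xi K (S j))%nat.
Proof. apply in_block; [exact K_pos|apply al_block]. Qed.

Lemma al_injective i j : al i = al j -> i = j.
Proof.
  intros E. apply (block_disjoint K K_pos i j (al i)); [apply al_block|].
  rewrite E. apply al_block.
Qed.

(** Block 0 may pick the number 0, which is not counted; the blocks 1 to [J - 1] remain. *)
Lemma counting_lower X J : INR (xi K J) <= X -> INR J - 1 <= INR (counting basis X).
Proof.
  intros HX. destruct J as [|J]; [simpl; pose proof (pos_INR (counting basis X)); lra|].
  rewrite S_INR. replace (INR J + 1 - 1) with (INR J) by ring. apply le_INR.
  change (counting basis X) with (length (listed X)).
  rewrite <- (length_seq J 1) at 1. rewrite <- (length_map al). apply NoDup_incl_length.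
  - apply NoDup_map_NoDup_ForallPairs; [|apply seq_NoDup].
    intros i j _ _ E. apply al_injective, E.
  - intros m Hm. apply in_map_iff in Hm. destruct Hm as (j & <- & Hj). apply in_seq in Hj.
    pose proof (al_range j) as Hr. pose proof (xi_ge K j).
    pose proof (xi_le K K_pos (S j) (S J) ltac:(lia)).
    apply in_listed. split; [lia|]. split; [|apply basis_true; right; left; exists j; reflexivity].
    apply Rle_trans with (INR (xi K (S J))); [apply le_INR; lia|exact HX].
Qed.

(** Every missed [n <= X] weighs at least [X^(-19/40)] in [al_missed]. *)
Lemma missed_count X N : 1 <= X -> INR (n0 + N) <= X + 1 ->
  Rsum (seq n0 N) (fun n => indic (~ represented n al)) <= 40 * exp (19 / 40 * ln X).
Proof.
  intros HX HN. pose proof (exp_pos (19 / 40 * ln X)) as He.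
  assert (H : exp (- (19 / 40 * ln X)) * Rsum (seq n0 N) (fun n => indic (~ represented n al)) <= 40).
  { eapply Rle_trans; [|apply (al_missed N)]. rewrite <- Rsum_scal. apply Rsum_le. intros n Hn.
    apply in_seq in Hn. apply Rmult_le_compat_r; [apply indic_range|]. apply exp_le.
    assert (INR (S n) <= INR (n0 + N)) by (apply le_INR; lia). rewrite S_INR in H.
    assert (0 < INR n) by (apply lt_0_INR; lia).
    assert (ln (INR n) <= ln X) by (apply ln_le; lra). lra. }
  rewrite exp_Ropp in H. apply Rmult_le_reg_l with (/ exp (19 / 40 * ln X)).
  - apply Rinv_0_lt_compat, He.
  - replace (/ exp (19 / 40 * ln X) * (40 * exp (19 / 40 * ln X))) with 40 by (field; lra). exact H.
Qed.

Lemma counting_upper X J : 1 <= X -> X < INR (xi K (S J)) ->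
  INR (counting basis X) <= INR J + (INR n0 + 2 + 40 * exp (19 / 40 * ln X)).
Proof.
  intros HX HJ. change (counting basis X) with (length (listed X)).
  set (N := (S (floor_nat X) - n0)%nat).
  set (M := filter (fun n => if excluded_middle_informative (~ represented n al) then true else false)
    (seq n0 N)).
  assert (Hlen : (length (listed X) <= length (seq 0 (S n0) ++ map al (seq 0 (S J)) ++ M))%nat).
  { apply NoDup_incl_length; [apply NoDup_filter, seq_NoDup|].
    intros m Hm. apply in_listed in Hm. destruct Hm as (H1 & H2 & H3). apply basis_true in H3.
    destruct H3 as [H3|[[j Hj]|H3]].
    - apply in_app_iff. left. apply in_seq. lia.
    - apply in_app_iff. right. apply in_app_iff. left. rewrite <- Hj. apply in_map.
      apply in_seq. destruct (lt_dec j (S J)) as [|Hge]; [lia|exfalso].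
      pose proof (al_range j). pose proof (xi_le K K_pos (S J) j ltac:(lia)).
      assert (INR (xi K (S J)) <= INR m) by (apply le_INR; lia). lra.
    - destruct (le_lt_dec m n0) as [Hle|Hlt]; [apply in_app_iff; left; apply in_seq; lia|].
      apply in_app_iff. right. apply in_app_iff. right. apply filter_In.
      destruct (floor_nat_spec X ltac:(lra)) as [_ Hn]. rewrite <- S_INR in Hn.
      assert (m < S (floor_nat X))%nat by (apply INR_lt; lra).
      split; [apply in_seq; unfold N; lia|].
      destruct (excluded_middle_informative _); tauto. }
  apply le_INR in Hlen. rewrite !length_app, length_map, !length_seq, !plus_INR, !S_INR in Hlen.
  assert (HM : INR (length M) <= 40 * exp (19 / 40 * ln X)).
  { unfold M. rewrite <- (Rsum_indic (seq n0 N) (fun n => ~ represented n al)).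
    destruct (le_lt_dec n0 (S (floor_nat X))) as [Hle|Hlt].
    - apply missed_count; [exact HX|]. replace (n0 + N)%nat with (S (floor_nat X)) by (unfold N; lia).
      rewrite S_INR. pose proof (floor_nat_spec X ltac:(lra)). lra.
    - replace N with 0%nat by (unfold N; lia). simpl.
      pose proof (exp_pos (19 / 40 * ln X)). lra. }
  lra.
Qed.

End BasisSet.

Lemma Rpower_quarter_sqr x : 0 < x -> Rpower x (1 / 4) * Rpower x (1 / 4) = sqrt x.
Proof.
  intros Hx. rewrite <- Rpower_plus, <- Rpower_sqrt by exact Hx. f_equal. field.
Qed.

Lemma Rpower_quarter_pos x : 0 < Rpower x (1 / 4).
Proof. apply exp_pos. Qed.

(** * Comparison with [2 c sqrt X / (ln X)^(1/4)] *)

Section Asymptotics.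

Variables (c K : R).
Hypothesis c_pos : 0 < c.
Hypothesis K_def : K = sqrt 2 / (4 * (c * c)).

Definition target (X : R) : R := 2 * c * sqrt X / Rpower (ln X) (1 / 4).

Lemma K_pos : 0 < K.
Proof.
  rewrite K_def. apply Rdiv_lt_0_compat; [apply sqrt_lt_R0; lra|].
  apply Rmult_lt_0_compat; [lra|apply Rmult_lt_0_compat; lra].
Qed.

Lemma target_pos X : 0 < X -> 0 < target X.
Proof.
  intros HX. unfold target. apply Rdiv_lt_0_compat; [|apply Rpower_quarter_pos].
  apply Rmult_lt_0_compat; [lra|apply sqrt_lt_R0, HX].
Qed.

(** The origin of [K]: solving [K J^2 sqrt (ln J) = X] with [ln J = ln X / 2] gives
    [J = target X]. *)
Lemma target_sqr X : 1 < X -> target X * target X * (K * sqrt (ln X)) = sqrt 2 * X.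
Proof.
  intros HX. assert (Hl : 0 < ln X) by (rewrite <- ln_1; apply ln_increasing; lra).
  unfold target. rewrite <- (Rpower_quarter_sqr (ln X) Hl), K_def.
  pose proof (Rpower_quarter_pos (ln X)) as Hp. set (p := Rpower (ln X) (1 / 4)) in *.
  transitivity (sqrt 2 * (sqrt X * sqrt X)); [field; lra|].
  rewrite sqrt_sqrt by lra. reflexivity.
Qed.

Lemma block_index X : 0 <= X -> exists J, INR (xi K J) <= X < INR (xi K (S J)).
Proof.
  intros HX. destruct (floor_nat_spec X HX) as [H1 H2].
  assert (Hxi0 : xi K 0 = 0%nat).
  { assert (INR (xi K 0) <= 0); [|apply INR_eq; simpl; pose proof (pos_INR (xi K 0)); lra].
    pose proof (xi_bounds K K_pos 0) as [_ H]. unfold grow in H. simpl in H. lra. }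
  destruct (block_of K K_pos 0 (floor_nat X)) as (J & _ & HJ); [lia|].
  apply in_block in HJ; [|apply K_pos]. exists J.
  assert (INR (xi K J) <= INR (floor_nat X)) by (apply le_INR; lia).
  assert (INR (S (floor_nat X)) <= INR (xi K (S J))) by (apply le_INR; lia). rewrite S_INR in H0. lra.
Qed.

(** [X] lies between [K J^2 sqrt_lg J] and [(1 + eta) K (J + 1)^2 sqrt_lg J], so [ln X] is [2 lg J]
    up to [eta * lg J], the condition on [sqrt_lg J] absorbing the logarithm of [2 K sqrt_lg J]. The
    conclusions follow by comparing squares. *)
Lemma index_vs_target eta J X : 0 < eta <= 1 -> regular K eta J -> 2 * K / eta <= sqrt_lg J ->
  1 < X -> INR (xi K J) <= X < INR (xi K (S J)) ->
  INR J <= (1 + eta) * target X /\ target X <= (1 + eta) * (INR J + 1).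
Proof.
  intros He Hreg HslK HX [HX1 HX2]. destruct Hreg.
  pose proof K_pos as HK. pose proof (target_sqr X HX) as HT.
  pose proof (target_pos X ltac:(lra)) as HT0. set (g := target X) in *.
  clearbody g. assert (Hlg0 := lg_nonneg J).
  assert (Hss : sqrt_lg J * sqrt_lg J = lg J) by (apply sqrt_sqrt, Hlg0).
  assert (Hl : 0 < ln X) by (rewrite <- ln_1; apply ln_increasing; lra).
  assert (H2 : 0 < sqrt 2) by (apply sqrt_lt_R0; lra).
  assert (HlnX1 : 2 * lg J <= ln X).
  { apply Rle_trans with (ln ((INR J + 1) * (INR J + 1))).
    - rewrite ln_mult by lra. unfold lg. lra.
    - apply ln_le; [apply Rmult_lt_0_compat|]; lra. }
  assert (HlnX2 : ln X <= (2 + eta) * lg J).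
  { apply Rle_trans with (ln ((2 * K * sqrt_lg J) * ((INR J + 1) * (INR J + 1)))).
    - apply ln_le; [lra|].
      assert (HKs : 0 <= K * ((INR J + 1) * (INR J + 1)) * sqrt_lg J) by (repeat apply Rmult_le_pos; lra).
      assert ((1 + eta) * (K * ((INR J + 1) * (INR J + 1)) * sqrt_lg J) <=
        2 * (K * ((INR J + 1) * (INR J + 1)) * sqrt_lg J)) by (apply Rmult_le_compat_r; lra).
      lra.
    - assert (HKs : 0 < 2 * K * sqrt_lg J) by (repeat apply Rmult_lt_0_compat; lra).
      rewrite (ln_mult (2 * K * sqrt_lg J)), (ln_mult (INR J + 1)); try lra; [|apply Rmult_lt_0_compat; lra].
      pose proof (ln_le_sub1 _ HKs) as Hln.
      assert (2 * K * sqrt_lg J <= eta * lg J).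
      { rewrite <- Hss, <- Rmult_assoc. apply Rmult_le_compat_r; [lra|].
        apply (Rmult_le_compat_l eta) in HslK; [|lra].
        replace (eta * (2 * K / eta)) with (2 * K) in HslK by (field; lra). exact HslK. }
      unfold lg in *. lra. }
  assert (Hs1 : sqrt 2 * sqrt_lg J <= sqrt (ln X)).
  { unfold sqrt_lg. rewrite <- sqrt_mult by lra. apply sqrt_le_1_alt, HlnX1. }
  assert (Hs2 : sqrt (ln X) <= sqrt 2 * ((1 + eta) * sqrt_lg J)).
  { apply Rle_trans with (sqrt ((2 * ((1 + eta) * (1 + eta))) * lg J)).
    - apply sqrt_le_1_alt. eapply Rle_trans; [exact HlnX2|]. apply Rmult_le_compat_r; [lra|]. nra.
    - rewrite sqrt_mult, sqrt_mult by nra. rewrite sqrt_square by lra. unfold sqrt_lg. lra. }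
  split.
  - apply Rsqr_incr_0_var; [|apply Rmult_le_pos; lra]. unfold Rsqr.
    assert (H : sqrt 2 * (K * (INR J * INR J) * sqrt_lg J) <= g * g * (K * (sqrt 2 * ((1 + eta) * sqrt_lg J)))).
    { apply Rle_trans with (sqrt 2 * X); [apply Rmult_le_compat_l; lra|]. rewrite <- HT.
      apply Rmult_le_compat_l; [apply Rmult_le_pos; lra|]. apply Rmult_le_compat_l; lra. }
    assert (Hm : 0 < sqrt 2 * K * sqrt_lg J) by (repeat apply Rmult_lt_0_compat; lra).
    assert (INR J * INR J <= g * g * (1 + eta)).
    { apply Rmult_le_reg_r with (sqrt 2 * K * sqrt_lg J); [exact Hm|]. lra. }
    assert (0 <= g * g * (1 + eta)) by (repeat apply Rmult_le_pos; lra).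
    assert (g * g * (1 + eta) * 1 <= g * g * (1 + eta) * (1 + eta)) by (apply Rmult_le_compat_l; lra).
    lra.
  - apply Rsqr_incr_0_var; [|apply Rmult_le_pos; lra]. unfold Rsqr.
    assert (H : g * g * (K * (sqrt 2 * sqrt_lg J)) <=
      sqrt 2 * ((1 + eta) * K * ((INR J + 1) * (INR J + 1)) * sqrt_lg J)).
    { apply Rle_trans with (sqrt 2 * X); [|apply Rmult_le_compat_l; lra]. rewrite <- HT.
      apply Rmult_le_compat_l; [apply Rmult_le_pos; lra|]. apply Rmult_le_compat_l; lra. }
    assert (Hm : 0 < sqrt 2 * K * sqrt_lg J) by (repeat apply Rmult_lt_0_compat; lra).
    assert (g * g <= (1 + eta) * ((INR J + 1) * (INR J + 1))).
    { apply Rmult_le_reg_r with (sqrt 2 * K * sqrt_lg J); [exact Hm|]. lra. }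
    assert (0 <= (1 + eta) * ((INR J + 1) * (INR J + 1))) by (repeat apply Rmult_le_pos; lra).
    assert ((1 + eta) * ((INR J + 1) * (INR J + 1)) * 1 <=
      (1 + eta) * ((INR J + 1) * (INR J + 1)) * (1 + eta)) by (apply Rmult_le_compat_l; lra).
    lra.
Qed.

(** Because [sqrt X = X^(19/40) X^(1/40)], and [X^(1/40)] outgrows [ln X], which is a crude bound
    for [(ln X)^(1/4)]. *)
Lemma error_negligible C eps : 0 < C -> 0 < eps ->
  exists X0, forall X, X0 < X -> C * exp (19 / 40 * ln X) <= eps * target X.
Proof.
  intros HC He. set (M0 := 1 + 6400 * C / (2 * c * eps)).
  exists (exp M0). intros X HX.
  assert (HX0 : 0 < X) by (pose proof (exp_pos M0); lra).
  assert (HM0 : 0 < 6400 * C / (2 * c * eps)) by (repeat apply Rdiv_lt_0_compat; nra).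
  assert (HM : M0 < ln X) by (rewrite <- (ln_exp M0); apply ln_increasing; [apply exp_pos|exact HX]).
  set (M := ln X) in *.
  assert (Hp : Rpower M (1 / 4) <= M).
  { rewrite <- (Rpower_1 M) at 2 by (unfold M0 in HM; lra).
    apply Rle_Rpower; unfold M0 in HM; lra. }
  assert (Hs : sqrt X = exp (19 / 40 * M) * exp (1 / 40 * M)).
  { rewrite <- Rpower_sqrt by exact HX0. unfold Rpower. fold M. rewrite <- exp_plus. f_equal. field. }
  unfold target. fold M. rewrite Hs.
  pose proof (exp_pos (19 / 40 * M)) as Hep. pose proof (Rpower_quarter_pos M) as Hpp.
  set (E := exp (19 / 40 * M)) in *. set (p := Rpower M (1 / 4)) in *.
  assert (HF : 1 / 6400 * (M * M) <= exp (1 / 40 * M)).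
  { eapply Rle_trans; [|apply exp_ge_sqr; unfold M0 in HM; lra]. right. field. }
  set (F := exp (1 / 40 * M)) in *.
  apply Rmult_le_reg_r with p; [exact Hpp|].
  replace (eps * (2 * c * (E * F) / p) * p) with (E * (2 * c * eps * F)) by (field; lra).
  apply Rle_trans with (E * (C * M)).
  - replace (C * E * p) with (E * (C * p)) by ring. apply Rmult_le_compat_l; [lra|].
    apply Rmult_le_compat_l; lra.
  - apply Rmult_le_compat_l; [lra|].
    assert (Hce : 0 < 2 * c * eps) by (repeat apply Rmult_lt_0_compat; lra).
    apply Rle_trans with (2 * c * eps * (1 / 6400 * (M * M))); [|apply Rmult_le_compat_l; lra].
    assert (H : 6400 * C <= 2 * c * eps * M).
    { replace (6400 * C) with (2 * c * eps * (6400 * C / (2 * c * eps))) by (field; lra).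
      apply Rmult_le_compat_l; [lra|]. unfold M0 in HM. lra. }
    apply (Rmult_le_compat_r M) in H; [|unfold M0 in HM; lra]. lra.
Qed.

Lemma counting_limit al n0 : (1 <= n0)%nat -> (forall j, In (al j) (block K j)) ->
  (forall N, Rsum (seq n0 N)
    (fun n => exp (- (19 / 40) * ln (INR n)) * indic (~ represented n al)) <= 40) ->
  is_lim (fun X => INR (counting (basis al n0) X) / target X) p_infty 1.
Proof.
  intros Hn0 Hal Hmiss. apply is_lim_spec. intros [eps Heps]. simpl.
  set (eta := Rmin 1 (eps / 4)).
  assert (Heta : 0 < eta <= 1) by (unfold eta; split; [apply Rmin_pos; lra|apply Rmin_l]).
  assert (Heta4 : eta <= eps / 4) by apply Rmin_r.
  destruct (eventually_regular K K_pos eta Heta) as [j1 Hj1].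
  destruct (eventually_sqrt_lg_ge (2 * K / eta)) as [j2 Hj2].
  destruct (error_negligible (INR n0 + 42) (eps / 4)) as [X0 HX0]; [pose proof (pos_INR n0); lra|lra|].
  exists (Rmax (Rmax X0 1) (INR (xi K (S (j1 + j2))))). intros X HX.
  assert (H1 : X0 < X) by (eapply Rle_lt_trans; [|exact HX]; eapply Rle_trans; [apply Rmax_l|apply Rmax_l]).
  assert (H2 : 1 < X) by (eapply Rle_lt_trans; [|exact HX]; eapply Rle_trans; [apply Rmax_r|apply Rmax_l]).
  assert (H3 : INR (xi K (S (j1 + j2))) < X) by (eapply Rle_lt_trans; [|exact HX]; apply Rmax_r).
  destruct (block_index X ltac:(lra)) as (J & HJ).
  assert (HJj : (j1 + j2 <= J)%nat).
  { destruct (le_lt_dec (j1 + j2) J) as [|Hlt]; [assumption|exfalso].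
    assert (INR (xi K (S J)) <= INR (xi K (S (j1 + j2))))
      by (apply le_INR, xi_le; [apply K_pos|lia]). lra. }
  destruct (index_vs_target eta J X Heta (Hj1 J ltac:(lia)) (Hj2 J ltac:(lia)) H2 HJ) as [Hu Hl].
  pose proof (target_pos X ltac:(lra)) as Hg. set (g := target X) in *.
  pose proof (counting_lower K al n0 K_pos Hn0 Hal X J ltac:(lra)) as Hlow.
  pose proof (counting_upper K al n0 K_pos Hn0 Hal Hmiss X J ltac:(lra) ltac:(lra)) as Hup.
  set (A := INR (counting (basis al n0) X)) in *.
  specialize (HX0 X H1).
  set (E := exp (19 / 40 * ln X)) in *.
  assert (HE : 1 <= E).
  { unfold E. rewrite <- exp_0 at 1. apply exp_le.
    assert (0 < ln X) by (rewrite <- ln_1; apply ln_increasing; lra). lra. }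
  fold g in HX0. pose proof (pos_INR n0) as Hn0R.
  assert (HnE : INR n0 * 1 <= INR n0 * E) by (apply Rmult_le_compat_l; lra).
  assert (Herr : INR n0 + 2 + 40 * E <= eps / 4 * g) by lra.
  assert (Hge : eta * g <= eps / 4 * g) by (apply Rmult_le_compat_r; lra).
  assert (Hdev : Rabs (A - g) < eps * g).
  { assert (0 < eps * g) by (apply Rmult_lt_0_compat; lra).
    apply Rabs_def1; [lra|].
    assert (HJ0 := pos_INR J).
    assert (eta * INR J <= eta * ((1 + eta) * g)) by (apply Rmult_le_compat_l; lra).
    assert (eta * ((1 + eta) * g) <= eta * (2 * g)).
    { apply Rmult_le_compat_l; [lra|]. apply Rmult_le_compat_r; lra. }
    lra. }
  replace (A / g - 1) with ((A - g) * / g) by (field; lra).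
  rewrite Rabs_mult, (Rabs_pos_eq (/ g)) by (left; apply Rinv_0_lt_compat, Hg).
  apply Rmult_lt_reg_r with g; [exact Hg|]. rewrite Rmult_assoc, Rinv_l by lra. lra.
Qed.

End Asymptotics.

Theorem theorem6p8 (c : R) (hc : Rpower (4 * PI / 3) (1 / 4) < c) :
  exists A : nat -> bool,
    sumsq_products_all A /\
    is_lim
      (fun X : R => INR (counting A X) /
                    (2 * c * sqrt X / Rpower (ln X) (1 / 4)))
      p_infty 1.
Proof.
  (* From [pi >= 3] one gets [c^4 >= 4], hence [K^2 = 2 / (16 c^4) <= 1/32]; nothing more precise
     about [pi] enters. *)
  pose proof PI2_3_2 as HPI. unfold PI2 in HPI.
  assert (Hb : 4 <= 4 * PI / 3) by lra.
  set (b := 4 * PI / 3) in *. set (p := Rpower b (1 / 4)) in *.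
  assert (Hp : 0 < p) by apply Rpower_quarter_pos.
  assert (Hc2 : 2 <= c * c).
  { apply Rle_trans with (p * p); [|apply Rmult_le_compat; lra].
    unfold p. rewrite Rpower_quarter_sqr by lra.
    rewrite <- (sqrt_square 2) by lra. apply sqrt_le_1_alt. lra. }
  set (K := sqrt 2 / (4 * (c * c))).
  assert (HK32 : 32 * (K * K) <= 1).
  { assert (Hs : sqrt 2 * sqrt 2 = 2) by (apply sqrt_sqrt; lra).
    replace (K * K) with ((sqrt 2 * sqrt 2) / (16 * ((c * c) * (c * c)))) by (unfold K; field; lra).
    rewrite Hs. apply Rmult_le_reg_r with (16 * ((c * c) * (c * c))); [nra|].
    replace (32 * (2 / (16 * (c * c * (c * c)))) * (16 * (c * c * (c * c)))) with 64 by (field; lra).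
    nra. }
  assert (HK : 0 < K) by (apply (K_pos c); [lra|reflexivity]).
  destruct (few_missed K HK HK32) as (al & n0 & Hn0 & Hal & Hmiss).
  exists (basis al n0). split; [apply basis_sumsq, Hn0|].
  apply (counting_limit c K); auto. lra.
Qed.
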